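(* Let $f:\mathbb{R}\to\mathbb{R}$ be of bounded variation on $[a,b]$ for each $-\infty<a<b<\infty$. Suppose there are real polynomials $p_+(x)=\sum_{k=0}^{n_+}a_{+k}x^k$ and $p_-(x)=\sum_{k=0}^{n_-}a_{-k}x^k$ such that $f(x)\sim p_+(x)$ as $x\to\infty$ and $f(x)\sim p_-(x)$ as $x\to-\infty$. Let $$g(x)=f(x)-H(x)p_+(x)-H(-x)p_-(x),$$ and suppose that $g$ is of bounded variation on $\mathbb{R}$ with $\lim_{|x|\to\infty}g(x)=0$. Then, as distributions, $$\hat f(s)=\hat g(s)+\sum_{k=0}^{n_+}a_{+k}\left[\pi i^k\delta^{(k)}(s)+\frac{k!}{(is)^{k+1}}\right]+\sum_{k=0}^{n_-}a_{-k}\left[\pi i^k\delta^{(k)}(s)-\frac{k!}{(is)^{k+1}}\right].$$ And, for each $x\in\mathbb{R}$, $$\frac{f(x-)+f(x+)}{2}=\frac{1}{2\pi}\lim_{\substack{T\to\infty\\ S\to0^+}}\int_{S<|s|<T}e^{ixs}\hat g(s)\,ds+H(x)p_+(x)+H(-x)p_-(x),$$ where in this last formula $\hat g(s)=\int_{-\infty}^{\infty}e^{-ist}g(t)\,dt$ for $s\neq0$.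
   Context: $H$ is the Heaviside step function: $H(x)=1$ for $x>0$, $H(0)=1/2$, $H(x)=0$ for $x<0$. $f(x\pm)$ are the one-sided limits of $f$ at $x$. The relation $f\sim p$ is asymptotic equivalence, $f-p=o(p)$. The coefficients of $p_+$ and $p_-$ are two unrelated families $a_{+k}$ and $a_{-k}$ indexed by the sign and $k$ (so $a_{+0}$ and $a_{-0}$ may differ). The Fourier transform convention is $\hat\phi(s)=\int_{-\infty}^\infty e^{-ist}\phi(t)\,dt$, extended to tempered distributions by $\langle\hat u,\phi\rangle=\langle u,\hat\phi\rangle$. $\delta^{(k)}$ is the $k$-th derivative of the Dirac distribution at $0$. The distribution $1/s$ is $\phi\mapsto\int_0^\infty\frac{\phi(x)-\phi(-x)}{x}\,dx$, and $1/s^{k+1}$ is the distribution $\frac{(-1)^k}{k!}\frac{d^k}{ds^k}\frac1s$. In the inversion formula the integral $\int_{-\infty}^\infty e^{-ist}g(t)\,dt$ ($s\neq0$) is understood as the (possibly conditionally convergent) improper integral $\lim_{A\to-\infty,\,B\to\infty}\int_A^B e^{-ist}g(t)\,dt$, and the limits $T\to\infty$, $S\to0^+$ are taken independently. *)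

(* Defs.v *)
From HB Require Import structures.
From mathcomp Require Import all_boot all_order all_algebra.
From mathcomp Require Import all_classical all_reals all_analysis.
From mathcomp Require Import complex.

Set Implicit Arguments.
Unset Strict Implicit.
Unset Printing Implicit Defensive.

Import Order.TTheory GRing.Theory Num.Theory.
Import numFieldNormedType.Exports.

Local Open Scope classical_set_scope.
Local Open Scope ring_scope.
Local Open Scope complex_scope.

(* Needed by the notation f ~_F g at F = +oo and F = -oo. *)
Canonical pinfty_filter_on (R : realType) :=
  FilterType (pinfty_nbhs R) _.
Canonical ninfty_filter_on (R : realType) :=
  FilterType (ninfty_nbhs R) _.

Section real_functions.
Context {R : realType}.
Implicit Types (g : R -> R).

Definition heaviside (x : R) : R :=
  if 0 < x then 1 else if x == 0 then 2^-1 else 0.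

(* The variations of g over all compact intervals have a common bound. *)
Definition bounded_variation_line g :=
  has_ubound [set v | exists a b : R, a <= b /\ variations a b g v].

End real_functions.

(* R[i] is not a normed module over R in the libraries, so integrals and
   derivatives of functions R -> R[i] are taken componentwise. *)
Section complex_valued.
Context {R : realType}.
Implicit Types (D : set R) (h phi : R -> R[i]).

Definition cintegrable D h :=
  (@lebesgue_measure R).-integrable D (fun x => (complex.Re (h x))%:E) /\
  (@lebesgue_measure R).-integrable D (fun x => (complex.Im (h x))%:E).

Definition cintegral D h : R[i] :=
  (\int[@lebesgue_measure R]_(x in D) complex.Re (h x)) +i*
  (\int[@lebesgue_measure R]_(x in D) complex.Im (h x)).

Definition cderivable h (x : R) :=
  derivable (fun y => complex.Re (h y)) x 1 /\
  derivable (fun y => complex.Im (h y)) x 1.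

Definition cderive h : R -> R[i] := fun x =>
  derive1 (fun y => complex.Re (h y)) x +i* derive1 (fun y => complex.Im (h y)) x.

(* e^{i x} *)
Definition expi (x : R) : R[i] := cos x +i* sin x.

Definition fourier phi : R -> R[i] :=
  fun s => cintegral setT (fun t => expi (- (s * t)) * phi t).

(* The integral of e^{-ist} g(t) over [A, B], as a function of (A, B). *)
Definition fourier_partial (g : R -> R) (s : R) (AB : R * R) : R[i] :=
  cintegral `[AB.1, AB.2] (fun t => expi (- (s * t)) * (g t)%:C).

(* A --> -oo and B --> +oo independently. *)
Definition fourier_improper (g : R -> R) (s : R) : R[i] :=
  lim ((fourier_partial g s AB : R[i]^o)
         @[AB --> filter_prod (ninfty_nbhs R) (pinfty_nbhs R)]).

Definition annulus (S T : R) : set R := [set s | S < `|s| < T].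

End complex_valued.

(* A distribution is represented by a functional on all functions R -> R[i];
   only its values on Schwartz functions are meaningful. *)
Section distributions.
Context {R : realType}.
Implicit Types (phi psi : R -> R[i]).

Definition weighted_derivative (j k : nat) phi (x : R) : R :=
  `|x| ^+ j * ComplexField.Normc.normc (iter k cderive phi x).

Definition schwartz phi :=
  (forall k x, cderivable (iter k cderive phi) x) /\
  (forall j k, has_ubound (range (weighted_derivative j k phi))).

Definition schwartz_seminorm (j k : nat) phi : R :=
  sup (range (weighted_derivative j k phi)).

Definition functional := (R -> R[i]) -> R[i].
Implicit Types (u v : functional).

Definition tempered u :=
  (forall (c : R[i]) phi psi, schwartz phi -> schwartz psi ->
     u (fun x => c * phi x + psi x) = c * u phi + u psi) /\
  (exists (C : R) (N : nat), forall phi, schwartz phi ->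
     ComplexField.Normc.normc (u phi) <=
     C * \sum_(j < N.+1) \sum_(k < N.+1) schwartz_seminorm j k phi).

Definition regular (f : R -> R) : functional :=
  fun phi => cintegral setT (fun t => (f t)%:C * phi t).

Definition defines_tempered (f : R -> R) :=
  (forall phi, schwartz phi -> cintegrable setT (fun t => (f t)%:C * phi t)) /\
  tempered (regular f).

Definition dist_fourier u : functional := fun phi => u (fourier phi).

Definition dist_derive u : functional := fun phi => - u (cderive phi).

Definition dirac_dist : functional := fun phi => phi 0.

(* The distribution 1/s; the integral converges absolutely on Schwartz functions. *)
Definition pv_inv : functional := fun phi =>
  cintegral `]0, +oo[ (fun x => (x^-1)%:C * (phi x - phi (- x))).

(* The distribution 1/s^{k+1}, with exponent k.+1. *)
Definition inv_pow (k : nat) : functional := fun phi =>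
  (-1) ^+ k / (k`!)%:R * iter k dist_derive pv_inv phi.

End distributions.

(* Main.v *)
Require Import Defs.
From HB Require Import structures.
From mathcomp Require Import all_boot all_order all_algebra.
From mathcomp Require Import all_classical all_reals all_analysis.
From mathcomp Require Import measurable_realfun complex ring lra.

Set Implicit Arguments.
Unset Strict Implicit.
Unset Printing Implicit Defensive.

Import Order.TTheory GRing.Theory Num.Theory.
Import numFieldNormedType.Exports.

Local Open Scope classical_set_scope.
Local Open Scope ring_scope.
Local Open Scope complex_scope.

(** Write H for the Heaviside function, and call g-hat the transform of g. Since
    f = g + H p_+ + H(-.) p_- , both formulas split along this sum. The function g
    is bounded, being of bounded variation with limits 0, so f grows at most
    polynomially and everything in sight is tempered.

    The distributional formula reduces to the transform of H(t) t^k and of its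
    mirror image. The factor t^k is traded for k derivatives of the test function
    ([regular_power_fourier]), which leaves the case k = 0: for a Schwartz
    function psi, the integral of psi-hat over the positive half-line is
    pi psi(0) - i <1/s, psi> ([heaviside_fourier]). Integrating psi-hat over [0, n]
    and exchanging the integrals produces the kernels sin(n x) / x and
    (1 - cos(n x)) / x against psi. The first concentrates at 0
    ([dirichlet_rapid]); in the second the oscillating term disappears by the
    Riemann-Lebesgue lemma and the odd part of psi over x remains
    ([half_line_cosT], [half_line_sinT]).

    For the inversion formula, center the integral at x. Each of g(x + u) and
    g(x - u), for u > 0, is a difference of nonincreasing functions h that tend to
    0 at infinity ([bounded_variation_line_decomp]). The second mean value theorem
    ([second_mean_value]) shows that the integral of h(u) cos(s u) converges, with
    a tail beyond N of at most 2 h(N) / |s|. This is uniform on S <= |s|, so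
    integration in s over S < s < T may be done under the integral sign and gives
    the limit over N of the integrals of h(u) (sin(T u) - sin(S u)) / u over
    [0, N]. As T grows the first term tends to pi / 2 times h(0+), and as S tends
    to 0 the second one tends to pi / 2 times the limit of h at infinity, which is
    0; both limits are uniform in large N ([dirichlet_int_large],
    [dirichlet_int_small]). They rest on the estimate 2 / (T Y) for the distance
    between pi / 2 and the integral of sin(T u) / u over [0, Y]
    ([sine_int_pihalf]). The annulus being symmetric, only the part of the
    transform that is even in s contributes. *)

(** * Invariance of Lebesgue measure under translation and reflection *)

Section invariance.
Context {R : realType}.
Notation mu := (@lebesgue_measure R).

Definition preserves (p : R -> R) := measurable_fun setT p /\
  forall A, measurable A -> mu (p @^-1` A) = mu A.

(** Lebesgue measure is determined by its values on half-open intervals. *)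
Lemma preserves_itv (p : R -> R) : measurable_fun setT p ->
  (forall a b, a < b -> mu (p @^-1` `]a, b]) = (b - a)%:E) -> preserves p.
Proof.
move=> mp pab; split=> // A mA.
pose q : measurableTypeR R -> measurableTypeR R := p.
have mq : measurable_fun setT q by [].
pose nu : {measure set (measurableTypeR R) -> \bar R} := pushforward mu q.
apply/esym.
rewrite (@lebesgue_measure_unique R (nu mq))//= => _ [[a b] _ <-].
rewrite /nu/= /pushforward/= lebesgue_measure_itv/= lte_fin.
case: ltP => ab.
  by rewrite -EFinB -(pab a b ab).
rewrite set_itv_ge//; last by rewrite bnd_simp -leNgt.
by rewrite preimage_set0 measure0.
Qed.

Lemma preserves_opp : preserves (@GRing.opp R).
Proof.
apply: preserves_itv; first by apply: continuous_measurable_fun; exact: opp_continuous.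
move=> a b ab.
rewrite (_ : _ @^-1` _ = `[- b, - a[%classic).
  by rewrite lebesgue_measure_itv/= lte_fin ltrN2 ab -EFinB opprK addrC.
by apply/seteqP; split=> x /=; rewrite !in_itv/=; lra.
Qed.

Lemma preserves_shift (c : R) : preserves (fun x => c + x).
Proof.
apply: preserves_itv; first exact: measurable_funD.
move=> a b ab.
rewrite (_ : _ @^-1` _ = `]a - c, b - c]%classic).
  rewrite lebesgue_measure_itv/= lte_fin ltrBlDr subrK ab -EFinB.
  by congr EFin; lra.
by apply/seteqP; split=> x /=; rewrite !in_itv/=; lra.
Qed.

Lemma preserves_comp p q : preserves p -> preserves q -> preserves (p \o q).
Proof.
move=> [mp pp] [mq qq]; split; first exact: measurableT_comp.
move=> A mA; rewrite comp_preimage qq ?pp//.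
by rewrite -[_ @^-1` _]setTI; exact: mp.
Qed.

Lemma preserves_ge0_integral (p : R -> R) (D : set R) (f : R -> \bar R) :
  preserves p -> measurable D ->
  measurable_fun D f -> (forall x, 0 <= f x)%E ->
  (\int[mu]_(x in p @^-1` D) f (p x) = \int[mu]_(x in D) f x)%E.
Proof.
move=> [mp pp] mD mf f0.
have mp' : measurable_fun [set: measurableTypeR R] (p : measurableTypeR R -> measurableTypeR R) by [].
rewrite -(ge0_integral_pushforward mp' mu mD mf)//.
by apply: eq_measure_integral => A mA _; exact: pp.
Qed.

Lemma preserves_integrable (p : R -> R) (D : set R) (f : R -> R) :
  preserves p -> measurable D ->
  mu.-integrable D (EFin \o f) ->
  mu.-integrable (p @^-1` D) (EFin \o (f \o p)).
Proof.
move=> pp mD /integrableP[mf fi]; apply/integrableP; split.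
  apply: (@measurable_comp _ _ _ _ _ _ D (EFin \o f) _ p mD) => //.
    by move=> _ [x /= Dx <-].
  by apply: measurable_funTS; case: pp.
apply: le_lt_trans fi; rewrite -(@preserves_ge0_integral p D (abse \o (EFin \o f)) pp mD)//.
  exact: measurableT_comp.
by move=> x; exact: abse_ge0.
Qed.

Lemma preserves_Rintegral (p : R -> R) (D : set R) (f : R -> R) :
  preserves p -> measurable D ->
  measurable_fun D f ->
  \int[mu]_(x in p @^-1` D) f (p x) = \int[mu]_(x in D) f x.
Proof.
move=> pp mD mf; rewrite /Rintegral; congr fine.
have mf' : measurable_fun D (EFin \o f) by exact/measurable_EFinP.
rewrite integralE [RHS]integralE.
rewrite -(preserves_ge0_integral pp mD (measurable_funepos mf'))//
   -(preserves_ge0_integral pp mD (measurable_funeneg mf'))//.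
by congr (_ - _)%E; apply: eq_integral => x _; rewrite unlock.
Qed.

End invariance.

(** * Integrability and exchange of integrals *)

Section integration_tools.
Context {R : realType}.
Notation mu := (@lebesgue_measure R).

Lemma integrable_measurable (D : set R) (w : R -> R) :
  mu.-integrable D (EFin \o w) -> measurable_fun D w.
Proof. by move=> /measurable_int /measurable_EFinP. Qed.

Lemma integrable_Mbounded (D : set R) (w k : R -> R) (C : R) :
  measurable D -> mu.-integrable D (EFin \o w) -> measurable_fun D k ->
  (forall u, D u -> `|k u| <= C) ->
  mu.-integrable D (fun u => (w u * k u)%:E).
Proof.
move=> mD wi mk kC.
have -> : (fun u => (w u * k u)%:E) = ((EFin \o w) \* (EFin \o k))%E.
  by apply/funext => u /=; rewrite EFinM.
apply: integrableMl => //.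
exists C; split; first exact: num_real.
by move=> M CM u Du; apply: le_trans (kC _ Du) (ltW CM).
Qed.

Lemma integrable_bounded (D : set R) (w : R -> R) (C : R) :
  measurable D -> (mu D < +oo)%E -> measurable_fun D w ->
  (forall u, D u -> `|w u| <= C) -> mu.-integrable D (EFin \o w).
Proof.
move=> mD Dfin mw wC; apply: measurable_bounded_integrable => //.
exists C; split; first exact: num_real.
by move=> M CM u Du; apply: le_trans (wC _ Du) (ltW CM).
Qed.

Lemma integrable_addr (D : set R) (f g : R -> R) : measurable D ->
  mu.-integrable D (EFin \o f) -> mu.-integrable D (EFin \o g) ->
  mu.-integrable D (fun x => (f x + g x)%:E).
Proof.
by move=> mD fi gi; apply: eq_integrable (integrableD _ fi gi) => //.
Qed.

Lemma integrable_subr (D : set R) (f g : R -> R) : measurable D ->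
  mu.-integrable D (EFin \o f) -> mu.-integrable D (EFin \o g) ->
  mu.-integrable D (fun x => (f x - g x)%:E).
Proof.
by move=> mD fi gi; apply: eq_integrable (integrableB _ fi gi) => //.
Qed.

Lemma integrable_mull (D : set R) (c : R) (f : R -> R) : measurable D ->
  mu.-integrable D (EFin \o f) ->
  mu.-integrable D (fun x => (c * f x)%:E).
Proof.
by move=> mD fi; apply: eq_integrable (integrableZl _ c fi) => //.
Qed.

Lemma integrable_mulr (D : set R) (c : R) (f : R -> R) : measurable D ->
  mu.-integrable D (EFin \o f) ->
  mu.-integrable D (fun x => (f x * c)%:E).
Proof.
by move=> mD fi; apply: eq_integrable (integrableZr _ c fi) => //.
Qed.

Lemma RintegralE (D : set R) (w : R -> R) : measurable D ->
  mu.-integrable D (EFin \o w) ->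
  (\int[mu]_(x in D) w x)%:E = (\int[mu]_(x in D) (w x)%:E)%E.
Proof. by move=> mD wi; rewrite /Rintegral fineK//; exact: integrable_fin_num. Qed.

Lemma le_Rintegral_bound (D : set R) (w v : R -> R) : measurable D ->
  mu.-integrable D (EFin \o w) -> mu.-integrable D (EFin \o v) ->
  (forall x, D x -> `|w x| <= v x) ->
  `|\int[mu]_(x in D) w x| <= \int[mu]_(x in D) v x.
Proof.
move=> mD wi vi wv; apply: (le_trans (le_normr_Rintegral _ wi)) => //.
apply: le_Rintegral => //; exact: integrable_norm.
Qed.

(** Fubini for a bounded kernel against an integrable weight: w(u) k(s, u) is
    dominated by C |w(u)|, which is integrable on D1 x D2 because D1 has finite
    measure. Every exchange of integrals below is an instance. *)
Lemma kernel_Fubini (D1 D2 : set R) (w : R -> R) (k : R -> R -> R) (C : R) :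
  measurable D1 -> (mu D1 < +oo)%E -> measurable D2 ->
  mu.-integrable D2 (EFin \o w) ->
  measurable_fun setT (fun z : R * R => k z.1 z.2) ->
  (forall s u, D1 s -> D2 u -> `|k s u| <= C) ->
  [/\ mu.-integrable D1 (fun s => (\int[mu]_(u in D2) (w u * k s u))%:E),
      mu.-integrable D2 (fun u => (w u * \int[mu]_(s in D1) k s u)%:E) &
      \int[mu]_(s in D1) (\int[mu]_(u in D2) (w u * k s u)) =
      \int[mu]_(u in D2) (w u * \int[mu]_(s in D1) k s u)].
Proof.
move=> mD1 D1fin mD2 wi mk kC.
(* The integrand, extended by 0 outside D1 x D2. *)
pose F (z : R * R) : \bar R := (\1_D1 z.1 * ((w \_ D2) z.2 * k z.1 z.2))%:E.
have mw : measurable_fun D2 w by exact: integrable_measurable.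
have mw' : measurable_fun setT (w \_ D2) by move/measurable_restrictT : mw; apply.
have mF : measurable_fun setT F.
  apply/measurable_EFinP; apply: measurable_funM.
    by apply: measurableT_comp => //; exact: measurable_fst.
  apply: measurable_funM => //.
  by apply: measurableT_comp => //; exact: measurable_snd.
have mk1 s : measurable_fun setT (k s).
  have -> : k s = (fun z : R * R => k z.1 z.2) \o (fun u => (s, u)) by [].
  by apply: measurableT_comp => //; exact: measurable_fun_pair.
have mk2 u : measurable_fun setT (k ^~ u).
  have -> : k ^~ u = (fun z : R * R => k z.1 z.2) \o (fun s => (s, u)) by [].
  by apply: measurableT_comp => //; exact: measurable_fun_pair.
have wki s : D1 s -> mu.-integrable D2 (fun u => (w u * k s u)%:E).
  move=> D1s; apply: (@integrable_Mbounded _ _ _ C) => //.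
    exact: measurable_funTS.
  by move=> u D2u; exact: kC.
have ki u : D2 u -> mu.-integrable D1 (EFin \o (k ^~ u)).
  move=> D2u; apply: (@integrable_bounded _ _ C) => //.
    exact: measurable_funTS.
  by move=> s D1s; exact: kC.
have F1 s : (\int[mu]_u F (s, u) =
    ((fun s => (\int[mu]_(u in D2) (w u * k s u))%:E) \_ D1) s)%E.
  rewrite patchE; case: ifPn => sD1; last first.
    under eq_integral do rewrite /F/= indicE (negbTE sD1) mul0r.
    by rewrite integral0.
  rewrite RintegralE//; last by apply: wki; exact/set_mem.
  rewrite [RHS]integral_mkcond; apply: eq_integral => u _.
  by rewrite /F/= indicE sD1 mul1r /patch; case: ifPn => // _; rewrite mul0r.
have F2 u : (\int[mu]_s F (s, u) =
    ((fun u => (w u * \int[mu]_(s in D1) k s u)%:E) \_ D2) u)%E.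
  rewrite patchE; case: ifPn => uD2; last first.
    under eq_integral do rewrite /F/= patchE (negbTE uD2) mul0r mulr0.
    by rewrite integral0.
  have uD2' : D2 u by exact/set_mem.
  rewrite -RintegralZl//; last exact: ki.
  rewrite RintegralE//; last first.
    under eq_fun do rewrite mulrC.
    apply: (@integrable_Mbounded _ _ _ `|w u|) => //; exact: ki.
  rewrite [RHS]integral_mkcond; apply: eq_integral => s _.
  rewrite /F/= patchE uD2 indicE /patch.
  by case: ifPn => // _; rewrite ?mul1r ?mul0r.
have iF : (mu \x mu)%E.-integrable setT F.
  apply/integrable12ltyP => //.
  have K0 : (\int[mu]_(u in D2) `|(w u)%:E| < +oo)%E by move/integrableP: wi => [].
  pose K := (`|C| * fine (\int[mu]_(u in D2) `|(w u)%:E|))%R.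
  apply: (@le_lt_trans _ _ (\int[mu]_(s in D1) (cst K%:E) s)%E); last first.
    by rewrite integral_cst// lte_mul_pinfty// lee_fin mulr_ge0// fine_ge0// integral_ge0.
  rewrite [leRHS]integral_mkcond; apply: ge0_le_integral => //.
  - by move=> s _; exact: integral_ge0.
    have := @measurable_fun_fubini_tonelli_F _ _ (measurableTypeR R) (measurableTypeR R) R mu (abse \o F). apply => //=.
    exact: measurableT_comp.
  - have : measurable_fun D1 (cst K%:E : R -> \bar R) by exact: measurable_cst. by move/measurable_restrictT; apply.
  move=> s _; rewrite patchE; case: ifPn => sD1; last first.
    under eq_integral do rewrite /F/= indicE (negbTE sD1) mul0r normr0.
    by rewrite integral0.
  rewrite /cst /K EFinM fineK; last by rewrite ge0_fin_numE// integral_ge0.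
  rewrite -ge0_integralZl//; last first.
    by apply: measurableT_comp => //; exact/measurable_EFinP.
  rewrite [leRHS]integral_mkcond; apply: ge0_le_integral => //.
  - apply: measurableT_comp => //.
    apply: (@measurableT_comp _ _ _ _ _ _ F) => //; exact: measurable_fun_pair.
  - have mm : measurable_fun D2 (fun u => `|C| * `|w u|).
      by apply: measurable_funM => //; exact: measurableT_comp.
    have mm' : measurable_fun D2 (fun u => (`|C|%:E * `|(w u)%:E|)%E).
      by apply/measurable_EFinP.
    by move/measurable_restrictT : mm'; apply.
  move=> u _; rewrite /F/= indicE sD1 mul1r /patch; case: ifPn => uD2; last first.
    by rewrite mul0r normr0.
  rewrite -EFinM lee_fin normrM mulrC ler_wpM2r//.
  by rewrite (le_trans (kC s u _ _))//; [exact/set_mem|exact/set_mem|exact: ler_norm].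
split.
- have H : mu.-integrable setT
     ((fun s => (\int[mu]_(u in D2) (w u * k s u))%:E) \_ D1).
    by apply: eq_integrable (integrable_fubini_F iF) => // s _; exact: F1.
  by move/integrable_restrict : H; rewrite setTI; exact.
- have i2 : mu.-integrable D2 (fun u => (w u * (C * fine (mu D1)))%:E).
    exact: integrable_mulr.
  apply: le_integrable i2 => //.
    have H : measurable_fun setT
       ((fun u => (w u * \int[mu]_(s in D1) k s u)%:E) \_ D2).
      by apply: eq_measurable_fun (measurable_fubini_G iF) => // u _; exact: F2.
    exact/measurable_restrictT.
  move=> u D2u; rewrite /= lee_fin normrM [leRHS]normrM ler_wpM2l//.
  have -> : C * fine (mu D1) = \int[mu]_(s in D1) (cst C s : R) by rewrite Rintegral_cst.
  apply: le_trans (ler_norm _); apply: le_Rintegral_bound => //; first exact: ki.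
    by apply: (@integrable_bounded _ _ `|C|) => //; exact: measurable_cst.
  by move=> s D1s; exact: kC.
have := Fubini iF.
under eq_integral do rewrite F1.
under [in X in _ = X -> _]eq_integral do rewrite F2.
by rewrite -!integral_mkcond /Rintegral => ->.
Qed.

End integration_tools.

(** * Truncation, splitting and the second mean value theorem *)

Section interval_integrals.
Context {R : realType}.
Notation mu := (@lebesgue_measure R).

Lemma mu_itv_lty (a b : R) : (mu `[a, b] < +oo)%E.
Proof. by rewrite lebesgue_measure_itv/=; case: ifP => _; rewrite -?EFinB ltry. Qed.

Lemma fine_mu_itv (a b : R) : a <= b -> fine (mu `[a, b]) = b - a.
Proof.
rewrite lebesgue_measure_itv/= lte_fin le_eqVlt => /predU1P[->|->//].
by rewrite ltxx subrr.
Qed.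

Lemma Rintegral_cst_itv (a b c : R) : a <= b ->
  \int[mu]_(x in `[a, b]) c = c * (b - a).
Proof.
by move=> ab; rewrite Rintegral_cst//; congr (_ * _); exact: fine_mu_itv.
Qed.

(** Dominated convergence for the truncations of w to E n, with |w| as bound. *)
Lemma Rintegral_exhaust (D : set R) (E : nat -> set R) (w : R -> R) :
  measurable D -> (forall n, measurable (E n)) ->
  mu.-integrable D (EFin \o w) ->
  (forall x, D x -> \forall n \near \oo, E n x) ->
  \int[mu]_(x in D `&` E n) w x @[n --> \oo] --> \int[mu]_(x in D) w x.
Proof.
move=> mD mE wi DE.
have mw : measurable_fun D w by exact: integrable_measurable.
have mwE n : measurable_fun D (w \_ (E n)).
  apply/(measurable_restrict w (mE n) mD).
  by apply: measurable_funS mw => //; exact: subIsetl.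
have m1 n : measurable_fun D (fun x => ((w \_ (E n)) x)%:E).
  exact/measurable_EFinP.
have m2 : measurable_fun D (EFin \o w) by exact/measurable_EFinP.
have lim_w : {ae mu, forall x, D x ->
    ((w \_ (E n)) x)%:E @[n --> \oo] --> (EFin \o w) x}.
  apply: aeW => x Dx; apply: cvg_near_cst.
  near=> n => /=; rewrite patchE mem_set//; near: n; exact: DE.
have le_w : {ae mu, forall x (n : nat), D x ->
    (`|((w \_ (E n)) x)%:E| <= (`|w x|)%:E)%E}.
  apply: aeW => x n Dx /=; rewrite lee_fin patchE.
  by case: ifPn => // _; rewrite normr0.
have [_ _] := @dominated_convergence _ _ _ mu D mD _ _ (fun x => `|w x|%:E) m1 m2
  lim_w (integrable_norm wi) le_w.
rewrite -RintegralE// => /fine_cvg; apply: cvg_trans.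
apply: near_eq_cvg; near=> n.
by rewrite /= Rintegral_mkcondr.
Unshelve. all: by end_near. Qed.

Lemma Rintegral_split (a b c : R) (w : R -> R) : a <= b -> b <= c ->
  mu.-integrable `[a, c] (EFin \o w) ->
  \int[mu]_(x in `[a, c]) w x =
  \int[mu]_(x in `[a, b]) w x + \int[mu]_(x in `[b, c]) w x.
Proof.
move=> ab bc wi.
rewrite -[X in _ = _ + X]Rintegral_itv_obnd_cbnd; last first.
  apply: integrableS wi => // x /=; rewrite !in_itv/= => /andP[bx ->].
  by rewrite (le_trans ab (ltW bx)).
by rewrite -(Rintegral_itvB wi) ?bnd_simp// addrC subrK.
Qed.

(** By the layer cake formula h(t) is the integral of 1 over 0 <= s <= h(t). After
    exchanging integrals, the level sets of a nonincreasing function are initial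
    segments of [a, b], over which phi integrates to at most M. *)
Lemma second_mean_value (a b M : R) (h phi : R -> R) : a <= b ->
  (forall x y, x <= y -> h y <= h x) -> 0 <= h b ->
  mu.-integrable `[a, b] (EFin \o phi) ->
  (forall y, a <= y <= b -> `|\int[mu]_(t in `[a, y]) phi t| <= M) ->
  `|\int[mu]_(t in `[a, b]) (phi t * h t)| <= M * h a.
Proof.
move=> ab ndh hb0 iphi phiM.
have M0 : 0 <= M by rewrite (le_trans _ (phiM a _))// ab lexx.
have ha0 : 0 <= h a by exact: le_trans (ndh _ _ ab).
(* The indicator of s <= h t. *)
pose k (s t : R) : R := \1_[set z : R | 0 <= z] (h t - s).
have mh : measurable_fun setT h by exact: nonincreasing_measurable.
have mk : measurable_fun setT (fun z : R * R => k z.1 z.2).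
  apply: measurableT_comp; first by apply: measurable_indic; rewrite -set_itvcy.
  by apply: measurable_funB; [apply: measurableT_comp => //; exact: measurable_snd
    |exact: measurable_fst].
have kE s t : k s t = ((s <= h t)%R)%:R.
  rewrite /k indicE -subr_ge0; case: (boolP (0 <= h t - s)) => H.
    by rewrite mem_set.
  by rewrite memNset//=; exact/negP.
have k1 s t : `|k s t| <= 1.
  by rewrite kE ger0_norm//; case: (s <= h t); rewrite ?ler01.
have [Gi _ GE] := @kernel_Fubini R `[0, h a] `[a, b] phi k 1 (measurable_itv _)
  (mu_itv_lty _ _) (measurable_itv _) iphi mk (fun s t _ _ => k1 s t).
have -> : \int[mu]_(t in `[a, b]) (phi t * h t) =
    \int[mu]_(t in `[a, b]) (phi t * \int[mu]_(s in `[0, h a]) k s t).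
  apply: eq_Rintegral => t; rewrite inE/= in_itv/= => /andP[at_ tb]; congr *%R.
  have ht0 : 0 <= h t by exact: le_trans (ndh _ _ tb).
  transitivity (\int[mu]_(s in `[0, h a] `&` `[0, h t]) (cst 1 s : R)).
    rewrite (_ : _ `&` _ = `[0, h t]%classic); last first.
      apply/seteqP; split=> x /=; rewrite !in_itv/= ; first by case.
      move=> /andP[-> xh]; rewrite xh (le_trans xh)//; exact: ndh.
    by rewrite Rintegral_cst_itv// mul1r subr0.
  rewrite Rintegral_mkcondr; apply: eq_Rintegral => s.
  rewrite inE/= in_itv/= => /andP[s0 _]; rewrite kE patchE.
  case: (boolP (s <= h t)) => sh.
    by rewrite mem_set//= in_itv/= s0.
  by rewrite memNset//= in_itv/= s0; exact/negP.
rewrite -GE.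
have : \int[mu]_(x in `[0, h a]) (cst M x) = M * h a.
  by rewrite Rintegral_cst_itv// subr0.
move=> <-; apply: le_Rintegral_bound => //.
  apply: (@integrable_bounded _ _ _ M) => //; first exact: mu_itv_lty.
  by move=> u _; rewrite /cst ger0_norm.
move=> s; rewrite /= in_itv/= => /andP[s0 sha].
have -> : \int[mu]_(u in `[a, b]) (phi u * k s u) =
    \int[mu]_(u in `[a, b] `&` [set u | s <= h u]) phi u.
  rewrite Rintegral_mkcondr; apply: eq_Rintegral => u _.
  rewrite kE patchE; case: (boolP (s <= h u)) => sh.
    by rewrite mem_set// mulr1.
  by rewrite memNset ?mulr0//=; exact/negP.
set A := _ `&` _.
have Aa : A a by split => //=; rewrite in_itv/= lexx.
have supA : has_sup A.
  by split; [exists a|exists b => x [/=]; rewrite in_itv/= => /andP[]].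
(* A is `[a, c] or `[a, c[, which have the same integral. *)
pose c := sup A.
have ac : a <= c by exact: sup_upper_bound.
have cb : c <= b by apply: ge_sup; [exists a|move=> x [/=]; rewrite in_itv/= => /andP[]].
have ltA x : a <= x -> x < c -> A x.
  move=> ax xc; have [y Ay xy] : exists2 y, A y & x < y by apply: sup_gt => //; exists a.
  split => /=; first by rewrite in_itv/= ax (le_trans (ltW xc)).
  by case: Ay => _ /= sy; apply: le_trans sy _; exact/ndh/ltW.
have leA x : A x -> a <= x <= c.
  move=> Ax; rewrite sup_upper_bound// andbT.
  by case: Ax; rewrite /= in_itv/= => /andP[].
suff -> : \int[mu]_(u in A) phi u = \int[mu]_(u in `[a, c]) phi u.
  by apply: phiM; rewrite ac cb.
have [Ac|nAc] := pselect (A c).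
  congr (Rintegral mu _ _); apply/seteqP; split=> x /=; rewrite in_itv/=.
    exact: leA.
  by move=> /andP[ax]; rewrite le_eqVlt => /predU1P[->//|]; exact: ltA.
rewrite -Rintegral_itv_bndo_bndc; last first.
  apply: integrableS iphi => // x /=; rewrite !in_itv/= => /andP[-> xc].
  exact: le_trans (ltW xc) cb.
congr (Rintegral mu _ _); apply/seteqP; split=> x /=; rewrite in_itv/=.
  move=> Ax; have /andP[-> ] := leA _ Ax; rewrite le_eqVlt => /predU1P[xc|//].
  by move: Ax; rewrite xc.
by move=> /andP[ax]; exact: ltA.
Qed.

End interval_integrals.

(** * The sine integral *)

Section sine_integral.
Context {R : realType}.
Notation mu := (@lebesgue_measure R).

Lemma continuous_integrable_itv (a b : R) (f : R -> R) : continuous f ->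
  mu.-integrable `[a, b] (EFin \o f).
Proof.
move=> cf; apply: continuous_compact_integrable; first exact: segment_compact.
exact: continuous_subspaceT.
Qed.

Lemma is_derive_continuous (F f : R -> R) (x : R) : is_derive x 1 F (f x) ->
  {for x, continuous F}.
Proof.
by move=> dF; apply/differentiable_continuous/derivable1_diffP; case: dF.
Qed.

Lemma FTC_itv (a b : R) (F f : R -> R) : a <= b ->
  {in `[a, b], continuous f} ->
  (forall x, a <= x <= b -> is_derive x 1 F (f x)) ->
  \int[mu]_(x in `[a, b]) f x = F b - F a.
Proof.
rewrite le_eqVlt => /predU1P[<- _ _|ab cf dF].
  by rewrite set_itv1 Rintegral_set1 subrr.
have cF x : a <= x <= b -> {for x, continuous F}.
  by move=> xab; exact: is_derive_continuous (dF _ xab).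
rewrite /Rintegral (@continuous_FTC2 _ _ F)//.
- apply: continuous_in_subspaceT => x; rewrite inE/=; exact: cf.
- split.
  + by move=> x; rewrite in_itv/= => /andP[ax xb]; case: (dF x) => //; rewrite !ltW.
  + by apply: cvg_at_right_filter; apply: cF; rewrite lexx ltW.
  + by apply: cvg_at_left_filter; apply: cF; rewrite lexx ltW.
- move=> x; rewrite in_itv/= => /andP[ax xb]; rewrite derive1E.
  by case: (dF x) => //; rewrite !ltW.
Qed.

Lemma abs_sin_le (x : R) : `|sin x| <= `|x|.
Proof.
wlog x0 : x / 0 <= x.
  by case: (leP 0 x) => [x0 /(_ x x0)//|x0 /(_ (- x))];
    rewrite sinN !normrN oppr_ge0 => -> //; exact: ltW.
have := @le_Rintegral_bound R `[0, x] cos (cst 1) (measurable_itv _)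
  (continuous_integrable_itv _ _ (@continuous_cos R)) (continuous_integrable_itv _ _ (@cst_continuous _ _ _)) _.
rewrite (@FTC_itv _ _ sin)//; last first.
  by move=> y _; exact: continuous_cos.
rewrite Rintegral_cst_itv// sin0 !subr0 mul1r [in X in _ -> X](ger0_norm x0).
by apply => y _; rewrite cos_max.
Qed.

Lemma measurable_inv : measurable_fun setT (fun x : R => x^-1).
Proof.
have -> : [set: R] = [set 0] `|` [set x | x != 0].
  apply/seteqP; split => x _ //=.
  by case: (eqVneq x 0); [left|right].
have o : open [set x : R | x != 0].
  rewrite (_ : [set x : R | x != 0] = ~` [set 0]).
    by apply: closed_openC; exact: closed_eq.
  by apply/seteqP; split => x /= /eqP.
apply/measurable_funU => //; first exact: open_measurable.
split; first exact: measurable_fun_set1.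
apply: open_continuous_measurable_fun => //.
move=> x; rewrite inE/= => x0; apply: continuousV => //; exact: cvg_id.
Qed.

Lemma continuous_mulr_comp (f : R -> R) (T : R) :
  continuous f -> continuous (fun u => f (T * u)).
Proof.
by move=> cf x; apply: continuous_comp; [exact: mulrl_continuous|exact: cf].
Qed.

(** The convention 0^-1 = 0 gives the kernel the value 0 at u = 0, a null set. *)
Lemma measurable_dker (T : R) : measurable_fun setT (fun u : R => sin (T * u) / u).
Proof.
apply: measurable_funM; last exact: measurable_inv.
apply: continuous_measurable_fun; apply: continuous_mulr_comp; exact: continuous_sin.
Qed.

Lemma abs_dker_le (T u : R) : `|sin (T * u) / u| <= `|T|.
Proof.
case: (eqVneq u 0) => [->|u0]; first by rewrite invr0 mulr0 normr0.
by rewrite normrM normfV ler_pdivrMr ?normr_gt0// -normrM abs_sin_le.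
Qed.

Lemma integrable_dker (T a b : R) :
  mu.-integrable `[a, b] (fun u => (sin (T * u) / u)%:E).
Proof.
apply: (@integrable_bounded _ _ _ `|T|) => //; first exact: mu_itv_lty.
  by apply: measurable_funTS; exact: measurable_dker.
by move=> u _; exact: abs_dker_le.
Qed.

Definition sine_int (T Y : R) := \int[mu]_(u in `[0, Y]) (sin (T * u) / u).

Lemma int_expR (c Y : R) : c != 0 -> 0 <= Y ->
  \int[mu]_(u in `[0, Y]) expR (- (c * u)) = (1 - expR (- (c * Y))) / c.
Proof.
move=> c0 Y0.
have dF (x : R) : 0 <= x <= Y ->
    is_derive x 1 (fun u => - expR (- (c * u)) / c) (expR (- (c * x))).
  by move=> _; apply: is_derive_eq; rewrite /GRing.scale/=; field.
rewrite (FTC_itv Y0 _ dF)//.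
  by rewrite mulr0 oppr0 expR0; field.
move=> x _; apply: continuous_comp; last exact: continuous_expR.
by apply: continuousN; exact: mulrl_continuous.
Qed.

Lemma int_expR_sin (T a Y : R) : 0 < T -> 0 <= Y ->
  \int[mu]_(u in `[0, Y]) (sin (T * u) * expR (- (a * u))) =
  T / (a ^+ 2 + T ^+ 2) -
  expR (- (a * Y)) * (T * cos (T * Y) + a * sin (T * Y)) / (a ^+ 2 + T ^+ 2).
Proof.
move=> T0 Y0.
have aT : a ^+ 2 + T ^+ 2 != 0 by rewrite gt_eqF// ltr_wpDl ?sqr_ge0// exprn_gt0.
have dF (x : R) : 0 <= x <= Y ->
    is_derive x 1 (fun u => - (expR (- (a * u)) *
      (T * cos (T * u) + a * sin (T * u))) / (a ^+ 2 + T ^+ 2))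
      (sin (T * x) * expR (- (a * x))).
  by move=> _; apply: is_derive_eq; rewrite /GRing.scale/=; field.
rewrite (FTC_itv Y0 _ dF)//.
  by rewrite !mulr0 oppr0 expR0 cos0 sin0; field.
move=> x _; apply: (@cvgM R R).
  by apply: continuous_mulr_comp; exact: continuous_sin.
apply: continuous_comp; last exact: continuous_expR.
by apply: continuousN; exact: mulrl_continuous.
Qed.

Lemma measurable_expR_kernel :
  measurable_fun setT (fun z : R * R => expR (- (z.1 * z.2))).
Proof.
apply: measurableT_comp; first exact: measurable_expR.
apply: measurableT_comp.
  by apply: continuous_measurable_fun; exact: opp_continuous.
by apply: measurable_funM; [exact: measurable_fst|exact: measurable_snd].
Qed.

(** Integrate exp(- a u) sin(T u) over [0, A] x [0, Y] in both orders. Integrating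
    in a first gives (1 - exp(- A u)) sin(T u) / u, hence the sine integral up to
    T / A. Integrating in u first gives T / (a ^ 2 + T ^ 2), whose integral is
    atan (A / T), up to a term bounded by 2 / T exp(- a Y). *)
Lemma sine_int_atan (T Y A : R) : 0 < T -> 0 < Y -> 0 < A ->
  `|sine_int T Y - atan (A / T)| <= 2 / (T * Y) + T / A.
Proof.
move=> T0 Y0 A0.
have T0' : T != 0 by rewrite gt_eqF.
have cs : continuous (fun u : R => sin (T * u)).
  by apply: continuous_mulr_comp; exact: continuous_sin.
have ce (c : R) : continuous (fun u : R => expR (- (c * u))).
  move=> x; apply: continuous_comp; last exact: continuous_expR.
  by apply: continuousN; exact: mulrl_continuous.
have k1 (a u : R) : `[0, A]%classic a -> `[0, Y]%classic u -> `|expR (- (a * u))| <= 1.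
  rewrite /= !in_itv/= => /andP[a0 _] /andP[u0 _].
  by rewrite ger0_norm ?expR_ge0// -expR0 ler_expR oppr_le0 mulr_ge0.
have [_ _] := kernel_Fubini (measurable_itv _) (mu_itv_lty 0 A) (measurable_itv _)
  (continuous_integrable_itv 0 Y cs) measurable_expR_kernel k1.
have den a : a ^+ 2 + T ^+ 2 != 0 by rewrite gt_eqF// ltr_wpDl ?sqr_ge0// exprn_gt0.
have cden : continuous (fun a : R => (a ^+ 2 + T ^+ 2)^-1).
  move=> x; apply: (@continuousV _ _ (fun a : R => a ^+ 2 + T ^+ 2)) => //.
  apply: cvgD; last exact: cvg_cst.
  exact: exprn_continuous.
have cT : continuous (fun a : R => T / (a ^+ 2 + T ^+ 2)).
  by move=> x; apply: cvgM; [exact: cvg_cst|exact: cden].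
pose E (a : R) := expR (- (a * Y)) * (T * cos (T * Y) + a * sin (T * Y)) / (a ^+ 2 + T ^+ 2).
have cE : continuous E.
  move=> x; apply: cvgM; last exact: cden.
  apply: cvgM.
    apply: continuous_comp; last exact: continuous_expR.
    by apply: continuousN; exact: mulrr_continuous.
  apply: cvgD; first exact: cvg_cst.
  exact: mulrr_continuous.
under eq_Rintegral do rewrite int_expR_sin ?(ltW Y0)//.
rewrite RintegralB//=; [|exact: continuous_integrable_itv..].
have dat x : 0 <= x <= A -> is_derive x 1 (fun a => atan (a / T)) (T / (x ^+ 2 + T ^+ 2)).
  move=> _; apply: is_derive_eq; rewrite /GRing.scale/=; field.
  by rewrite T0' den.
rewrite (FTC_itv (ltW A0) _ dat); last by move=> x _; exact: cT.
rewrite mul0r atan0 subr0.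
have Eb : `|\int[mu]_(x in `[0, A]) E x| <= 2 / (T * Y).
  have ie : mu.-integrable `[0, A] (EFin \o (fun a : R => 2 / T * expR (- (Y * a)))).
    apply: continuous_integrable_itv => x.
    by apply: cvgM; [exact: cvg_cst|exact: ce].
  apply: (le_trans (le_Rintegral_bound _ (continuous_integrable_itv _ _ cE) ie _)) => //.
    move=> x; rewrite /= in_itv/= => /andP[x0 _].
    rewrite /E !normrM (ger0_norm (expR_ge0 _)) -mulrA mulrC [Y * x]mulrC ler_wpM2r ?expR_ge0//.
    have d0 : 0 < x ^+ 2 + T ^+ 2 by rewrite lt_def den addr_ge0 ?sqr_ge0.
    rewrite normfV (gtr0_norm d0) ler_pdivrMr//.
    apply: (@le_trans _ _ (T + x)).
      apply: le_trans (ler_normD _ _) _; rewrite !normrM (gtr0_norm T0) (ger0_norm x0).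
      by apply: lerD; rewrite ler_piMr ?cos_max ?sin_max// ltW.
    rewrite mulrAC ler_pdivlMr//; nra.
  rewrite RintegralZl//; last by apply: continuous_integrable_itv; exact: ce.
  rewrite int_expR ?gt_eqF ?(ltW A0)//.
  have -> : 2 / (T * Y) = 2 / T * (1 / Y) by field; rewrite T0' gt_eqF.
  by rewrite ler_wpM2l ?divr_ge0 ?(ltW T0)// ler_pM2r ?invr_gt0// gerBl expR_ge0.
have ied : mu.-integrable `[0, Y] (fun u => (sin (T * u) / u * expR (- (A * u)))%:E).
  apply: (@integrable_Mbounded _ _ _ _ 1) => //; first exact: integrable_dker.
    by apply: measurable_funTS; apply: continuous_measurable_fun.
  move=> u; rewrite /= in_itv/= => /andP[u0 _].
  by rewrite ger0_norm ?expR_ge0// -expR0 ler_expR oppr_le0 mulr_ge0// ltW.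
have -> : \int[mu]_(u in `[0, Y]) (sin (T * u) * \int[mu]_(a in `[0, A]) expR (- (a * u)))
   = \int[mu]_(u in `[0, Y]) (sin (T * u) / u - sin (T * u) / u * expR (- (A * u))).
  apply: eq_Rintegral => u; rewrite inE/= in_itv/= => /andP[u0 _].
  have [->|un0] := eqVneq u 0; first by rewrite mulr0 sin0 !mul0r subrr.
  under eq_Rintegral do rewrite mulrC.
  by rewrite int_expR// ?(ltW A0)// [A * u]mulrC; field.
rewrite RintegralB//; last exact: integrable_dker.
rewrite -/(sine_int T Y) => eq1.
have Rb : `|\int[mu]_(u in `[0, Y]) (sin (T * u) / u * expR (- (A * u)))| <= T / A.
  have ie : mu.-integrable `[0, Y] (EFin \o (fun a : R => T * expR (- (A * a)))).
    apply: continuous_integrable_itv => x.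
    by apply: cvgM; [exact: cvg_cst|exact: ce].
  apply: (le_trans (le_Rintegral_bound _ ied ie _)) => //.
    move=> x _; rewrite normrM (ger0_norm (expR_ge0 _)) ler_wpM2r ?expR_ge0//.
    by rewrite (le_trans (abs_dker_le _ _))// gtr0_norm.
  rewrite RintegralZl//; last by apply: continuous_integrable_itv; exact: ce.
  rewrite int_expR ?gt_eqF ?(ltW Y0)// ler_wpM2l ?(ltW T0)// -[leRHS]div1r.
  by rewrite ler_pM2r ?invr_gt0// gerBl expR_ge0.
move: eq1; rewrite -[X in _ - X = _]/(\int[mu]_(x in `[0, A]) E x).
move: Eb Rb; set I1 := Rintegral _ _ _; set I2 := Rintegral _ _ _ => I1b I2b eq1.
have -> : sine_int T Y - atan (A / T) = I2 - I1 by lra.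
by rewrite [leRHS]addrC (le_trans (ler_normB _ _))// lerD.
Qed.

Lemma sine_int_pihalf (T Y : R) : 0 < T -> 0 < Y ->
  `|sine_int T Y - pi / 2| <= 2 / (T * Y).
Proof.
move=> T0 Y0; apply/ler_addgt0Pr => e e0.
have e20 : 0 < e / 2 by rewrite divr_gt0.
have := @cvgy_atan R => /cvgrPdist_le /(_ _ e20)[M [Mr MA]].
(* A = B T makes A / T exceed M, and T / A at most e / 2. *)
pose B := (`|M| + 1 + T / (e / 2) / T).
have q0 : 0 <= T / (e / 2) / T by rewrite !divr_ge0// ltW.
have B0 : 0 < B by rewrite ltr_wpDr// ltr_wpDl.
have BM : M < B.
  apply: (le_lt_trans (ler_norm _)).
  by rewrite /B -addrA ltrDl ltr_wpDr.
have := sine_int_atan T0 Y0 (mulr_gt0 B0 T0); rewrite mulfK ?gt_eqF// => H.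
have TB : T / (B * T) <= e / 2.
  rewrite invfM mulrCA divff ?gt_eqF// mulr1 invf_ple ?posrE//.
  rewrite /B mulrAC divff ?gt_eqF// mul1r.
  by rewrite lerDr addr_ge0.
have := MA _ BM; move: H; rewrite !ler_norml => /andP[H1 H2] /andP[H3 H4].
apply/andP; split; lra.
Qed.

(** For T Y <= 1 bound the kernel by T; otherwise use the distance to pi / 2. *)
Lemma sine_int_le4 (T Y : R) : 0 <= T -> 0 <= Y -> `|sine_int T Y| <= 4.
Proof.
move=> T0 Y0.
have [TY|TY] := leP (T * Y) 1.
  apply: (@le_trans _ _ (\int[mu]_(u in `[0, Y]) (cst T u))).
    apply: le_Rintegral_bound => //; first exact: integrable_dker.
      by apply: continuous_integrable_itv; exact: cst_continuous.
    by move=> u _; rewrite (le_trans (abs_dker_le _ _))// ger0_norm.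
  by rewrite Rintegral_cst_itv// subr0; lra.
have T1 : 0 < T by rewrite lt_def T0 andbT; apply/eqP => T00; move: TY; rewrite T00 mul0r ltr10.
have Y1 : 0 < Y by rewrite lt_def Y0 andbT; apply/eqP => T00; move: TY; rewrite T00 mulr0 ltr10.
have := sine_int_pihalf T1 Y1.
have : 2 / (T * Y) <= 2 by rewrite ler_pdivrMr ?mulr_gt0// ler_peMr// ltW.
have := @pihalf_lt2 R; have := @pihalf_ge1 R.
rewrite !ler_norml => ? ? ? /andP[? ?]; apply/andP; split; lra.
Qed.

End sine_integral.

(** * Dirichlet's test for cosine and sine integrals *)

Section dirichlet_test.
Context {R : realType}.
Notation mu := (@lebesgue_measure R).

(** The normal form of a monotone part: the last condition fixes the value at 0 to
    be the right limit, so that h 0 can stand for h(0+). *)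
Definition decays (h : R -> R) := [/\ forall x y, x <= y -> h y <= h x,
  h x @[x --> +oo] --> (0 : R) & h x @[x --> 0^'+] --> h 0].

Lemma decays_ge0 h x : decays h -> 0 <= h x.
Proof.
move=> [ndh h0 _].
have cv : cvg (h x @[x --> +oo]) by apply/cvg_ex; exists 0.
rewrite -(cvg_lim _ h0)//; apply: limr_le => //.
by near=> y; apply: ndh; near: y; apply: nbhs_pinfty_ge; exact: num_real.
Unshelve. all: by end_near. Qed.

Lemma decays_measurable h D : decays h -> measurable D -> measurable_fun D h.
Proof.
by move=> [ndh _ _] mD; apply: nonincreasing_measurable.
Qed.

Lemma decays_small h e : decays h -> 0 < e ->
  exists2 B, 0 < B & forall x, B <= x -> h x <= e.
Proof.
move=> hd e0; have [ndh /cvgrPdist_le /(_ _ e0)[M [Mr MA]] _] := hd.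
exists (`|M| + 1); first by rewrite ltr_wpDl.
move=> x Mx; have : M < x by rewrite (lt_le_trans _ Mx)// (le_lt_trans (ler_norm _))// ltrDl.
by move/MA; rewrite sub0r normrN ger0_norm//; exact: decays_ge0.
Qed.

Lemma decays_integrable (h phi : R -> R) (a b : R) : decays h -> 0 <= a ->
  mu.-integrable `[a, b] (EFin \o phi) ->
  mu.-integrable `[a, b] (fun u => (phi u * h u)%:E).
Proof.
move=> hd a0 iphi; apply: (@integrable_Mbounded _ _ _ _ (h a)) => //.
  exact: decays_measurable.
move=> u; rewrite /= in_itv/= => /andP[au _].
rewrite ger0_norm; last exact: decays_ge0.
by case: hd => ndh _ _; exact: ndh.
Qed.

(** The second mean value theorem bounds the integral over [a, b] by M h(a), which
    gives the Cauchy criterion and, letting b tend to infinity, the tail. *)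
Lemma dirichlet_test (h phi : R -> R) (M : R) : decays h -> 0 <= M ->
  (forall a b, mu.-integrable `[a, b] (EFin \o phi)) ->
  (forall a b, 0 <= a -> a <= b -> `|\int[mu]_(t in `[a, b]) phi t| <= M) ->
  cvg (\int[mu]_(u in `[0, N]) (phi u * h u) @[N --> +oo]) /\
  forall N, 0 <= N ->
    `|lim (\int[mu]_(u in `[0, N]) (phi u * h u) @[N --> +oo]) -
      \int[mu]_(u in `[0, N]) (phi u * h u)| <= M * h N.
Proof.
move=> hd M0 iphi phiM; have [ndh _ _] := hd.
pose F (N : R) := \int[mu]_(u in `[0, N]) (phi u * h u).
have tail a b : 0 <= a -> a <= b -> `|F b - F a| <= M * h a.
  move=> a0 ab.
  have -> : F b = F a + \int[mu]_(u in `[a, b]) (phi u * h u).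
    by apply: Rintegral_split => //; exact: decays_integrable.
  rewrite addrAC subrr add0r.
  apply: second_mean_value => //; first exact: decays_ge0.
  by move=> y /andP[ay _]; exact: phiM.
have cF : cvg (F N @[N --> +oo]).
  apply/cauchy_cvgP/cauchy_exP => e e0.
  have e1 : 0 < e / (M + 1) by rewrite divr_gt0// ltr_wpDl.
  have [B B0 hB] := decays_small hd e1.
  exists (F B); exists B; split=> [|N /ltW BN]; first exact: num_real.
  rewrite /ball/= distrC.
  apply: (le_lt_trans (tail _ _ (ltW B0) BN)).
  apply: (@le_lt_trans _ _ (M * (e / (M + 1)))).
    by rewrite ler_wpM2l// hB.
  rewrite mulrCA gtr_pMr// ltr_pdivrMr ?ltr_wpDl// mul1r ltrDl//.
split => // N N0; apply/ler_addgt0Pr => e e0.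
have /cvgrPdist_le /(_ _ e0) cFe := cF.
near +oo_R => P.
have NP : N <= P by near: P; apply: nbhs_pinfty_ge; exact: num_real.
have lP : `|lim (F N @[N --> +oo]) - F P| <= e by near: P.
rewrite -(subrK (F P) (lim _)) -addrA addrC (le_trans (ler_normD _ _))//.
by rewrite lerD// tail.
Unshelve. all: by end_near. Qed.

Lemma int_cos (s a b : R) : s != 0 -> a <= b ->
  \int[mu]_(u in `[a, b]) cos (s * u) = (sin (s * b) - sin (s * a)) / s.
Proof.
move=> s0 ab.
have dF (x : R) : a <= x <= b -> is_derive x 1 (fun u => sin (s * u) / s) (cos (s * x)).
  by move=> _; apply: is_derive_eq; rewrite /GRing.scale/=; field.
rewrite (FTC_itv ab _ dF) -?mulrBl// => x _.
by apply: continuous_mulr_comp; exact: continuous_cos.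
Qed.

Lemma int_sin (s a b : R) : s != 0 -> a <= b ->
  \int[mu]_(u in `[a, b]) sin (s * u) = (cos (s * a) - cos (s * b)) / s.
Proof.
move=> s0 ab.
have dF (x : R) : a <= x <= b -> is_derive x 1 (fun u => - cos (s * u) / s) (sin (s * x)).
  by move=> _; apply: is_derive_eq; rewrite /GRing.scale/=; field.
rewrite (FTC_itv ab _ dF).
  by rewrite -mulrBl opprK addrC.
by move=> x _; apply: continuous_mulr_comp; exact: continuous_sin.
Qed.

Lemma int_cos_le (s a b : R) : s != 0 -> a <= b ->
  `|\int[mu]_(u in `[a, b]) cos (s * u)| <= 2 / `|s|.
Proof.
move=> s0 ab; rewrite int_cos// normrM normfV ler_pM2r ?invr_gt0 ?normr_gt0//.
by rewrite (le_trans (ler_normB _ _))// -[leRHS]/(1 + 1) lerD// sin_max.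
Qed.

Lemma int_sin_le (s a b : R) : s != 0 -> a <= b ->
  `|\int[mu]_(u in `[a, b]) sin (s * u)| <= 2 / `|s|.
Proof.
move=> s0 ab; rewrite int_sin// normrM normfV ler_pM2r ?invr_gt0 ?normr_gt0//.
by rewrite (le_trans (ler_normB _ _))// -[leRHS]/(1 + 1) lerD// cos_max.
Qed.

Lemma continuous_cosM (s : R) : continuous (fun u => cos (s * u)).
Proof. by apply: continuous_mulr_comp; exact: continuous_cos. Qed.

Lemma continuous_sinM (s : R) : continuous (fun u => sin (s * u)).
Proof. by apply: continuous_mulr_comp; exact: continuous_sin. Qed.

Definition cos_improper (k : R -> R) (s : R) : R :=
  lim (\int[mu]_(u in `[0, N]) (cos (s * u) * k u) @[N --> +oo]).

Definition sin_improper (k : R -> R) (s : R) : R :=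
  lim (\int[mu]_(u in `[0, N]) (sin (s * u) * k u) @[N --> +oo]).

Lemma cos_improperP h s : decays h -> s != 0 ->
  cvg (\int[mu]_(u in `[0, N]) (cos (s * u) * h u) @[N --> +oo]) /\
  forall N, 0 <= N ->
    `|cos_improper h s - \int[mu]_(u in `[0, N]) (cos (s * u) * h u)| <= 2 / `|s| * h N.
Proof.
move=> hd s0; apply: dirichlet_test => //.
- by move=> a b; apply: continuous_integrable_itv; exact: continuous_cosM.
- by move=> a b _ ab; exact: int_cos_le.
Qed.

Lemma sin_improperP h s : decays h -> s != 0 ->
  cvg (\int[mu]_(u in `[0, N]) (sin (s * u) * h u) @[N --> +oo]) /\
  forall N, 0 <= N ->
    `|sin_improper h s - \int[mu]_(u in `[0, N]) (sin (s * u) * h u)| <= 2 / `|s| * h N.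
Proof.
move=> hd s0; apply: dirichlet_test => //.
- by move=> a b; apply: continuous_integrable_itv; exact: continuous_sinM.
- by move=> a b _ ab; exact: int_sin_le.
Qed.

End dirichlet_test.

(** * Limits of the Dirichlet integral of a monotone function *)

Section inversion_core.
Context {R : realType}.
Notation mu := (@lebesgue_measure R).

Lemma sine_int_itv (T a b : R) : 0 <= a -> a <= b ->
  \int[mu]_(u in `[a, b]) (sin (T * u) / u) = sine_int T b - sine_int T a.
Proof.
move=> a0 ab.
have -> : sine_int T b = sine_int T a + \int[mu]_(u in `[a, b]) (sin (T * u) / u).
  by apply: Rintegral_split => //; exact: integrable_dker.
by rewrite addrAC subrr add0r.
Qed.

Definition dirichlet_int (h : R -> R) (N T : R) : R :=
  \int[mu]_(u in `[0, N]) (sin (T * u) / u * h u).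

(** Integrating cos(s u) in s from S to T yields (sin(T u) - sin(S u)) / u. *)
Lemma dirichlet_intB h (N S T : R) : decays h -> 0 <= N -> S <= T ->
  mu.-integrable `[S, T] (fun s => (\int[mu]_(u in `[0, N]) (cos (s * u) * h u))%:E) /\
  \int[mu]_(s in `[S, T]) (\int[mu]_(u in `[0, N]) (cos (s * u) * h u)) =
  dirichlet_int h N T - dirichlet_int h N S.
Proof.
move=> hd N0 ST.
have mk : measurable_fun setT (fun z : R * R => cos (z.1 * z.2)).
  apply: measurableT_comp.
    by apply: continuous_measurable_fun; exact: continuous_cos.
  by apply: measurable_funM; [exact: measurable_fst|exact: measurable_snd].
have hi : mu.-integrable `[0, N] (EFin \o h).
  have := @decays_integrable R h (cst 1) 0 N hd (lexx _)
     (continuous_integrable_itv _ _ (@cst_continuous _ _ _)).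
  by apply: eq_integrable => // u _; rewrite /cst mul1r.
have [i1 iL] := @kernel_Fubini R `[S, T] `[0, N] h (fun s u => cos (s * u)) 1
  (measurable_itv _) (mu_itv_lty _ _) (measurable_itv _) hi mk (fun s u _ _ => cos_max _).
under [X in X = _ -> _]eq_Rintegral do under eq_Rintegral do rewrite mulrC.
move=> E; split.
  apply: eq_integrable i1 => // s _; congr EFin.
  by apply: eq_Rintegral => u _; rewrite mulrC.
rewrite {}E /dirichlet_int -RintegralB//; [|by apply: decays_integrable => //; exact: integrable_dker..].
have iR : mu.-integrable `[0, N]
   (EFin \o (fun u => sin (T * u) / u * h u - sin (S * u) / u * h u)).
  have i2 : mu.-integrable `[0, N] (EFin \o (fun u => sin (T * u) / u - sin (S * u) / u)).
    by apply: integrable_subr => //; exact: integrable_dker.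
  apply: eq_integrable (decays_integrable hd (lexx 0) i2) => //= u _.
  by rewrite mulrBl.
have sub : `]0, N] `<=` (`[0, N] : set R).
  by move=> u; rewrite /= !in_itv/= => /andP[/ltW -> ->].
rewrite -Rintegral_itv_obnd_cbnd; last exact: integrableS iL.
rewrite -[RHS]Rintegral_itv_obnd_cbnd; last exact: integrableS iR.
apply: eq_Rintegral => u; rewrite inE/= in_itv/= => /andP[u0 _].
under eq_Rintegral do rewrite mulrC.
rewrite int_cos ?gt_eqF//.
by rewrite [u * T]mulrC [u * S]mulrC; field; rewrite gt_eqF.
Qed.

(** On [0, d] replace h by h(d): the error is at most 4 (h(0) - h(d)) by the second
    mean value theorem, small with d. What remains is h(d) times a sine integral,
    close to pi / 2 for large T, and the part beyond d is O(1 / (T d)). *)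
Lemma dirichlet_int_large h (e : R) : decays h -> 0 < e ->
  exists T0 N0 : R, [/\ 0 <= T0, 0 <= N0 & forall T N, T0 < T -> N0 <= N ->
    `|dirichlet_int h N T - pi / 2 * h 0| <= e].
Proof.
move=> hd e0; have [ndh _ hc] := hd.
have e1 : 0 < e / 2 / 6 by rewrite !divr_gt0.
have [d d0 hd1] : exists2 d, 0 < d & h 0 - h d <= e / 2 / 6.
  move/cvgrPdist_le : hc => /(_ _ e1) hn.
  near (0 : R)^'+ => d; exists d => //.
  by rewrite (le_trans (ler_norm _))//; near: d.
have h0 : 0 <= h 0 by exact: decays_ge0.
have hd0 : 0 <= h d by exact: decays_ge0.
(* For T > T0 the error 2 / (T d) h(0) of the sine integral is at most e / 12. *)
pose T0 := 24 * h 0 / (d * e).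
have T00 : 0 <= T0 by rewrite divr_ge0 ?mulr_ge0// ltW.
exists T0, d; split => //; first exact: ltW.
move=> T N TT dN.
have T1 : 0 < T by exact: le_lt_trans TT.
have dh0 : h d <= h 0 by apply: ndh; exact: ltW.
have iH : mu.-integrable `[0, N] (EFin \o (fun u => sin (T * u) / u * h u)).
  by apply: decays_integrable => //; exact: integrable_dker.
rewrite /dirichlet_int (Rintegral_split (ltW d0) dN)//.
have iHd : mu.-integrable `[0, d] (EFin \o (fun u => sin (T * u) / u * h u)).
  by apply: decays_integrable => //; exact: integrable_dker.
have iD : mu.-integrable `[0, d] (EFin \o (fun u => sin (T * u) / u * h d)).
  by apply: integrable_mulr => //; exact: integrable_dker.
have split1 : \int[mu]_(u in `[0, d]) (sin (T * u) / u * h u) =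
    \int[mu]_(u in `[0, d]) (sin (T * u) / u * (h u - h d)) + sine_int T d * h d.
  under [X in X + _]eq_Rintegral do rewrite mulrBr.
  by rewrite RintegralB// RintegralZr ?subrK//; exact: integrable_dker.
have b1 : `|\int[mu]_(u in `[0, d]) (sin (T * u) / u * (h u - h d))| <= 4 * (h 0 - h d).
  apply: (@second_mean_value _ _ _ _ (fun u => h u - h d)).
  - exact: ltW.
  - by move=> x y xy; rewrite lerD2r ndh.
  - by rewrite subrr.
  - exact: integrable_dker.
  - by move=> y /andP[y0 _]; apply: sine_int_le4 => //; exact: ltW.
have Td : 2 / (T * d) * h 0 <= e / 12.
  rewrite mulrAC ler_pdivrMr ?mulr_gt0//.
  move: TT; rewrite /T0 ltr_pdivrMr ?mulr_gt0// => TT; nra.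
have b2 : `|sine_int T d - pi / 2| <= 2 / (T * d) by exact: sine_int_pihalf.
have b3 : `|\int[mu]_(u in `[d, N]) (sin (T * u) / u * h u)| <= 4 / (T * d) * h d.
  apply: second_mean_value => //; first exact: decays_ge0.
    exact: integrable_dker.
  move=> y /andP[dy _]; rewrite sine_int_itv ?(ltW d0)//.
  have y0 : 0 < y by exact: lt_le_trans dy.
  have -> : sine_int T y - sine_int T d = (sine_int T y - pi / 2) - (sine_int T d - pi / 2) by lra.
  apply: (le_trans (ler_normB _ _)).
  have := sine_int_pihalf T1 y0.
  have : 2 / (T * y) <= 2 / (T * d).
    by rewrite ler_pM2l// lef_pV2 ?posrE ?mulr_gt0// ler_pM2l.
  have -> : 4 / (T * d) = 2 / (T * d) + 2 / (T * d) by lra.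
  lra.
have p2 := @pihalf_lt2 R; have p1 := @pihalf_ge1 R.
rewrite split1.
have q0 : 0 <= 2 / (T * d) by rewrite divr_ge0// ltW// mulr_gt0.
move: b1 b2 b3; set I1 := Rintegral _ _ _; set I2 := Rintegral _ _ _.
have -> : 4 / (T * d) = 2 * (2 / (T * d)) by lra.
set q := 2 / (T * d) in q0 Td *; set P := pi / 2 in p1 p2 *; set s := sine_int T d.
rewrite !ler_norml => /andP[? ?] /andP[? ?] /andP[? ?].
have : q * h d <= q * h 0 by rewrite ler_wpM2l.
have : (s - P) * h d <= q * h d by rewrite ler_wpM2r.
have : - q * h d <= (s - P) * h d by rewrite ler_wpM2r.
have : 0 <= P * (h 0 - h d) by rewrite mulr_ge0 ?subr_ge0//; lra.
have : P * (h 0 - h d) <= 2 * (h 0 - h d) by rewrite ler_wpM2r ?subr_ge0// ltW.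
move=> *; apply/andP; split; lra.
Unshelve. all: by end_near. Qed.

(** Below B the kernel is at most S; beyond B the second mean value theorem gives
    8 h(B), which is small for large B. *)
Lemma dirichlet_int_small h (e : R) : decays h -> 0 < e ->
  exists S0 N0 : R, [/\ 0 < S0, 0 <= N0 & forall S N, 0 < S -> S < S0 -> N0 <= N ->
    `|dirichlet_int h N S| <= e].
Proof.
move=> hd e0; have [ndh _ hc] := hd.
have e1 : 0 < e / 2 / 8 by rewrite !divr_gt0.
have [B B0 hB] := decays_small hd e1.
have h0 : 0 <= h 0 by exact: decays_ge0.
exists (e / 2 / (h 0 * B + 1)), B; split.
- by rewrite !divr_gt0// ltr_wpDl ?mulr_ge0 ?(ltW B0).
- exact: ltW.
move=> S N S0; rewrite ltr_pdivlMr ?ltr_wpDl ?mulr_ge0 ?(ltW B0)// => SS BN.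
rewrite /dirichlet_int (Rintegral_split (ltW B0) BN)//; last first.
  by apply: decays_integrable => //; exact: integrable_dker.
have b1 : `|\int[mu]_(u in `[0, B]) (sin (S * u) / u * h u)| <= S * h 0 * B.
  rewrite -[X in _ <= _ * X]subr0 -Rintegral_cst_itv ?(ltW B0)//.
  apply: le_Rintegral_bound => //.
  - by apply: decays_integrable => //; exact: integrable_dker.
  - by apply: continuous_integrable_itv; exact: cst_continuous.
  move=> u; rewrite /= in_itv/= => /andP[u0 _].
  rewrite normrM ler_pM//; last by rewrite ger0_norm ?ndh//; exact: decays_ge0.
  by rewrite (le_trans (abs_dker_le _ _))// gtr0_norm.
have b2 : `|\int[mu]_(u in `[B, N]) (sin (S * u) / u * h u)| <= 8 * h B.
  apply: second_mean_value => //; first exact: decays_ge0.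
    exact: integrable_dker.
  move=> y /andP[By _]; rewrite sine_int_itv ?(ltW B0)//.
  apply: (le_trans (ler_normB _ _)).
  have -> : 8 = 4 + 4 :> R by lra.
  by rewrite lerD// sine_int_le4// ltW// (lt_le_trans B0).
have hBe := hB B (lexx _).
apply: (le_trans (ler_normD _ _)).
nra.
Qed.

End inversion_core.

(** * Integration of the cosine transform over a range of frequencies *)

Section inversion_decays.
Context {R : realType}.
Notation mu := (@lebesgue_measure R).

Lemma measurable_partial_transform (kap h : R -> R) (N : R) (D : set R) :
  continuous kap -> (forall u, `|kap u| <= 1) ->
  measurable D -> (mu D < +oo)%E ->
  mu.-integrable `[0, N] (EFin \o h) ->
  measurable_fun D (fun s => \int[mu]_(u in `[0, N]) (kap (s * u) * h u)).
Proof.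
move=> ck k1 mD Dfin hi.
have mk : measurable_fun setT (fun z : R * R => kap (z.1 * z.2)).
  apply: measurableT_comp; first exact: continuous_measurable_fun.
  by apply: measurable_funM; [exact: measurable_fst|exact: measurable_snd].
have [i1 _ _] := @kernel_Fubini R D `[0, N] h (fun s u => kap (s * u)) 1
  mD Dfin (measurable_itv _) hi mk (fun s u _ _ => k1 _).
apply: integrable_measurable; apply: eq_integrable i1 => // s _; congr EFin.
by apply: eq_Rintegral => u _; rewrite mulrC.
Qed.

Lemma decays_integrable0 (h : R -> R) (N : R) : decays h ->
  mu.-integrable `[0, N] (EFin \o h).
Proof.
move=> hd; have := @decays_integrable R h (cst 1) 0 N hd (lexx _)
     (continuous_integrable_itv _ _ (@cst_continuous _ _ _)).
by apply: eq_integrable => // u _; rewrite /cst mul1r.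
Qed.

Lemma measurable_cos_improper (h : R -> R) (D : set R) : decays h ->
  measurable D -> (mu D < +oo)%E -> (forall s, D s -> s != 0) ->
  measurable_fun D (cos_improper h).
Proof.
move=> hd mD Dfin D0.
apply: (@measurable_fun_cvg _ _ _ D
  (fun (n : nat) (s : R) => \int[mu]_(u in `[0, n%:R]) (cos (s * u) * h u))).
  move=> n; apply: measurable_partial_transform => //.
  - exact: continuous_cos.
  - exact: cos_max.
  - exact: decays_integrable0.
move=> s /D0 s0; have [cv _] := cos_improperP hd s0.
exact: (cvg_comp _ _ (cvgr_idn) cv).
Qed.

Lemma measurable_sin_improper (h : R -> R) (D : set R) : decays h ->
  measurable D -> (mu D < +oo)%E -> (forall s, D s -> s != 0) ->
  measurable_fun D (sin_improper h).
Proof.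
move=> hd mD Dfin D0.
apply: (@measurable_fun_cvg _ _ _ D
  (fun (n : nat) (s : R) => \int[mu]_(u in `[0, n%:R]) (sin (s * u) * h u))).
  move=> n; apply: measurable_partial_transform => //.
  - exact: continuous_sin.
  - exact: sin_max.
  - exact: decays_integrable0.
move=> s /D0 s0; have [cv _] := sin_improperP hd s0.
exact: (cvg_comp _ _ (cvgr_idn) cv).
Qed.

Lemma cos_improper_le (h : R -> R) (s : R) : decays h -> s != 0 ->
  `|cos_improper h s| <= 2 / `|s| * h 0.
Proof.
move=> hd s0; have [_ /(_ 0 (lexx _))] := cos_improperP hd s0.
by rewrite set_itv1 Rintegral_set1 subr0.
Qed.

Lemma sin_improper_le (h : R -> R) (s : R) : decays h -> s != 0 ->
  `|sin_improper h s| <= 2 / `|s| * h 0.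
Proof.
move=> hd s0; have [_ /(_ 0 (lexx _))] := sin_improperP hd s0.
by rewrite set_itv1 Rintegral_set1 subr0.
Qed.

Lemma integrable_cos_improper (h : R -> R) (D : set R) (S : R) : decays h ->
  measurable D -> (mu D < +oo)%E -> 0 < S -> (forall s, D s -> S <= `|s|) ->
  mu.-integrable D (EFin \o cos_improper h).
Proof.
move=> hd mD Dfin S0 DS.
have D0 s : D s -> s != 0.
  by move=> /DS Ss; rewrite -normr_gt0 (lt_le_trans S0).
apply: (@integrable_bounded _ _ _ (2 / S * h 0)) => //.
  exact: measurable_cos_improper.
move=> s Ds; apply: le_trans (cos_improper_le hd (D0 _ Ds)) _.
rewrite ler_wpM2r ?decays_ge0// ler_pM2l// lef_pV2 ?posrE ?DS//.
exact: lt_le_trans (DS _ Ds).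
Qed.

Lemma integrable_sin_improper (h : R -> R) (D : set R) (S : R) : decays h ->
  measurable D -> (mu D < +oo)%E -> 0 < S -> (forall s, D s -> S <= `|s|) ->
  mu.-integrable D (EFin \o sin_improper h).
Proof.
move=> hd mD Dfin S0 DS.
have D0 s : D s -> s != 0.
  by move=> /DS Ss; rewrite -normr_gt0 (lt_le_trans S0).
apply: (@integrable_bounded _ _ _ (2 / S * h 0)) => //.
  exact: measurable_sin_improper.
move=> s Ds; apply: le_trans (sin_improper_le hd (D0 _ Ds)) _.
rewrite ler_wpM2r ?decays_ge0// ler_pM2l// lef_pV2 ?posrE ?DS//.
exact: lt_le_trans (DS _ Ds).
Qed.

(** The tail 2 h(N) / S of the cosine transform is uniform on [S, T], so its
    integral is a limit of differences of truncated Dirichlet integrals. N is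
    chosen after S and T, which is harmless since the estimates on those integrals
    are uniform in large N. *)
Lemma cvg_int_cos_improper (h : R -> R) : decays h ->
  \int[mu]_(s in `[ST.1, ST.2]) cos_improper h s
    @[ST --> filter_prod (0^'+ : set_system R) (pinfty_nbhs R)] --> pi / 2 * h 0.
Proof.
move=> hd; apply/cvgrPdist_le => e e0.
have e3 : 0 < e / 3 by rewrite divr_gt0.
have [T0 [N0 [T00 N00 HT]]] := dirichlet_int_large hd e3.
have [S0 [N1 [S00 N10 HS]]] := dirichlet_int_small hd e3.
exists ([set S | 0 < S < S0], [set T | Num.max T0 S0 < T]) => /=.
  split; last by exists (Num.max T0 S0); split; [exact: num_real|].
  near=> S; apply/andP; split; last by near: S; exact: nbhs_right_lt.
  by [].
move=> [S T] /= [/andP[Sp SS0]]; rewrite gt_max => /andP[TT0 TS0].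
have ST : S < T by exact: lt_trans SS0 TS0.
have dlt : 0 < 2 / S * (T - S) by rewrite mulr_gt0 ?subr_gt0// divr_gt0.
(* For N >= B the tail 2 / S h(N), integrated over [S, T], is at most e / 3. *)
have [B B0 hB] := decays_small hd (divr_gt0 e3 dlt).
pose N := Num.max B (Num.max N0 N1).
have NB : B <= N by rewrite le_max lexx.
have NN0 : N0 <= N by rewrite !le_max lexx orbT.
have NN1 : N1 <= N by rewrite !le_max lexx !orbT.
have Np : 0 <= N by exact: le_trans NN0.
have [iN EN] := dirichlet_intB hd Np (ltW ST).
have iC : mu.-integrable `[S, T] (EFin \o cos_improper h).
  apply: (@integrable_cos_improper _ _ S) => //; first exact: mu_itv_lty.
  move=> s; rewrite /= in_itv/= => /andP[Ss _].
  by rewrite ger0_norm// (le_trans (ltW Sp)).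
have close : `|\int[mu]_(s in `[S, T]) cos_improper h s -
    (dirichlet_int h N T - dirichlet_int h N S)| <= e / 3.
  rewrite -EN -RintegralB//.
  apply: (@le_trans _ _ (2 / S * h N * (T - S))); last first.
    have := hB _ NB; rewrite ler_pdivlMr// => hN.
    by rewrite mulrAC mulrC.
  rewrite -Rintegral_cst_itv ?(ltW ST)//; apply: le_Rintegral_bound => //.
  - exact: integrable_subr.
  - by apply: continuous_integrable_itv; exact: cst_continuous.
  move=> s; rewrite /= in_itv/= => /andP[Ss _].
  have s0 : 0 < s by exact: lt_le_trans Ss.
  have [_ /(_ _ Np) H] := cos_improperP hd (lt0r_neq0 s0).
  apply: (le_trans H); rewrite ler_wpM2r ?decays_ge0// ler_pM2l//.
  by rewrite (gtr0_norm s0) lef_pV2 ?posrE.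
have := HT _ _ TT0 NN0; have := HS _ _ Sp SS0 NN1.
move: close; rewrite !ler_norml => /andP[? ?] /andP[? ?] /andP[? ?].
apply/andP; split; lra.
Unshelve. all: by end_near. Qed.

End inversion_decays.

(** * Functions of bounded variation as differences of monotone functions *)

Section bv_decomposition.
Context {R : realType}.

(** Changing the value at 0 and on the negative half-line is harmless: only u > 0
    will matter. *)
Lemma right_regularization (h : R -> R) :
  (forall x y, x <= y -> h y <= h x) -> h x @[x --> +oo] --> (0 : R) ->
  exists2 k, decays k & forall u, 0 < u -> k u = h u.
Proof.
move=> ndh h0.
have cvh : cvg (h x @[x --> 0^'+]).
  apply: nonincreasing_at_right_is_cvgr; near=> a.
    by move=> x y _ _; exact: ndh.
  exists (h 0) => _ /= [y + <-]; rewrite in_itv/= => /andP[y0 _].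
  exact/ndh/ltW.
set l := lim (h x @[x --> 0^'+]) in cvh.
have hl u : 0 < u -> h u <= l.
  move=> u0; apply: limr_ge => //; near=> y; apply: ndh.
  by near: y; exact: nbhs_right_le.
exists (fun u => if 0 < u then h u else l); last by move=> u ->.
split.
- move=> x y xy; case: ifPn => y0; case: ifPn => x0 //.
  + exact: ndh.
  + exact: hl.
  + by move: y0; rewrite (lt_le_trans x0 xy).
- apply: cvg_trans h0; apply: near_eq_cvg; near=> x.
  have -> // : 0 < x by near: x; apply: nbhs_pinfty_gt; exact: num_real.
- rewrite ltxx; apply: cvg_trans cvh; apply: near_eq_cvg; near=> x.
  by have -> // : 0 < x by near: x; exact: nbhs_right_gt.
Unshelve. all: by end_near. Qed.

(** With V the limit of T, take the nonincreasing functions V / 2 - (T - G) / 2 and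
    V / 2 - (T + G) / 2. *)
Lemma dominated_variation_decomp (G T : R -> R) (M : R) :
  (forall u v, u <= v -> `|G v - G u| <= T v - T u) -> (forall u, T u <= M) ->
  G t @[t --> +oo] --> (0 : R) ->
  exists h1 h2, [/\ decays h1, decays h2 & forall u, 0 < u -> G u = h1 u - h2 u].
Proof.
move=> key TM G0.
have ndT u v : u <= v -> T u <= T v.
  by move=> /key H; rewrite -subr_ge0; exact: le_trans H.
have cT : T u @[u --> +oo] --> sup (range T).
  by apply: nondecreasing_cvgr => //; exists M => _ [u _ <-].
set V := sup (range T) in cT.
pose n1 u := V / 2 - (T u - G u) / 2.
pose n2 u := V / 2 - (T u + G u) / 2.
have nd1 u v : u <= v -> n1 v <= n1 u.
  by move=> uv; rewrite /n1; have := key _ _ uv; rewrite ler_norml => /andP[? ?]; lra.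
have nd2 u v : u <= v -> n2 v <= n2 u.
  by move=> uv; rewrite /n2; have := key _ _ uv; rewrite ler_norml => /andP[? ?]; lra.
have l1 : n1 u @[u --> +oo] --> (0 : R).
  rewrite [X in _ --> X](_ : _ = V / 2 - (V - 0) / 2); last by lra.
  by apply: cvgB; [exact: cvg_cst|apply: cvgMl; exact: cvgB].
have l2 : n2 u @[u --> +oo] --> (0 : R).
  rewrite [X in _ --> X](_ : _ = V / 2 - (V + 0) / 2); last by lra.
  by apply: cvgB; [exact: cvg_cst|apply: cvgMl; exact: cvgD].
have [h1 h1d h1E] := right_regularization nd1 l1.
have [h2 h2d h2E] := right_regularization nd2 l2.
exists h1, h2; split=> // u u0; rewrite h1E// h2E// /n1 /n2; lra.
Qed.

(** The variation over [x, x + u] dominates the increments of g. *)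
Lemma bounded_variation_line_decomp (g : R -> R) (x : R) :
  bounded_variation_line g -> g t @[t --> +oo] --> (0 : R) ->
  exists h1 h2, [/\ decays h1, decays h2 &
    forall u, 0 < u -> g (x + u) = h1 u - h2 u].
Proof.
move=> [M gM] g0.
have BV a b : a <= b -> bounded_variation a b g.
  by move=> ab; exists M => v gv; apply: gM; exists a, b.
have fTV a b : a <= b -> total_variation a b g \is a fin_num.
  by move=> ab; apply/bounded_variationP => //; exact: BV.
(* Num.max extends the variation by 0 to the negative half-line. *)
pose T u := fine (total_variation x (x + Num.max u 0) g).
have xm u : x <= x + Num.max u 0 by rewrite lerDl le_max lexx orbT.
have key u v : u <= v -> `|g (x + Num.max v 0) - g (x + Num.max u 0)| <= T v - T u.
  move=> uv.
  have muv : x + Num.max u 0 <= x + Num.max v 0.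
    by rewrite lerD2l ge_max !le_max uv lexx orbT.
  rewrite /T (total_variationD g (xm u) muv) fineD ?fTV// addrAC subrr add0r.
  by rewrite -lee_fin fineK ?fTV//; exact: total_variation_ge.
have TM u : T u <= M.
  rewrite /T -lee_fin fineK ?fTV//; apply: ge_ereal_sup => _ [v gv <-].
  by rewrite lee_fin; apply: gM; exists x, (x + Num.max u 0).
have g0' : g (x + Num.max u 0) @[u --> +oo] --> (0 : R).
  apply/cvgrPdist_le => e e0; move/cvgrPdist_le : g0 => /(_ _ e0)[A [Ar HA]].
  near=> u; apply: HA; rewrite -ltrBlDl.
  by rewrite lt_max; apply/orP; left; near: u; apply: nbhs_pinfty_gt; exact: num_real.
have [h1 [h2 [h1d h2d hE]]] :=
  @dominated_variation_decomp (fun u => g (x + Num.max u 0)) T M key TM g0'.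
exists h1, h2; split=> // u u0; rewrite -hE//.
by rewrite (max_idPl (ltW u0)).
Unshelve. all: by end_near. Qed.

Lemma bounded_variation_line_opp (g : R -> R) :
  bounded_variation_line g -> bounded_variation_line (g \o -%R).
Proof.
move=> [M gM]; exists M => v [a [b [ab gv]]]; apply: gM.
exists (- b), (- a); rewrite lerN2; split => //.
by rewrite -variations_opp !opprK.
Qed.

End bv_decomposition.

(** * Centered integrals and integrals over annuli *)

Section centering.
Context {R : realType}.
Notation mu := (@lebesgue_measure R).

Lemma integrable_cc (g kap : R -> R) (C a b : R) :
  measurable_fun setT g -> (forall t, `|g t| <= C) -> continuous kap ->
  mu.-integrable `[a, b] (fun t => (kap t * g t)%:E).
Proof.
move=> mg gC ck; apply: (@integrable_Mbounded _ _ _ _ C) => //.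
  exact: continuous_integrable_itv.
exact: measurable_funTS.
Qed.

Lemma decomp_measurable_bounded (g h1 h2 : R -> R) : decays h1 -> decays h2 ->
  (forall u, 0 < u -> g u = h1 u - h2 u) ->
  measurable_fun (`]0, +oo[ : set R) g /\ forall u, 0 < u -> `|g u| <= h1 0 + h2 0.
Proof.
move=> h1d h2d gE; split.
  have : measurable_fun (`]0, +oo[ : set R) (fun u => h1 u - h2 u).
    by apply: measurable_funB; exact: decays_measurable.
  apply: eq_measurable_fun => u; rewrite inE/= in_itv/= andbT => u0.
  by rewrite gE.
move=> u u0; rewrite gE// (le_trans (ler_normB _ _))// !ger0_norm ?decays_ge0//.
by case: h1d h2d => [n1 _ _] [n2 _ _]; rewrite lerD// ?n1 ?n2// ltW.
Qed.

(** Each half-line is handled by a decomposition into monotone functions. *)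
Lemma bv_measurable_bounded (g : R -> R) : bounded_variation_line g ->
  g t @[t --> +oo] --> (0 : R) -> g t @[t --> -oo] --> (0 : R) ->
  measurable_fun setT g /\ exists C, forall t, `|g t| <= C.
Proof.
move=> gbv gp gm.
have [h1 [h2 [h1d h2d gE]]] := bounded_variation_line_decomp 0 gbv gp.
have {}gE u : 0 < u -> g u = h1 u - h2 u by move=> /gE; rewrite add0r.
have gm' : (g \o -%R) t @[t --> +oo] --> (0 : R) by exact/cvgNy_compNP.
have [k1 [k2 [k1d k2d kE]]] :=
  bounded_variation_line_decomp 0 (bounded_variation_line_opp gbv) gm'.
have {}kE u : 0 < u -> (g \o -%R) u = k1 u - k2 u by move=> /kE; rewrite add0r.
have [mp bp] := decomp_measurable_bounded h1d h2d gE.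
have [mm bm] := decomp_measurable_bounded k1d k2d kE.
split; last first.
  exists (`|g 0| + (h1 0 + h2 0) + (k1 0 + k2 0)) => t.
  have := decays_ge0 0 h1d; have := decays_ge0 0 h2d.
  have := decays_ge0 0 k1d; have := decays_ge0 0 k2d.
  have := normr_ge0 (g 0).
  case: (ltgtP 0 t) => [/bp|t0|<-]; [lra| |lra].
  have : 0 < - t by rewrite oppr_gt0.
  move=> /bm /=; rewrite opprK; lra.
have mm' : measurable_fun (`]-oo, 0[ : set R) g.
  have mk k : decays k -> measurable_fun (`]-oo, 0[ : set R) (k \o -%R).
    move=> [ndk _ _]; apply: nondecreasing_measurable => // u v uv.
    by rewrite /= ndk// lerN2.
  have : measurable_fun (`]-oo, 0[ : set R) (fun u => (k1 \o -%R) u - (k2 \o -%R) u).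
    by apply: measurable_funB; exact: mk.
  apply: eq_measurable_fun => u; rewrite inE/= in_itv/= => u0.
  by rewrite -kE ?oppr_gt0//= opprK.
have -> : [set: R] = `]-oo, 0[ `|` ([set 0] `|` `]0, +oo[).
  apply/seteqP; split=> t //= _; rewrite !in_itv/= andbT.
  by have [t0|t0|->] := ltgtP t 0; [left|right; right|right; left].
apply/measurable_funU => //; first exact: measurableU.
split=> //; apply/measurable_funU => //; split=> //.
exact: measurable_fun_set1.
Qed.

(** Translate the integral on the right of x, reflect the one on the left. *)
Lemma centered_split (g kap : R -> R) (C x A B : R) :
  measurable_fun setT g -> (forall t, `|g t| <= C) -> continuous kap ->
  A <= x -> x <= B ->
  \int[mu]_(t in `[A, B]) (kap (t - x) * g t) =
  \int[mu]_(u in `[0, B - x]) (kap u * g (x + u)) +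
  \int[mu]_(u in `[0, x - A]) (kap (- u) * g (x - u)).
Proof.
move=> mg gC ck Ax xB.
have ck' : continuous (fun t => kap (t - x)).
  move=> t; apply: continuous_comp; last exact: ck.
  by apply: cvgB; [exact: cvg_id|exact: cvg_cst].
have ig a b : mu.-integrable `[a, b] (EFin \o (fun t => kap (t - x) * g t)).
  by apply: integrable_cc gC _.
rewrite (Rintegral_split Ax xB)// addrC; congr (_ + _).
  rewrite -(preserves_Rintegral (preserves_shift x))//; last first.
    exact: integrable_measurable.
  rewrite (_ : _ @^-1` _ = `[0, B - x]%classic); last first.
    by apply/seteqP; split=> u /=; rewrite !in_itv/=; lra.
  by apply: eq_Rintegral => u _; rewrite addrAC subrr add0r.
rewrite -(preserves_Rintegral (preserves_comp (preserves_shift x) preserves_opp))//; last first.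
  exact: integrable_measurable.
rewrite (_ : _ @^-1` _ = `[0, x - A]%classic); last first.
  by apply/seteqP; split=> u /=; rewrite !in_itv/=; lra.
by apply: eq_Rintegral => u _; rewrite /= addrAC subrr add0r.
Qed.

Lemma decomp_transform (kap g h1 h2 : R -> R) (N : R) :
  mu.-integrable `[0, N] (EFin \o kap) ->
  decays h1 -> decays h2 -> (forall u, 0 < u -> g u = h1 u - h2 u) ->
  \int[mu]_(u in `[0, N]) (kap u * g u) =
  \int[mu]_(u in `[0, N]) (kap u * h1 u) - \int[mu]_(u in `[0, N]) (kap u * h2 u).
Proof.
move=> ck h1d h2d gE.
have i1 : mu.-integrable `[0, N] (EFin \o (fun u => kap u * h1 u)).
  exact: decays_integrable.
have i2 : mu.-integrable `[0, N] (EFin \o (fun u => kap u * h2 u)).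
  exact: decays_integrable.
rewrite -RintegralB//.
have sub : `]0, N] `<=` (`[0, N] : set R).
  by move=> u; rewrite /= !in_itv/= => /andP[/ltW -> ->].
have i12 : mu.-integrable `]0, N] (EFin \o (fun u => kap u * h1 u - kap u * h2 u)).
  by apply: integrableS (integrable_subr _ i1 i2).
have e u : u \in `]0, N]%classic -> kap u * h1 u - kap u * h2 u = kap u * g u.
  by rewrite inE/= in_itv/= => /andP[/gE ->]; rewrite mulrBr.
rewrite -[RHS]Rintegral_itv_obnd_cbnd// -[LHS]Rintegral_itv_obnd_cbnd; last first.
  by apply: eq_integrable i12 => // u ue; rewrite /= e.
by apply: eq_Rintegral => u ue; rewrite e.
Qed.

End centering.

Section annulus_integral.
Context {R : realType}.
Notation mu := (@lebesgue_measure R).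

Lemma annulusE (S T : R) : 0 < S -> annulus S T = `]S, T[ `|` `]- T, - S[.
Proof.
move=> S0; rewrite /annulus; apply/seteqP; split=> s /=; rewrite !in_itv/=.
  case: (ger0P s) => s0 H; [by left|right].
  by move: H; rewrite ltrNr andbC ltrNl.
move=> [|] /andP[Ss sT].
  by rewrite gtr0_norm ?Ss// (lt_trans S0).
by rewrite ltr0_norm ?(lt_trans sT) ?oppr_lt0// ltrNr sT ltrNl.
Qed.

Lemma measurable_annulus (S T : R) : 0 < S -> measurable (annulus S T).
Proof. by move=> S0; rewrite annulusE//; exact: measurableU. Qed.

Lemma mu_annulus_lty (S T : R) : 0 < S -> (mu (annulus S T) < +oo)%E.
Proof.
move=> S0; apply: le_lt_trans (mu_itv_lty (- T) T).
apply: le_measure; rewrite ?inE//; first exact: measurable_annulus.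
by move=> s; rewrite /annulus/= => /andP[_]; rewrite in_itv/= ltr_norml => /andP[/ltW -> /ltW ->].
Qed.

(** Fold the negative half of the annulus onto the positive one. *)
Lemma Rintegral_annulus (F : R -> R) (S T : R) : 0 < S -> S < T ->
  mu.-integrable (annulus S T) (EFin \o F) ->
  mu.-integrable `[S, T] (EFin \o F) ->
  mu.-integrable `[S, T] (EFin \o (F \o -%R)) ->
  \int[mu]_(s in annulus S T) F s = \int[mu]_(s in `[S, T]) (F s + F (- s)).
Proof.
move=> S0 ST iF iF1 iF2; rewrite RintegralD//.
move: iF; rewrite annulusE// => iF.
have sub : `]S, T[ `<=` (`[S, T] : set R).
  by move=> u; rewrite /= !in_itv/= => /andP[/ltW -> /ltW ->].
have sub2 : `]S, T] `<=` (`[S, T] : set R).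
  by move=> u; rewrite /= !in_itv/= => /andP[/ltW -> ->].
have oo_cc G : mu.-integrable `[S, T] (EFin \o G) ->
    \int[mu]_(s in `]S, T[) G s = \int[mu]_(s in `[S, T]) G s.
  move=> iG; rewrite Rintegral_itv_bndo_bndc ?Rintegral_itv_obnd_cbnd//.
    exact: integrableS iG.
  exact: integrableS iG.
rewrite Rintegral_setU//; last first.
  apply/disj_setPS => s [/=]; rewrite !in_itv/= => /andP[? ?] /andP[? ?]; lra.
rewrite -!oo_cc//; congr (_ + _).
rewrite -(preserves_Rintegral preserves_opp)//; last first.
  apply: integrable_measurable; apply: integrableS iF => //; exact: measurableU.
congr (Rintegral mu _ _); apply/seteqP; split=> s /=; rewrite !in_itv/=; lra.
Qed.

End annulus_integral.

(** * Convergence of the Fourier integral *)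

Section complex_tools.
Context {R : realType}.
Notation mu := (@lebesgue_measure R).
Local Notation normc := ComplexField.Normc.normc.

Lemma normc_le_abs (z : R[i]) : normc z <= `|complex.Re z| + `|complex.Im z|.
Proof.
case: z => a b /=; rewrite -[leRHS]ger0_norm ?addr_ge0// -sqrtr_sqr ler_wsqrtr//.
by rewrite sqrrD !real_normK ?num_real// lerD2r lerDl mulrn_wge0// mulr_ge0.
Qed.

Lemma abs_Re_le (z : R[i]) : `|complex.Re z| <= normc z.
Proof.
case: z => a b /=; rewrite -sqrtr_sqr ler_wsqrtr//.
by rewrite lerDl sqr_ge0.
Qed.

Lemma abs_Im_le (z : R[i]) : `|complex.Im z| <= normc z.
Proof.
case: z => a b /=; rewrite -sqrtr_sqr ler_wsqrtr//.
by rewrite lerDr sqr_ge0.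
Qed.

(** A positive element of R[i] is a positive real, so convergence in R[i] is
    convergence of the components. *)
Lemma cvg_complex (T : Type) (F : set_system T) (f : T -> R[i]) (a b : R) :
  Filter F -> complex.Re (f t) @[t --> F] --> a -> complex.Im (f t) @[t --> F] --> b ->
  (f t : R[i]^o) @[t --> F] --> (a +i* b : R[i]^o).
Proof.
move=> FF fa fb; apply/cvgrPdist_le => -[e ei].
rewrite ltcE /= => /andP[/eqP -> e0].
have e2 : 0 < e / 2 by rewrite divr_gt0.
move/cvgrPdist_le : fa => /(_ _ e2) Fa.
move/cvgrPdist_le : fb => /(_ _ e2) Fb.
apply: filterS2 Fa Fb => t; case: (f t) => x y /= xa yb.
have := normc_le_abs (a +i* b - (x +i* y)) => /=.
rewrite lecE/= eqxx/= => /le_trans; apply.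
by rewrite [leRHS]splitr lerD.
Qed.

Lemma complex_ReM (z w : R[i]) : complex.Re (z * w) =
  complex.Re z * complex.Re w - complex.Im z * complex.Im w.
Proof. by case: z w => a b [c d]. Qed.

Lemma complex_ImM (z w : R[i]) : complex.Im (z * w) =
  complex.Re z * complex.Im w + complex.Im z * complex.Re w.
Proof. by case: z w => a b [c d]. Qed.

Lemma complex_ReD (z w : R[i]) : complex.Re (z + w) = complex.Re z + complex.Re w.
Proof. by case: z w => a b [c d]. Qed.

Lemma complex_ImD (z w : R[i]) : complex.Im (z + w) = complex.Im z + complex.Im w.
Proof. by case: z w => a b [c d]. Qed.

Lemma complex_eq (z w : R[i]) : complex.Re z = complex.Re w ->
  complex.Im z = complex.Im w -> z = w.
Proof. by case: z w => a b [c d] /= -> ->. Qed.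

End complex_tools.

Section inversion.
Context {R : realType}.
Notation mu := (@lebesgue_measure R).

Lemma cvg_subr_pinfty (x : R) : (B - x) @[B --> +oo] --> +oo.
Proof.
apply/cvgryPge => M; near=> B; rewrite lerBrDr.
by near: B; apply: nbhs_pinfty_ge; exact: num_real.
Unshelve. all: by end_near. Qed.

Lemma cvg_rsub_ninfty (x : R) : (x - A) @[A --> -oo] --> +oo.
Proof.
apply/cvgryPge => M; near=> A; rewrite lerBrDr -lerBrDl.
by near: A; apply: nbhs_ninfty_le; exact: num_real.
Unshelve. all: by end_near. Qed.

(** Moving the origin to x multiplies the transform by exp(- i s x). *)
Lemma expi_shift (x s a b : R) : expi (x * s) *
    ((cos (s * x) * a - sin (s * x) * b) +i* - (cos (s * x) * b + sin (s * x) * a)) =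
  a +i* - b.
Proof.
have E : cos (x * s) ^+ 2 + sin (x * s) ^+ 2 = 1 by exact: cos2Dsin2.
rewrite [s * x]mulrC /expi.
move: E; set c := cos _; set d := sin _ => E.
have c2 : c ^+ 2 = 1 - d ^+ 2 by rewrite -E addrK.
by apply: complex_eq => /=; ring: c2.
Qed.

Section at_point.
Variables (g : R -> R) (x : R) (p1 p2 m1 m2 : R -> R) (M : R).
Hypotheses (mg : measurable_fun setT g) (gM : forall t, `|g t| <= M).
Hypotheses (p1d : decays p1) (p2d : decays p2) (m1d : decays m1) (m2d : decays m2).
Hypotheses (gp : forall u, 0 < u -> g (x + u) = p1 u - p2 u).
Hypotheses (gm : forall u, 0 < u -> g (x - u) = m1 u - m2 u).

(** Real part of exp(i x s) times the transform of g, in terms of the monotone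
    parts p1 - p2 of g(x + .) and m1 - m2 of g(x - .). *)
Definition even_part (s : R) : R :=
  (cos_improper p1 s - cos_improper p2 s) + (cos_improper m1 s - cos_improper m2 s).

(** Opposite of the imaginary part of exp(i x s) times the transform of g. *)
Definition odd_part (s : R) : R :=
  (sin_improper p1 s - sin_improper p2 s) - (sin_improper m1 s - sin_improper m2 s).

Lemma fourier_partialE (s A B : R) :
  fourier_partial g s (A, B) =
  (\int[mu]_(t in `[A, B]) (cos (s * t) * g t)) +i*
  (- \int[mu]_(t in `[A, B]) (sin (s * t) * g t)).
Proof.
rewrite /fourier_partial /cintegral /=; congr (_ +i* _).
  by apply: eq_Rintegral => t _; rewrite cosN mulr0 subr0.
rewrite -mulN1r -RintegralZl//; last first.
  by apply: integrable_cc gM _ => //; exact: continuous_sinM.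
by apply: eq_Rintegral => t _; rewrite sinN mulr0 add0r mulN1r mulNr.
Qed.

Lemma cvg_centered (kap P Q : R -> R) (p q : R) : continuous kap ->
  (forall N, P N = \int[mu]_(u in `[0, N]) (kap u * g (x + u))) ->
  (forall N, Q N = \int[mu]_(u in `[0, N]) (kap (- u) * g (x - u))) ->
  P N @[N --> +oo] --> p -> Q N @[N --> +oo] --> q ->
  \int[mu]_(t in `[AB.1, AB.2]) (kap (t - x) * g t)
    @[AB --> filter_prod (ninfty_nbhs R) (pinfty_nbhs R)] --> p + q.
Proof.
move=> ck PE QE Pp Qq.
have lP : P (AB.2 - x) @[AB --> filter_prod (ninfty_nbhs R) (pinfty_nbhs R)] --> p.
  have c1 : P (B - x) @[B --> +oo] --> p by exact: cvg_comp (cvg_subr_pinfty x) Pp.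
  exact: (@cvg_comp _ _ _ snd (fun B => P (B - x)) _ _ _ cvg_snd c1).
have lQ : Q (x - AB.1) @[AB --> filter_prod (ninfty_nbhs R) (pinfty_nbhs R)] --> q.
  have c1 : Q (x - A) @[A --> -oo] --> q by exact: cvg_comp (cvg_rsub_ninfty x) Qq.
  exact: (@cvg_comp _ _ _ fst (fun A => Q (x - A)) _ _ _ cvg_fst c1).
apply: cvg_trans (cvgD lP lQ); apply: near_eq_cvg.
exists ([set A | A <= x], [set B | x <= B]).
  by split; [apply: nbhs_ninfty_le|apply: nbhs_pinfty_ge]; exact: num_real.
by move=> [A B] /= [Ax xB]; rewrite (centered_split mg gM ck Ax xB) -PE -QE.
Qed.

Lemma cvg_decomp (kap k h1 h2 : R -> R) (a b : R) : continuous kap ->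
  decays h1 -> decays h2 -> (forall u, 0 < u -> k u = h1 u - h2 u) ->
  \int[mu]_(u in `[0, N]) (kap u * h1 u) @[N --> +oo] --> a ->
  \int[mu]_(u in `[0, N]) (kap u * h2 u) @[N --> +oo] --> b ->
  \int[mu]_(u in `[0, N]) (kap u * k u) @[N --> +oo] --> a - b.
Proof.
move=> ck h1d h2d kE ca cb; apply: cvg_trans (cvgB ca cb); apply: near_eq_cvg.
near=> N; rewrite (decomp_transform _ h1d h2d kE)//.
exact: continuous_integrable_itv.
Unshelve. all: by end_near. Qed.

Lemma cvg_even_part s : s != 0 ->
  \int[mu]_(t in `[AB.1, AB.2]) (cos (s * (t - x)) * g t)
    @[AB --> filter_prod (ninfty_nbhs R) (pinfty_nbhs R)] --> even_part s.
Proof.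
move=> s0; apply: (@cvg_centered (fun u => cos (s * u)) _ _ _ _ (@continuous_cosM _ _)) => //.
  by apply: (cvg_decomp (@continuous_cosM _ _) p1d p2d gp);
    [have [] := cos_improperP p1d s0|have [] := cos_improperP p2d s0].
under eq_fun do (under eq_Rintegral do rewrite mulrN cosN).
by apply: (cvg_decomp (@continuous_cosM _ _) m1d m2d gm);
    [have [] := cos_improperP m1d s0|have [] := cos_improperP m2d s0].
Qed.

Lemma cvg_odd_part s : s != 0 ->
  \int[mu]_(t in `[AB.1, AB.2]) (sin (s * (t - x)) * g t)
    @[AB --> filter_prod (ninfty_nbhs R) (pinfty_nbhs R)] --> odd_part s.
Proof.
move=> s0; apply: (@cvg_centered (fun u => sin (s * u)) _ _ _ _ (@continuous_sinM _ _)) => //.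
  by apply: (cvg_decomp (@continuous_sinM _ _) p1d p2d gp);
    [have [] := sin_improperP p1d s0|have [] := sin_improperP p2d s0].
have E N : \int[mu]_(u in `[0, N]) (sin (s * - u) * g (x - u)) =
   - \int[mu]_(u in `[0, N]) (sin (s * u) * g (x - u)).
  rewrite -mulN1r -RintegralZl//; last first.
    apply: (@integrable_cc _ (fun u => g (x - u)) _ M) => //.
      by apply: (measurableT_comp mg); case: (preserves_comp (preserves_shift x) preserves_opp).
    exact: continuous_sinM.
  by apply: eq_Rintegral => u _; rewrite mulrN sinN mulN1r mulNr.
under eq_fun do rewrite E.
apply: cvgN.
by apply: (cvg_decomp (@continuous_sinM _ _) m1d m2d gm);
    [have [] := sin_improperP m1d s0|have [] := sin_improperP m2d s0].
Qed.

(** Expand cos(s t) and sin(s t) around t = x; both centered integrals converge. *)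
Lemma cvg_fourier_partial s : s != 0 ->
  (fourier_partial g s AB : R[i]^o)
    @[AB --> filter_prod (ninfty_nbhs R) (pinfty_nbhs R)] -->
  ((cos (s * x) * even_part s - sin (s * x) * odd_part s) +i*
   - (cos (s * x) * odd_part s + sin (s * x) * even_part s) : R[i]^o).
Proof.
move=> s0.
have ic A B : mu.-integrable `[A, B] (EFin \o (fun t => cos (s * (t - x)) * g t)).
  apply: integrable_cc gM _ => // t; apply: continuous_comp; last exact: continuous_cos.
  apply: cvgM; first exact: cvg_cst.
  by apply: cvgB; [exact: cvg_id|exact: cvg_cst].
have is_ A B : mu.-integrable `[A, B] (EFin \o (fun t => sin (s * (t - x)) * g t)).
  apply: integrable_cc gM _ => // t; apply: continuous_comp; last exact: continuous_sin.
  apply: cvgM; first exact: cvg_cst.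
  by apply: cvgB; [exact: cvg_id|exact: cvg_cst].
have sE t : s * t = s * (t - x) + s * x by rewrite -mulrDr subrK.
have cE A B : \int[mu]_(t in `[A, B]) (cos (s * t) * g t) =
    cos (s * x) * \int[mu]_(t in `[A, B]) (cos (s * (t - x)) * g t) -
    sin (s * x) * \int[mu]_(t in `[A, B]) (sin (s * (t - x)) * g t).
  rewrite -!RintegralZl// -RintegralB//; [|exact: integrable_mull..].
  apply: eq_Rintegral => t _; rewrite {1}sE cosD; ring.
have sE' A B : \int[mu]_(t in `[A, B]) (sin (s * t) * g t) =
    cos (s * x) * \int[mu]_(t in `[A, B]) (sin (s * (t - x)) * g t) +
    sin (s * x) * \int[mu]_(t in `[A, B]) (cos (s * (t - x)) * g t).
  rewrite -!RintegralZl// -RintegralD//; [|exact: integrable_mull..].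
  apply: eq_Rintegral => t _; rewrite {1}sE sinD; ring.
pose c AB := \int[mu]_(t in `[AB.1, AB.2]) (cos (s * (t - x)) * g t).
pose d AB := \int[mu]_(t in `[AB.1, AB.2]) (sin (s * (t - x)) * g t).
have -> : fourier_partial g s = fun AB =>
    (cos (s * x) * c AB - sin (s * x) * d AB) +i*
    - (cos (s * x) * d AB + sin (s * x) * c AB).
  by apply/funext => -[A B]; rewrite fourier_partialE// cE sE'.
have cc := cvg_even_part s0; have cd := cvg_odd_part s0.
apply: cvg_complex => /=.
  by apply: cvgB; apply: cvgM => //; exact: cvg_cst.
by apply: cvgN; apply: cvgD; apply: cvgM => //; exact: cvg_cst.
Qed.

Lemma expi_fourier_improper s : s != 0 ->
  expi (x * s) * fourier_improper g s = even_part s +i* - odd_part s.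
Proof.
move=> s0; rewrite /fourier_improper.
have /cvg_lim -> := cvg_fourier_partial s0; last exact: norm_hausdorff.
exact: expi_shift.
Qed.

End at_point.

End inversion.

(** * Inversion at a point *)

Section inversion_limit.
Context {R : realType}.
Notation mu := (@lebesgue_measure R).

Lemma cos_improperN (h : R -> R) (s : R) : cos_improper h (- s) = cos_improper h s.
Proof.
rewrite /cos_improper; congr (lim _).
by under eq_fun do (under eq_Rintegral do rewrite mulNr cosN).
Qed.

Lemma sin_improperN (h : R -> R) (s : R) : decays h -> s != 0 ->
  sin_improper h (- s) = - sin_improper h s.
Proof.
move=> hd s0.
have EN N : \int[mu]_(u in `[0, N]) (sin (- s * u) * h u) =
    - \int[mu]_(u in `[0, N]) (sin (s * u) * h u).
  rewrite -[RHS]mulN1r -RintegralZl//; last first.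
    by apply: decays_integrable => //; apply: continuous_integrable_itv; exact: continuous_sinM.
  by apply: eq_Rintegral => u _; rewrite mulNr sinN mulN1r mulNr.
rewrite /sin_improper; under eq_fun do rewrite EN.
apply: cvg_lim => //; apply: cvgN.
by have [] := sin_improperP hd s0.
Qed.

Section at_point.
Variables (g : R -> R) (x : R) (p1 p2 m1 m2 : R -> R) (M : R).
Hypotheses (mg : measurable_fun setT g) (gM : forall t, `|g t| <= M).
Hypotheses (p1d : decays p1) (p2d : decays p2) (m1d : decays m1) (m2d : decays m2).
Hypotheses (gp : forall u, 0 < u -> g (x + u) = p1 u - p2 u).
Hypotheses (gm : forall u, 0 < u -> g (x - u) = m1 u - m2 u).

Let E := even_part p1 p2 m1 m2.
Let O := odd_part p1 p2 m1 m2.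

Lemma even_partN s : E (- s) = E s.
Proof. by rewrite /E /even_part !cos_improperN. Qed.

Lemma odd_partN s : s != 0 -> O (- s) = - O s.
Proof. by move=> s0; rewrite /O /odd_part !sin_improperN//; ring. Qed.

Lemma integrable_even_part (D : set R) (S : R) :
  measurable D -> (mu D < +oo)%E -> 0 < S -> (forall s, D s -> S <= `|s|) ->
  mu.-integrable D (EFin \o E).
Proof.
move=> mD Dfin S0 DS; have ic h : decays h -> mu.-integrable D (EFin \o cos_improper h).
  by move=> hd; exact: (integrable_cos_improper hd mD Dfin S0 DS).
by apply: integrable_addr => //; apply: integrable_subr => //; exact: ic.
Qed.

Lemma integrable_odd_part (D : set R) (S : R) :
  measurable D -> (mu D < +oo)%E -> 0 < S -> (forall s, D s -> S <= `|s|) ->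
  mu.-integrable D (EFin \o O).
Proof.
move=> mD Dfin S0 DS; have ic h : decays h -> mu.-integrable D (EFin \o sin_improper h).
  by move=> hd; exact: (integrable_sin_improper hd mD Dfin S0 DS).
by apply: integrable_subr => //; apply: integrable_subr => //; exact: ic.
Qed.

Lemma annulus_ge (S T s : R) : annulus S T s -> S <= `|s|.
Proof. by rewrite /annulus/= => /andP[/ltW]. Qed.

Lemma annulus_neq0 (S T s : R) : 0 < S -> annulus S T s -> s != 0.
Proof. by move=> S0 /annulus_ge Ss; rewrite -normr_gt0 (lt_le_trans S0). Qed.

Let expiE := expi_fourier_improper mg gM p1d p2d m1d m2d gp gm.

Lemma cintegrable_annulus (S T : R) : 0 < S ->
  cintegrable (annulus S T) (fun s => expi (x * s) * fourier_improper g s).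
Proof.
move=> S0; split.
- have := @integrable_even_part (annulus S T) S (measurable_annulus _ S0)
    (mu_annulus_lty _ S0) S0 (@annulus_ge S T).
  apply: eq_integrable; first exact: measurable_annulus.
  by move=> s /set_mem/(annulus_neq0 S0) s0; rewrite /= expiE.
- have := @integrable_mull _ _ (-1) _ (measurable_annulus T S0)
    (@integrable_odd_part (annulus S T) S (measurable_annulus _ S0)
      (mu_annulus_lty _ S0) S0 (@annulus_ge S T)).
  apply: eq_integrable; first exact: measurable_annulus.
  by move=> s /set_mem/(annulus_neq0 S0) s0; rewrite expiE//= mulN1r.
Qed.

(** The odd part integrates to 0 and the even part counts twice. *)
Lemma cintegral_annulus (S T : R) : 0 < S -> S < T ->
  cintegral (annulus S T) (fun s => expi (x * s) * fourier_improper g s) =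
  (2 * (\int[mu]_(s in `[S, T]) cos_improper p1 s -
        \int[mu]_(s in `[S, T]) cos_improper p2 s +
        (\int[mu]_(s in `[S, T]) cos_improper m1 s -
         \int[mu]_(s in `[S, T]) cos_improper m2 s))) +i* 0.
Proof.
move=> S0 ST.
have cc s : `[S, T]%classic s -> S <= `|s|.
  by rewrite /= in_itv/= => /andP[Ss _]; rewrite ger0_norm// (le_trans (ltW S0)).
have cN s : `[S, T]%classic s -> s != 0.
  by move=> /cc Ss; rewrite -normr_gt0 (lt_le_trans S0).
have ic h : decays h -> mu.-integrable `[S, T] (EFin \o cos_improper h).
  by move=> hd; apply: (integrable_cos_improper hd _ (mu_itv_lty _ _) S0 cc).
have iE := @integrable_even_part (annulus S T) S (measurable_annulus _ S0)
    (mu_annulus_lty _ S0) S0 (@annulus_ge S T).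
have iO := @integrable_odd_part (annulus S T) S (measurable_annulus _ S0)
    (mu_annulus_lty _ S0) S0 (@annulus_ge S T).
have iE1 := @integrable_even_part `[S, T] S (measurable_itv _) (mu_itv_lty _ _) S0 cc.
have iO1 := @integrable_odd_part `[S, T] S (measurable_itv _) (mu_itv_lty _ _) S0 cc.
rewrite /cintegral; congr (_ +i* _).
  transitivity (\int[mu]_(s in annulus S T) E s).
    by apply: eq_Rintegral => s /set_mem/(annulus_neq0 S0) s0; rewrite expiE.
  rewrite Rintegral_annulus//; last first.
    by apply: eq_integrable iE1 => // s _; rewrite /= even_partN.
  transitivity (\int[mu]_(s in `[S, T]) (2 * E s)).
    by apply: eq_Rintegral => s _; rewrite even_partN; ring.
  rewrite RintegralZl//; congr (_ * _).
  rewrite RintegralD ?RintegralB//; try exact: ic.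
    by apply: integrable_subr => //; exact: ic.
  by apply: integrable_subr => //; exact: ic.
transitivity (\int[mu]_(s in annulus S T) (-1 * O s)).
  by apply: eq_Rintegral => s /set_mem/(annulus_neq0 S0) s0; rewrite expiE//= mulN1r.
rewrite RintegralZl//; last exact: measurable_annulus.
(* On [S, T] the function O(s) + O(- s) vanishes. *)
have iO2 : mu.-integrable `[S, T] (EFin \o (O \o -%R)).
  apply: eq_integrable (integrable_mull (-1) _ iO1) => // s /set_mem /cN s0.
  by rewrite /= odd_partN// mulN1r.
rewrite Rintegral_annulus//.
rewrite (@eq_Rintegral _ _ _ _ _ (cst 0)); last first.
  by move=> s /set_mem /cN s0; rewrite odd_partN// subrr.
by rewrite Rintegral_cst_itv ?(ltW ST)// mul0r mulr0.
Qed.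

Lemma cvg_cintegral_annulus :
  (cintegral (annulus ST.1 ST.2)
     (fun s => expi (x * s) * fourier_improper g s) : R[i]^o)
   @[ST --> filter_prod (0^'+ : set_system R) (pinfty_nbhs R)] -->
   ((pi * (p1 0 - p2 0 + (m1 0 - m2 0))) +i* 0 : R[i]^o).
Proof.
pose I h (ST : R * R) := \int[mu]_(s in `[ST.1, ST.2]) cos_improper h s.
have cI h : decays h ->
    I h ST @[ST --> filter_prod (0^'+ : set_system R) (pinfty_nbhs R)] --> pi / 2 * h 0.
  exact: cvg_int_cos_improper.
have c : ((2 * (I p1 ST - I p2 ST + (I m1 ST - I m2 ST))) +i* 0 : R[i]^o)
   @[ST --> filter_prod (0^'+ : set_system R) (pinfty_nbhs R)] -->
   ((pi * (p1 0 - p2 0 + (m1 0 - m2 0))) +i* 0 : R[i]^o).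
  apply: cvg_complex => /=; last exact: cvg_cst.
  rewrite (_ : pi * _ = 2 * (pi / 2 * p1 0 - pi / 2 * p2 0 +
    (pi / 2 * m1 0 - pi / 2 * m2 0))); last by field.
  apply: cvgM; first exact: cvg_cst.
  by apply: cvgD; apply: cvgB; exact: cI.
apply: cvg_trans c; apply: near_eq_cvg.
exists ([set S | 0 < S < 1], [set T | 1 < T]) => /=.
  split; last by apply: nbhs_pinfty_gt; exact: num_real.
  near=> S; apply/andP; split; last by near: S; exact: nbhs_right_lt.
  by [].
move=> [S T] /= [/andP[S0 S1] T1].
by rewrite /= cintegral_annulus// (lt_trans S1).
Unshelve. all: by end_near. Qed.

Lemma cvg_at_right_decomp : g t @[t --> x^'+] --> p1 0 - p2 0.
Proof.
have c : p1 u - p2 u @[u --> 0^'+] --> p1 0 - p2 0.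
  by case: p1d p2d => [_ _ c1] [_ _ c2]; exact: cvgB.
apply/cvgrPdist_le => e e0; move/cvgrPdist_le : c => /(_ _ e0)[d /= d0 H].
exists d => //= t /= xt xltt.
have tx : 0 < t - x by rewrite subr_gt0.
have -> : g t = p1 (t - x) - p2 (t - x) by rewrite -gp// addrC subrK.
apply: H => //=.
by rewrite sub0r normrN distrC.
Qed.

Lemma cvg_at_left_decomp : g t @[t --> x^'-] --> m1 0 - m2 0.
Proof.
have c : m1 u - m2 u @[u --> 0^'+] --> m1 0 - m2 0.
  by case: m1d m2d => [_ _ c1] [_ _ c2]; exact: cvgB.
apply/cvgrPdist_le => e e0; move/cvgrPdist_le : c => /(_ _ e0)[d /= d0 H].
exists d => //= t /= xt tltx.
have tx : 0 < x - t by rewrite subr_gt0.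
have -> : g t = m1 (x - t) - m2 (x - t) by rewrite -gm// subKr.
apply: H => //=.
by rewrite sub0r normrN.
Qed.

End at_point.

Lemma heaviside_gt0 (x : R) : 0 < x -> heaviside x = 1.
Proof. by rewrite /heaviside => ->. Qed.

Lemma heaviside_lt0 (x : R) : x < 0 -> heaviside x = 0.
Proof. by move=> x0; rewrite /heaviside ltNge (ltW x0)/= lt_eqF. Qed.

Lemma cvg_heaviside_right (x : R) :
  heaviside t @[t --> x^'+] --> (if 0 <= x then 1 else 0 : R).
Proof.
apply: cvg_near_cst; case: leP => x0; near=> t.
  by rewrite heaviside_gt0// (le_lt_trans x0).
rewrite heaviside_lt0//; near: t; exact: nbhs_right_lt.
Unshelve. all: by end_near. Qed.

Lemma cvg_heaviside_left (x : R) :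
  heaviside t @[t --> x^'-] --> (if 0 < x then 1 else 0 : R).
Proof.
apply: cvg_near_cst; case: ltP => x0; near=> t.
  rewrite heaviside_gt0//; near: t; exact: nbhs_left_gt.
by rewrite heaviside_lt0// (lt_le_trans _ x0).
Unshelve. all: by end_near. Qed.

Lemma cvg_heavisideN_right (x : R) :
  heaviside (- t) @[t --> x^'+] --> (if 0 < - x then 1 else 0 : R).
Proof.
apply: cvg_near_cst; case: ltP => x0; near=> t.
  rewrite heaviside_gt0// oppr_gt0; near: t; apply: nbhs_right_lt.
  by rewrite -oppr_gt0.
by rewrite heaviside_lt0// oppr_lt0 (le_lt_trans (_ : 0 <= x))// -oppr_le0.
Unshelve. all: by end_near. Qed.

Lemma cvg_heavisideN_left (x : R) :
  heaviside (- t) @[t --> x^'-] --> (if 0 <= - x then 1 else 0 : R).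
Proof.
apply: cvg_near_cst; case: leP => x0; near=> t.
  by rewrite heaviside_gt0// oppr_gt0 (lt_le_trans (_ : t < x))// -oppr_ge0.
rewrite heaviside_lt0// oppr_lt0; near: t; apply: nbhs_left_gt.
by rewrite -oppr_lt0.
Unshelve. all: by end_near. Qed.

Lemma heaviside_mean (x : R) :
  heaviside x = ((if 0 <= x then 1 else 0) + (if 0 < x then 1 else 0)) / 2.
Proof. rewrite /heaviside; case: (ltgtP 0 x) => _; lra. Qed.

End inversion_limit.

(** * Rapidly decreasing and slowly growing functions *)

Section rapid_functions.
Context {R : realType}.
Notation mu := (@lebesgue_measure R).

(** Split the line at 0 and reflect the negative half-line. *)
Lemma Rintegral_fold (F : R -> R) : mu.-integrable setT (EFin \o F) ->
  mu.-integrable `]0, +oo[ (EFin \o (F \o -%R)) /\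
  \int[mu]_x F x = \int[mu]_(x in `]0, +oo[) (F x + F (- x)).
Proof.
move=> iF.
have iS D : measurable D -> mu.-integrable D (EFin \o F).
  by move=> mD; apply: integrableS iF.
have p : (@GRing.opp R) @^-1` `]-oo, 0[ = `]0, +oo[%classic.
  by apply/seteqP; split=> x /=; rewrite !in_itv/= andbT oppr_lt0.
have iN : mu.-integrable `]0, +oo[ (EFin \o (F \o -%R)).
  by rewrite -p; apply: (preserves_integrable preserves_opp) => //; exact: iS.
split=> //.
have -> : [set: R] = `]-oo, 0[ `|` `[0, +oo[.
  apply/seteqP; split=> x //= _; rewrite !in_itv/= andbT.
  by case: (ltP x 0); [left|right].
rewrite Rintegral_setU//; last first.
- by apply/disj_setPS => x [/=]; rewrite !in_itv/= andbT => x0 /(lt_le_trans x0); rewrite ltxx.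
- by apply: iS; exact: measurableU.
rewrite -Rintegral_itv_obnd_cbnd; last exact: iS.
rewrite -(preserves_Rintegral preserves_opp)//; last exact: integrable_measurable (iS _ _).
by rewrite p addrC [RHS]RintegralD//; exact: iS.
Qed.

Lemma integrable_oneDsqrV : mu.-integrable setT (fun x : R => ((1 + x ^+ 2)^-1)%:E) /\
  \int[mu]_x (1 + x ^+ 2)^-1 = pi :> R.
Proof.
have c : continuous (fun x : R => (1 + x ^+ 2)^-1) by exact: continuous_oneDsqrV.
have p0 (x : R) : 0 <= (1 + x ^+ 2)^-1 by rewrite invr_ge0 addr_ge0// sqr_ge0.
have I : (\int[mu]_x ((1 + x ^+ 2)^-1)%:E = pi%:E)%E.
  rewrite ge0_symfun_integralT//; last by move=> x; rewrite /= sqrrN.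
  by rewrite -set_itvcy integral0y_oneDsqr -EFinM mulrC divfK.
split; last by rewrite /Rintegral I.
apply/integrableP; split.
  by apply/measurable_EFinP; exact: continuous_measurable_fun.
under eq_integral do rewrite /= ger0_norm//.
by rewrite I ltry.
Qed.

(** Compare with A K / (1 + t ^ 2), whose integral over the line is A K pi. *)
Lemma weighted_integrable (u w : R -> R) (A K : R) (n : nat) :
  measurable_fun setT u -> measurable_fun setT w -> 0 <= A ->
  (forall t, `|u t| <= A * (1 + `|t| ^+ n)) ->
  (forall t, (1 + t ^+ 2) * (1 + `|t| ^+ n) * `|w t| <= K) ->
  mu.-integrable setT (fun t => (u t * w t)%:E) /\
  `|\int[mu]_t (u t * w t)| <= A * K * pi.
Proof.
move=> mu_ mw A0 uA wK.
have [i1 I1] := integrable_oneDsqrV.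
have i2 : mu.-integrable setT (fun t : R => (A * K * (1 + t ^+ 2)^-1)%:E).
  exact: integrable_mull.
have le t : `|u t * w t| <= A * K * (1 + t ^+ 2)^-1.
  have t2 : 0 < 1 + t ^+ 2 by rewrite ltr_pwDl// sqr_ge0.
  rewrite ler_pdivlMr// normrM.
  apply: (@le_trans _ _ (A * (1 + `|t| ^+ n) * `|w t| * (1 + t ^+ 2))).
    by rewrite ler_pM2r// ler_wpM2r.
  rewrite -!mulrA ler_wpM2l//.
  by rewrite mulrA mulrC mulrA.
have i : mu.-integrable setT (fun t => (u t * w t)%:E).
  apply: le_integrable i2 => //; first by apply/measurable_EFinP; exact: measurable_funM.
  by move=> t _; rewrite lee_fin (le_trans (le t))// ler_norm.
split => //; apply: (le_trans (le_Rintegral_bound _ i i2 _)) => //.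
by rewrite RintegralZl// I1.
Qed.

Definition slow (u : R -> R) := measurable_fun setT u /\
  exists A n, 0 <= A /\ forall t, `|u t| <= A * (1 + `|t| ^+ n).

Definition rapid (w : R -> R) := measurable_fun setT w /\
  forall j, exists C, forall t, `|t| ^+ j * `|w t| <= C.

Lemma rapid_weight (w : R -> R) (n : nat) : rapid w ->
  exists K, forall t, (1 + t ^+ 2) * (1 + `|t| ^+ n) * `|w t| <= K.
Proof.
move=> [_ wr]; have [C0 H0] := wr 0; have [C1 H1] := wr 2.
have [C2 H2] := wr n; have [C3 H3] := wr (2 + n)%N.
exists (C0 + C1 + C2 + C3) => t.
have := H0 t; have := H1 t; have := H2 t; have := H3 t.
rewrite expr0 mul1r exprD -(real_normK (num_real t)).
set a := `|t| ^+ 2; set b := `|t| ^+ n; set c := `|w t|.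
by move=> *; rewrite mulrDl !mulrDr !mulr1 !mul1r !mulrDl !mul1r; lra.
Qed.

Lemma slow_rapid_integrable (u w : R -> R) : slow u -> rapid w ->
  mu.-integrable setT (fun t => (u t * w t)%:E).
Proof.
move=> [mu_ [A [n [A0 uA]]]] wr; have [K HK] := rapid_weight n wr.
by have [] := weighted_integrable mu_ (proj1 wr) A0 uA HK.
Qed.

Lemma slow_bounded (u : R -> R) (C : R) : measurable_fun setT u ->
  (forall t, `|u t| <= C) -> slow u.
Proof.
move=> mu_ uC; split => //; exists C, 0%N.
have C0 : 0 <= C by exact: le_trans (uC 0).
by split => // t; rewrite (le_trans (uC t))// expr0 ler_peMr// lerDl.
Qed.

(** Below 1 in absolute value compare with 1, above 1 with the higher power. *)
Lemma norm_exp_le (t : R) (m n : nat) : (m <= n)%N -> `|t| ^+ m <= 1 + `|t| ^+ n.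
Proof.
move=> mn; have tn0 : 0 <= `|t| ^+ n by exact: exprn_ge0.
have [t1|t1] := leP `|t| 1.
  by rewrite (le_trans (exprn_ile1 _ _ t1))// lerDl.
apply: (@le_trans _ _ (`|t| ^+ n)); last by rewrite lerDr.
exact: ler_weXn2l (ltW t1) _ _ mn.
Qed.

Lemma slow_bound_widen (u : R -> R) (A : R) (m n : nat) : (m <= n)%N -> 0 <= A ->
  (forall t, `|u t| <= A * (1 + `|t| ^+ m)) ->
  forall t, `|u t| <= (A + A) * (1 + `|t| ^+ n).
Proof.
move=> mn A0 uA t; apply: (le_trans (uA t)).
have tn0 : 0 <= `|t| ^+ n by exact: exprn_ge0.
have := norm_exp_le t mn.
set a := `|t| ^+ m; set b := `|t| ^+ n in tn0 * => ab; nra.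
Qed.

Lemma slowD (u v : R -> R) : slow u -> slow v -> slow (fun t => u t + v t).
Proof.
move=> [mu_ [A [m [A0 uA]]]] [mv [B [n [B0 vB]]]].
split; first exact: measurable_funD.
exists ((A + A) + (B + B)), (maxn m n); split; first by rewrite !addr_ge0.
move=> t; rewrite (le_trans (ler_normD _ _))// mulrDl lerD//.
  exact: (slow_bound_widen (leq_maxl m n) A0 uA).
exact: (slow_bound_widen (leq_maxr m n) B0 vB).
Qed.

Lemma slowM (u v : R -> R) : slow u -> slow v -> slow (fun t => u t * v t).
Proof.
move=> [mu_ [A [m [A0 uA]]]] [mv [B [n [B0 vB]]]].
split; first exact: measurable_funM.
exists (A * B * 3), (m + n)%N; split; first by rewrite !mulr_ge0.
move=> t; rewrite normrM (le_trans (ler_pM _ _ (uA t) (vB t)))//.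
rewrite mulrACA -!mulrA !ler_wpM2l//.
have := norm_exp_le t (leq_addr n m); have := norm_exp_le t (leq_addl m n).
rewrite exprD; have : 0 <= `|t| ^+ m * `|t| ^+ n by rewrite mulr_ge0// exprn_ge0.
by set a := `|t| ^+ m; set b := `|t| ^+ n => *; nra.
Qed.

Lemma slow_exp (k : nat) : slow (fun t : R => t ^+ k).
Proof.
split; first by apply: continuous_measurable_fun; exact: exprn_continuous.
exists 1, k; split => // t; rewrite mul1r normrX lerDr//.
Qed.

Lemma rapid_integrable (w : R -> R) : rapid w -> mu.-integrable setT (EFin \o w).
Proof.
move=> wr; have s1 : slow (cst 1).
  by apply: (@slow_bounded _ 1) => [|t]; [exact: measurable_cst|rewrite normr1].
by have := slow_rapid_integrable s1 wr; under eq_fun do rewrite mul1r.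
Qed.

End rapid_functions.

(** * Cosine and sine transforms on the line *)

Section trig_transforms.
Context {R : realType}.
Notation mu := (@lebesgue_measure R).

Lemma rapid_cvg0 (w : R -> R) : rapid w ->
  w n%:R @[n --> \oo] --> (0 : R) /\ w (- n%:R) @[n --> \oo] --> (0 : R).
Proof.
move=> [_ wr]; have [C HC] := wr 1.
have C0 : 0 <= C by rewrite (le_trans _ (HC 0))// mulr_ge0.
have key (e : R) : 0 < e -> \forall n \near \oo, forall t, `|t| = n%:R -> `|w t| <= e.
  move=> e0; near=> n => t tn.
  have n0 : 0 < n%:R :> R by near: n; exact: nbhs_infty_gtr.
  have := HC t; rewrite expr1 tn mulrC -ler_pdivlMr// => /le_trans; apply.
  rewrite ler_pdivrMr// mulrC -ler_pdivrMr//.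
  by near: n; exact: nbhs_infty_ger.
split; apply/cvgrPdist_le => e /key H; near=> n; rewrite sub0r normrN.
  by near: n; apply: filterS H => n; apply; rewrite normr_nat.
by near: n; apply: filterS H => n; apply; rewrite normrN normr_nat.
Unshelve. all: by end_near. Qed.

Lemma Rintegral_truncT (w : R -> R) : mu.-integrable setT (EFin \o w) ->
  \int[mu]_(x in `[- n%:R, n%:R]) w x @[n --> \oo] --> \int[mu]_x w x.
Proof.
move=> wi.
have := @Rintegral_exhaust R setT (fun n => `[- n%:R, n%:R]%classic) w measurableT
  (fun n => measurable_itv _) wi.
under eq_fun do rewrite setTI.
apply => x _; near=> n; rewrite /= in_itv/= -ler_norml.
by near: n; exact: nbhs_infty_ger.
Unshelve. all: by end_near. Qed.

(** The integral of f over [- n, n] is F(n) - F(- n). *)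
Lemma Rintegral_derive_eq0 (F f : R -> R) :
  (forall x : R, is_derive x 1 F (f x)) -> continuous f ->
  mu.-integrable setT (EFin \o f) ->
  F n%:R @[n --> \oo] --> (0 : R) -> F (- n%:R) @[n --> \oo] --> (0 : R) ->
  \int[mu]_x f x = 0.
Proof.
move=> dF cf fi F1 F2.
have H1 := Rintegral_truncT fi.
have H2 : \int[mu]_(x in `[- n%:R, n%:R]) f x @[n --> \oo] --> (0 - 0 : R).
  have E n : \int[mu]_(x in `[- n%:R, n%:R]) f x = F n%:R - F (- n%:R).
    apply: (@FTC_itv _ _ _ F f); first by rewrite -subr_ge0 opprK addr_ge0.
    by move=> x _; exact: cf.
  by under eq_fun do rewrite E; exact: cvgB.
by rewrite -(cvg_lim _ H1)// (cvg_lim _ H2)// subrr.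
Qed.

Definition cosT (psi : R -> R) (t : R) := \int[mu]_x (cos (t * x) * psi x).
Definition sinT (psi : R -> R) (t : R) := \int[mu]_x (sin (t * x) * psi x).

Definition C1rapid (psi dpsi : R -> R) :=
  [/\ forall x : R, is_derive x 1 psi (dpsi x), continuous dpsi, rapid psi & rapid dpsi].

Lemma integrable_kernel (kap psi : R -> R) : continuous kap -> (forall x, `|kap x| <= 1) ->
  rapid psi -> mu.-integrable setT (fun x => (kap x * psi x)%:E).
Proof.
move=> ck k1 pr; apply: slow_rapid_integrable => //.
by apply: slow_bounded k1; exact: continuous_measurable_fun.
Qed.

Lemma integrable_cosT psi t : rapid psi ->
  mu.-integrable setT (fun x => (cos (t * x) * psi x)%:E).
Proof.
by apply: integrable_kernel => [|x]; [exact: continuous_cosM|exact: cos_max].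
Qed.

Lemma integrable_sinT psi t : rapid psi ->
  mu.-integrable setT (fun x => (sin (t * x) * psi x)%:E).
Proof.
by apply: integrable_kernel => [|x]; [exact: continuous_sinM|exact: sin_max].
Qed.

Lemma cosT_le psi t : rapid psi -> `|cosT psi t| <= \int[mu]_x `|psi x|.
Proof.
move=> pr; apply: le_Rintegral_bound => //; first exact: integrable_cosT.
  exact: integrable_norm (rapid_integrable pr).
by move=> x _; rewrite normrM ler_piMl// cos_max.
Qed.

Lemma sinT_le psi t : rapid psi -> `|sinT psi t| <= \int[mu]_x `|psi x|.
Proof.
move=> pr; apply: le_Rintegral_bound => //; first exact: integrable_sinT.
  exact: integrable_norm (rapid_integrable pr).
by move=> x _; rewrite normrM ler_piMl// sin_max.
Qed.

Lemma rapid_kernel0 (kap psi : R -> R) : (forall x, `|kap x| <= 1) -> rapid psi ->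
  kap n%:R * psi n%:R @[n --> \oo] --> (0 : R) /\
  kap (- n%:R) * psi (- n%:R) @[n --> \oo] --> (0 : R).
Proof.
move=> k1 /rapid_cvg0[p1 p2].
have H (u v : nat -> R) : (forall n, `|u n| <= 1) -> v n @[n --> \oo] --> (0 : R) ->
    u n * v n @[n --> \oo] --> (0 : R).
  move=> u1 /cvgrPdist_le v0; apply/cvgrPdist_le => e /v0; apply: filterS => n.
  rewrite !sub0r !normrN normrM => /(le_trans _); apply.
  by rewrite ler_piMl.
by split; apply: H.
Qed.

(** Integration by parts, as the vanishing integral of the derivative of
    cos(t x) psi(x). *)
Lemma cosT_derive psi dpsi t : C1rapid psi dpsi -> cosT dpsi t = t * sinT psi t.
Proof.
move=> [dp cdp pr dpr].
have cp : continuous psi by move=> x; exact: is_derive_continuous (dp x).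
have i1 := integrable_cosT t dpr; have i2 := integrable_sinT t pr.
apply/eqP; rewrite -subr_eq0 /cosT /sinT -RintegralZl// -RintegralB//; last first.
  exact: integrable_mull.
apply/eqP; have [l1 l2] := rapid_kernel0 (fun x => cos_max (t * x)) pr.
apply: (@Rintegral_derive_eq0 (fun x => cos (t * x) * psi x)) => //.
- move=> x; have := dp x => ?; apply: is_derive_eq; rewrite /GRing.scale/=; ring.
- move=> x; apply: cvgB; apply: cvgM; [exact: continuous_cosM|exact: cdp|exact: cvg_cst|].
  by apply: cvgM; [exact: continuous_sinM|exact: cp].
- by apply: integrable_subr => //; exact: integrable_mull.
Qed.

Lemma sinT_derive psi dpsi t : C1rapid psi dpsi -> sinT dpsi t = - (t * cosT psi t).
Proof.
move=> [dp cdp pr dpr].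
have cp : continuous psi by move=> x; exact: is_derive_continuous (dp x).
have i1 := integrable_sinT t dpr; have i2 := integrable_cosT t pr.
apply/eqP; rewrite -addr_eq0 /cosT /sinT -RintegralZl// -RintegralD//; last first.
  exact: integrable_mull.
apply/eqP; have [l1 l2] := rapid_kernel0 (fun x => sin_max (t * x)) pr.
apply: (@Rintegral_derive_eq0 (fun x => sin (t * x) * psi x)) => //.
- move=> x; have := dp x => ?; apply: is_derive_eq; rewrite /GRing.scale/=; ring.
- move=> x; apply: cvgD; apply: cvgM; [exact: continuous_sinM|exact: cdp|exact: cvg_cst|].
  by apply: cvgM; [exact: continuous_cosM|exact: cp].
- by apply: integrable_addr => //; exact: integrable_mull.
Qed.

Lemma continuous_transform (kap psi : R -> R) : continuous kap -> (forall x, `|kap x| <= 1) ->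
  rapid psi -> continuous (fun t : R => \int[mu]_x (kap (t * x) * psi x)).
Proof.
move=> ck k1 pr a.
have ip := rapid_integrable pr.
have ik t : mu.-integrable setT (fun x => (kap (t * x) * psi x)%:E).
  apply: (@integrable_kernel (fun x => kap (t * x))) => //.
  exact: continuous_mulr_comp.
have aI : a \in (`](a - 1), (a + 1)[%classic : set R).
  by rewrite inE/= in_itv/=; apply/andP; split; rewrite ?ltrBlDr ltrDl.
apply: (@continuity_under_integral R _ _ mu (fun t x => kap (t * x) * psi x) setT
  measurableT (a - 1) (a + 1) (fun t _ => ik t) _ (fun x => `|psi x|)
  (integrable_norm ip) _ a aI).
- apply: aeW => x _ t _; apply: cvgM; last exact: cvg_cst.
  by apply: continuous_comp; [exact: mulrr_continuous|exact: ck].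
- by move=> t _; apply: aeW => x _; rewrite normrM ler_piMl.
Qed.

End trig_transforms.

(** * The Riemann-Lebesgue lemma on a half-line *)

Section half_line.
Context {R : realType}.
Notation mu := (@lebesgue_measure R).

(** Both sides are integrals over the part of D outside E. *)
Lemma Rintegral_restrict_close (D E : set R) (f v : R -> R) :
  measurable D -> measurable E -> mu.-integrable D (EFin \o f) ->
  mu.-integrable D (EFin \o v) -> (forall x, D x -> `|f x| <= v x) ->
  `|\int[mu]_(x in D) f x - \int[mu]_(x in D `&` E) f x| <=
  \int[mu]_(x in D) v x - \int[mu]_(x in D `&` E) v x.
Proof.
move=> mD mE fi vi fv.
have ip g : mu.-integrable D (EFin \o g) -> mu.-integrable D (EFin \o (g \_ E)).
  move=> gi; rewrite -restrict_EFin; apply/integrable_restrict => //.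
  by apply: integrableS gi => //; exact: measurableI.
rewrite !Rintegral_mkcondr -!RintegralB//; try exact: ip.
apply: le_Rintegral_bound => //; try by apply: integrable_subr => //; exact: ip.
move=> x Dx; rewrite !patchE; case: ifPn => _; first by rewrite !subrr normr0.
by rewrite !subr0 fv.
Qed.

Lemma half_line_trunc (w : R -> R) : mu.-integrable `]0, +oo[ (EFin \o w) ->
  \int[mu]_(x in `[0, n%:R]) w x @[n --> \oo] --> \int[mu]_(x in `]0, +oo[) w x.
Proof.
move=> wi.
have E (n : nat) : \int[mu]_(x in `]0, +oo[ `&` `[0, n%:R]) w x = \int[mu]_(x in `[0, n%:R]) w x.
  have -> : `]0, +oo[ `&` `[0, n%:R] = `]0, n%:R]%classic :> set R.
    apply/seteqP; split=> x /=; rewrite !in_itv/= ?andbT.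
      by move=> [-> /andP[_ ->]].
    by move=> /andP[x0 ->]; rewrite x0 ltW.
  rewrite Rintegral_itv_obnd_cbnd//; apply: integrableS wi => //.
  by move=> x /=; rewrite !in_itv/= andbT => /andP[].
have -> : (fun n : nat => \int[mu]_(x in `[0, n%:R]) w x) =
    (fun n => \int[mu]_(x in `]0, +oo[ `&` `[0, n%:R]) w x).
  by apply/funext => n; rewrite E.
apply: (@Rintegral_exhaust R `]0, +oo[ (fun n => `[0, n%:R]%classic)) => // x; rewrite /= in_itv/= andbT => x0; near=> n; rewrite /= in_itv/= (ltW x0)/=.
by near: n; exact: nbhs_infty_ger.
Unshelve. all: by end_near. Qed.

(** Integrate by parts once: the primitive sin(t x) / t supplies the factor 1 / t. *)
Lemma cos_IBP_le (w dw : R -> R) (a b : R) : 0 < a -> a <= b ->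
  (forall x : R, 0 < x -> is_derive x 1 w (dw x)) ->
  (forall x : R, 0 < x -> {for x, continuous dw}) ->
  exists K, forall t : R, 0 < t -> `|\int[mu]_(x in `[a, b]) (w x * cos (t * x))| <= K / t.
Proof.
move=> a0 ab dwP cdw.
have cw (x : R) : 0 < x -> {for x, continuous w} by move=> x0; exact: is_derive_continuous (dwP x x0).
have pos x : x \in `[a, b] -> 0 < x by rewrite in_itv/= => /andP[ax _]; exact: lt_le_trans ax.
have icc (f : R -> R) : (forall x : R, 0 < x -> {for x, continuous f}) -> mu.-integrable `[a, b] (EFin \o f).
  move=> cf; apply: continuous_compact_integrable; first exact: segment_compact.
  by apply: continuous_in_subspaceT => x; rewrite inE/= => /pos; exact: cf.
exists (`|w b| + `|w a| + \int[mu]_(x in `[a, b]) `|dw x|) => t t0.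
have i1 : mu.-integrable `[a, b] (EFin \o (fun x => w x * cos (t * x))).
  by apply: icc => x x0; apply: (@cvgM R R); [exact: cw|exact: continuous_cosM].
have i2 : mu.-integrable `[a, b] (EFin \o (fun x => dw x * sin (t * x))).
  by apply: icc => x x0; apply: (@cvgM R R); [exact: cdw|exact: continuous_sinM].
have tn0 : t != 0 by rewrite gt_eqF.
have dF (x : R) : a <= x <= b -> is_derive x 1 (fun x => w x * sin (t * x) / t)
    (w x * cos (t * x) + t^-1 * (dw x * sin (t * x))).
  move=> /andP[ax _]; have ? := dwP _ (lt_le_trans a0 ax).
  by apply: is_derive_eq; rewrite /GRing.scale/=; field.
have := FTC_itv ab _ dF; rewrite RintegralD//; last exact: integrable_mull.
rewrite RintegralZl// => H.
have -> : \int[mu]_(x in `[a, b]) (w x * cos (t * x)) =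
   (w b * sin (t * b) - w a * sin (t * a) - \int[mu]_(x in `[a, b]) (dw x * sin (t * x))) / t.
  rewrite mulrBl mulrBl -H ?[t^-1 * _]mulrC ?addrK//.
  move=> x /pos x0; apply: (@cvgD R R).
    by apply: (@cvgM R R); [exact: cw|exact: continuous_cosM].
  apply: (@cvgM R R); first exact: cvg_cst.
  by apply: (@cvgM R R); [exact: cdw|exact: continuous_sinM].
rewrite normrM normfV (gtr0_norm t0) ler_pM2r ?invr_gt0//.
have s1 (f x : R) : `|f * sin (t * x)| <= `|f| by rewrite normrM ler_piMr// sin_max.
rewrite (le_trans (ler_normB _ _))// lerD//.
  by rewrite (le_trans (ler_normB _ _))// lerD.
apply: le_Rintegral_bound => //; apply: integrable_norm; exact: icc.
Qed.

(** Cut to a compact interval of the open half-line up to e / 2 in L1, and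
    integrate by parts there. The singularity of dw at 0 is never met. *)
Lemma riemann_lebesgue (w dw : R -> R) :
  (forall x : R, 0 < x -> is_derive x 1 w (dw x)) ->
  (forall x : R, 0 < x -> {for x, continuous dw}) ->
  mu.-integrable `]0, +oo[ (EFin \o w) ->
  \int[mu]_(x in `]0, +oo[) (w x * cos (n%:R * x)) @[n --> \oo] --> (0 : R).
Proof.
move=> dwP cdw wi; apply/cvgrPdist_le => e e0.
have e2 : 0 < e / 2 by rewrite divr_gt0.
have wni := integrable_norm wi.
pose E m : set R := `[m.+1%:R^-1, m.+1%:R]%classic.
have ED (x : R) : `]0, +oo[%classic x -> \forall n \near \oo, E n x.
  rewrite /= in_itv/= andbT => x0; near=> n; rewrite /E /= in_itv/=.
  apply/andP; split.
    rewrite invf_ple ?posrE//.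
    by rewrite (@le_trans _ _ n%:R) ?ler_nat//; near: n; exact: nbhs_infty_ger.
  by rewrite (@le_trans _ _ n%:R) ?ler_nat//; near: n; exact: nbhs_infty_ger.
have /cvgrPdist_le /(_ _ e2) := @Rintegral_exhaust R `]0, +oo[ E (fun x => `|w x|)
  (measurable_itv _) (fun n => measurable_itv _) wni ED.
move=> [m _ /(_ m (leqnn _)) /=]; rewrite -/(E m) => Hm.
have m0 : 0 < m.+1%:R^-1 :> R by rewrite invr_gt0.
have m1 : m.+1%:R^-1 <= m.+1%:R :> R by rewrite (@le_trans _ _ 1) ?invf_le1 ?ler1n.
have [K HK] := cos_IBP_le m0 m1 dwP cdw.
near=> n.
have n0 : 0 < n%:R :> R by near: n; exact: nbhs_infty_gtr.
have wc : mu.-integrable `]0, +oo[ (EFin \o (fun x => w x * cos (n%:R * x))).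
  apply: (@integrable_Mbounded _ _ _ _ 1) => //; last by move=> *; exact: cos_max.
  by apply: measurable_funTS; apply: continuous_measurable_fun; exact: continuous_cosM.
have close := @Rintegral_restrict_close `]0, +oo[ (E m) _ (fun x => `|w x|) (measurable_itv _)
  (measurable_itv _) wc wni.
have {}close : `|\int[mu]_(x in `]0, +oo[) (w x * cos (n%:R * x)) -
     \int[mu]_(x in `]0, +oo[ `&` E m) (w x * cos (n%:R * x))| <= e / 2.
  apply: (le_trans (close _)); last exact: le_trans (ler_norm _) Hm.
  by move=> x _; rewrite normrM ler_piMr// cos_max.
have DE : `]0, +oo[ `&` E m = E m.
  apply/seteqP; split=> x; first by case.
  split => //; move: H; rewrite /E /= !in_itv/= andbT => /andP[mx _].
  exact: lt_le_trans mx.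
rewrite DE in close.
have b : `|\int[mu]_(x in E m) (w x * cos (n%:R * x))| <= e / 2.
  apply: (le_trans (HK _ n0)); rewrite ler_pdivrMr// mulrC -ler_pdivrMr//.
  by near: n; exact: nbhs_infty_ger.
rewrite sub0r normrN (splitr e) -(subrK (\int[mu]_(x in E m) (w x * cos (n%:R * x))) (Rintegral _ _ _)).
by rewrite (le_trans (ler_normD _ _))// lerD.
Unshelve. all: by end_near. Qed.

End half_line.

(** * Integrals of the transforms over a half-line *)

Section half_line_formulas.
Context {R : realType}.
Notation mu := (@lebesgue_measure R).

Lemma rapid_cvgy (w : R -> R) : rapid w -> w x @[x --> +oo] --> (0 : R).
Proof.
move=> [_ wr]; have [C HC] := wr 1.
have C0 : 0 <= C by rewrite (le_trans _ (HC 0))// mulr_ge0.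
apply/cvgrPdist_le => e e0; near=> x.
have x0 : 0 < x by near: x; apply: nbhs_pinfty_gt; exact: num_real.
rewrite sub0r normrN; have := HC x.
rewrite expr1 gtr0_norm// mulrC -ler_pdivlMr// => /le_trans; apply.
rewrite ler_pdivrMr// mulrC -ler_pdivrMr//.
Unshelve. all: by end_near. Qed.

Lemma rapidD (u v : R -> R) : rapid u -> rapid v -> rapid (fun x => u x + v x).
Proof.
move=> [mu_ ur] [mv vr]; split; first exact: measurable_funD.
move=> j; have [A HA] := ur j; have [B HB] := vr j; exists (A + B) => t.
rewrite (le_trans (ler_wpM2l _ (ler_normD _ _)))// mulrDr lerD//.
Qed.

Lemma rapidN (u : R -> R) : rapid u -> rapid (fun x => - u x).
Proof.
move=> [mu_ ur]; split.
  exact: measurableT_comp.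
by move=> j; have [A HA] := ur j; exists A => t; rewrite normrN.
Qed.

Lemma rapid_refl (u : R -> R) : rapid u -> rapid (fun x => u (- x)).
Proof.
move=> [mu_ ur]; split.
  by apply: (measurableT_comp mu_); apply: continuous_measurable_fun; exact: opp_continuous.
by move=> j; have [A HA] := ur j; exists A => t; have := HA (- t); rewrite normrN.
Qed.

Lemma C1rapid_even (psi dpsi : R -> R) : C1rapid psi dpsi ->
  C1rapid (fun x => psi x + psi (- x)) (fun x => dpsi x - dpsi (- x)).
Proof.
move=> [dp cdp pr dpr]; split.
- move=> x; have := dp x => ?; have := dp (- x) => ?.
  have ? : is_derive x 1 (fun x => psi (- x)) (dpsi (- x) * -1).
    by apply: is_derive1_comp.
  by apply: is_derive_eq; rewrite mulrN1.
- move=> x; apply: cvgB; first exact: cdp.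
  by apply: continuous_comp; [exact: opp_continuous|exact: cdp].
- by apply: rapidD => //; exact: rapid_refl.
- by apply: rapidD => //; apply: rapidN; exact: rapid_refl.
Qed.

Lemma C1rapid_continuous (psi dpsi : R -> R) : C1rapid psi dpsi -> continuous psi.
Proof. by move=> [dp _ _ _] x; exact: is_derive_continuous (dp x). Qed.

(** The integral of |q'| over [0, u] dominates the increments of q. *)
Lemma C1rapid_decomp (q dq : R -> R) : C1rapid q dq ->
  exists h1 h2, [/\ decays h1, decays h2,
    forall u, 0 < u -> q u = h1 u - h2 u & q 0 = h1 0 - h2 0].
Proof.
move=> qC; have cq := C1rapid_continuous qC; have [dqP cdq qr dqr] := qC.
have cn : continuous (fun x => `|dq x|).
  by move=> x; apply: cvg_norm; exact: cdq.
pose T u := \int[mu]_(x in `[0, Num.max u 0]) `|dq x|.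
have m0 (u : R) : 0 <= Num.max u 0 by rewrite le_max lexx orbT.
have key u v : u <= v -> `|q (Num.max v 0) - q (Num.max u 0)| <= T v - T u.
  move=> uv.
  have muv : Num.max u 0 <= Num.max v 0 by rewrite ge_max !le_max uv lexx orbT.
  have -> : T v = T u + \int[mu]_(x in `[Num.max u 0, Num.max v 0]) `|dq x|.
    by apply: Rintegral_split => //; exact: continuous_integrable_itv.
  rewrite addrAC subrr add0r.
  have dF (x : R) : Num.max u 0 <= x <= Num.max v 0 -> is_derive x 1 q (dq x) by move=> _.
  rewrite -(FTC_itv muv _ dF); last by move=> x _; exact: cdq.
  by apply: le_Rintegral_bound => //; exact: continuous_integrable_itv.
have TM u : T u <= \int[mu]_x `|dq x|.
  have ni := integrable_norm (rapid_integrable dqr).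
  rewrite /T [leLHS]Rintegral_mkcond; apply: le_Rintegral => //.
    rewrite -restrict_EFin; apply/integrable_restrict => //.
    by rewrite setTI; exact: continuous_integrable_itv.
  by move=> x _; rewrite patchE; case: ifPn => // _; exact: normr_ge0.
have q0 : q (Num.max u 0) @[u --> +oo] --> (0 : R).
  apply: cvg_trans (rapid_cvgy qr); apply: near_eq_cvg; near=> u.
  by rewrite (max_idPl _)//; near: u; apply: nbhs_pinfty_ge; exact: num_real.
have [h1 [h2 [h1d h2d hE]]] := dominated_variation_decomp key TM q0.
have {}hE u : 0 < u -> q u = h1 u - h2 u.
  by move=> u0; rewrite -hE// (max_idPl (ltW u0)).
exists h1, h2; split => //.
have c1 : q u @[u --> 0^'+] --> q 0 by apply: cvg_at_right_filter; exact: cq.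
have c2 : h1 u - h2 u @[u --> 0^'+] --> h1 0 - h2 0.
  by case: h1d h2d => [_ _ d1] [_ _ d2]; exact: cvgB.
have c3 : q u @[u --> 0^'+] --> h1 0 - h2 0.
  by apply: cvg_trans c2; apply: near_eq_cvg; near=> u; rewrite hE.
by rewrite -(cvg_lim _ c1)// (cvg_lim _ c3).
Unshelve. all: by end_near. Qed.

(** The truncated Dirichlet integrals are close to pi / 2 q(0) uniformly in large
    truncations, so the bound passes to the half-line. *)
Lemma dirichlet_rapid (q dq : R -> R) : C1rapid q dq ->
  \int[mu]_(x in `]0, +oo[) (sin (n%:R * x) / x * q x) @[n --> \oo] --> pi / 2 * q 0.
Proof.
move=> qC; have [dqP cdq qr dqr] := qC.
have [h1 [h2 [h1d h2d hE h0]]] := C1rapid_decomp qC.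
apply/cvgrPdist_le => e e0.
have e4 : 0 < e / 4 by rewrite divr_gt0.
have [T1 [N1 [T10 N10 H1]]] := dirichlet_int_large h1d e4.
have [T2 [N2 [T20 N20 H2]]] := dirichlet_int_large h2d e4.
near=> n.
have nT1 : T1 < n%:R by near: n; exact: nbhs_infty_gtr.
have nT2 : T2 < n%:R by near: n; exact: nbhs_infty_gtr.
have iq : mu.-integrable `]0, +oo[ (EFin \o (fun x => sin (n%:R * x) / x * q x)).
  have : mu.-integrable `]0, +oo[ (fun x => (q x * (sin (n%:R * x) / x))%:E).
    apply: (@integrable_Mbounded _ _ _ _ `|n%:R|) => //.
    - by apply: integrableS (rapid_integrable qr).
    - by apply: measurable_funTS; exact: measurable_dker.
    - by move=> u _; exact: abs_dker_le.
  by apply: eq_integrable => // x _ /=; rewrite mulrC.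
have /cvgrPdist_le /(_ _ (divr_gt0 e0 (ltr0n _ 2))) [P _ HP] := half_line_trunc iq.
near \oo => N.
have PN : (P <= N)%N by near: N; exact: nbhs_infty_ge.
have NN1 : N1 <= N%:R by near: N; exact: nbhs_infty_ger.
have NN2 : N2 <= N%:R by near: N; exact: nbhs_infty_ger.
have := HP _ PN; rewrite /= (decomp_transform _ h1d h2d hE); last exact: integrable_dker.
rewrite -!/(dirichlet_int _ _ _).
have := H1 _ _ nT1 NN1; have := H2 _ _ nT2 NN2; rewrite h0.
set I := Rintegral _ _ _.
rewrite !ler_norml => /andP[? ?] /andP[? ?] /andP[? ?]; apply/andP; split; lra.
Unshelve. all: by end_near. Qed.

Lemma transform_Fubini (kap psi : R -> R) (N : R) : continuous kap ->
  (forall x, `|kap x| <= 1) -> rapid psi ->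
  mu.-integrable setT (fun x => (psi x * \int[mu]_(t in `[0, N]) kap (t * x))%:E) /\
  \int[mu]_(t in `[0, N]) (\int[mu]_x (kap (t * x) * psi x)) =
  \int[mu]_x (psi x * \int[mu]_(t in `[0, N]) kap (t * x)).
Proof.
move=> ck k1 pr.
have mk : measurable_fun setT (fun z : R * R => kap (z.1 * z.2)).
  apply: measurableT_comp; first exact: continuous_measurable_fun.
  by apply: measurable_funM; [exact: measurable_fst|exact: measurable_snd].
have [_ i2 <-] := @kernel_Fubini R `[0, N] setT psi (fun t x => kap (t * x)) 1
  (measurable_itv _) (mu_itv_lty _ _) measurableT (rapid_integrable pr) mk
  (fun s u _ _ => k1 _).
split=> //; apply: eq_Rintegral => t _; apply: eq_Rintegral => x _.
by rewrite mulrC.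
Qed.

Lemma int_cos_kernel (x N : R) : x != 0 -> 0 <= N ->
  \int[mu]_(t in `[0, N]) cos (t * x) = sin (N * x) / x.
Proof.
move=> x0 N0; under eq_Rintegral do rewrite mulrC.
by rewrite int_cos// mulr0 sin0 subr0 mulrC [x * N]mulrC mulrC.
Qed.

Lemma int_sin_kernel (x N : R) : x != 0 -> 0 <= N ->
  \int[mu]_(t in `[0, N]) sin (t * x) = (1 - cos (N * x)) / x.
Proof.
move=> x0 N0; under eq_Rintegral do rewrite mulrC.
by rewrite int_sin// mulr0 cos0 [x * N]mulrC.
Qed.

(** The integral of cosT psi over [0, n] is the Dirichlet integral at frequency n
    of the even function psi(x) + psi(- x), whose value at 0 is 2 psi(0). *)
Lemma half_line_cosT (psi dpsi : R -> R) : C1rapid psi dpsi ->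
  mu.-integrable `]0, +oo[ (EFin \o cosT psi) ->
  \int[mu]_(t in `]0, +oo[) cosT psi t = pi * psi 0.
Proof.
move=> pC iC; have [dp cdp pr dpr] := pC.
have H1 := half_line_trunc iC.
have H2 := dirichlet_rapid (C1rapid_even pC).
have E (n : nat) : \int[mu]_(t in `[0, n%:R]) cosT psi t =
    \int[mu]_(x in `]0, +oo[) (sin (n%:R * x) / x * (psi x + psi (- x))).
  have [iF ->] := transform_Fubini n%:R (@continuous_cos R) (@cos_max R) pr.
  have [_ ->] := Rintegral_fold iF.
  apply: eq_Rintegral => x; rewrite inE/= in_itv/= andbT => x0.
  rewrite !int_cos_kernel ?oppr_eq0 ?gt_eqF// mulrN sinN invrN mulrNN.
  ring.
rewrite -(cvg_lim _ H1)//; under eq_fun do rewrite E.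
by rewrite (cvg_lim _ H2)// oppr0; field.
Qed.

(** Near 0 the difference is at most 2 C x for C a bound of the derivative; beyond 1
    it decreases like x ^- 2. *)
Lemma odd_quotient_integrable (psi dpsi : R -> R) : C1rapid psi dpsi ->
  mu.-integrable `]0, +oo[ (fun x => ((psi x - psi (- x)) / x)%:E).
Proof.
move=> pC; have [dp cdp pr dpr] := pC.
have [mpsi pb] := pr; have [_ dpb] := dpr.
have [C HC] := dpb 0; have [A0 HA0] := pb 0; have [A2 HA2] := pb 2.
have C0 : 0 <= C by rewrite (le_trans _ (HC 0))// mulr_ge0.
have A00 : 0 <= A0 by rewrite (le_trans _ (HA0 0))// mulr_ge0.
have A20 : 0 <= A2 by rewrite (le_trans _ (HA2 0))// mulr_ge0.
(* For x <= 1 the quotient is at most 2 C and 1 + x ^ 2 at most 2. *)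
pose K := 4 * C + 2 * A0 + 2 * A2.
have [i1 _] := @integrable_oneDsqrV R.
have i2 : mu.-integrable `]0, +oo[ (fun x : R => (K * (1 + x ^+ 2)^-1)%:E).
  by apply: integrable_mull => //; apply: integrableS i1.
apply: le_integrable i2 => //.
  apply/measurable_EFinP; apply: measurable_funTS; apply: measurable_funM.
    apply: measurable_funB => //; apply: (measurableT_comp mpsi).
    by apply: continuous_measurable_fun; exact: opp_continuous.
  exact: measurable_inv.
move=> x; rewrite /= in_itv/= andbT => x0.
rewrite lee_fin; apply: le_trans (ler_norm _).
have x2 : 0 < 1 + x ^+ 2 by rewrite ltr_pwDl// sqr_ge0.
rewrite ler_pdivlMr// normrM normfV (gtr0_norm x0).
have [x1|x1] := leP x 1.
  have b : `|psi x - psi (- x)| <= C * (x + x).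
    have dF (y : R) : - x <= y <= x -> is_derive y 1 psi (dpsi y) by move=> _.
    have xx : - x <= x by rewrite ge0_cp// ltW.
    rewrite -(FTC_itv xx _ dF); last by move=> y _; exact: cdp.
    rewrite -[x in X in _ <= _ * (_ + X)]opprK -Rintegral_cst_itv//.
    apply: le_Rintegral_bound => //; try exact: continuous_integrable_itv.
      by apply: continuous_integrable_itv; exact: cst_continuous.
    by move=> y _; have := HC y; rewrite expr0 mul1r.
  rewrite mulrAC ler_pdivrMr//.
  apply: (@le_trans _ _ (C * (x + x) * (1 + 1))).
    by rewrite ler_pM// ?addr_ge0 ?sqr_ge0// lerD2l expr_le1// ltW.
  rewrite /K; have : 0 <= (2 * A0 + 2 * A2) * x by rewrite mulr_ge0 ?addr_ge0 ?mulr_ge0// ltW.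
  lra.
have HAx := HA0 x; have HAy := HA0 (- x); have HAu := HA2 x; have HAv := HA2 (- x).
move: HAx HAy HAu HAv; rewrite !expr0 !mul1r normrN (gtr0_norm x0) => HAx HAy HAu HAv.
apply: (@le_trans _ _ (`|psi x - psi (- x)| * (1 + x ^+ 2))).
  by rewrite ler_wpM2r ?(ltW x2)// ler_piMr// invf_le1// ltW.
apply: (@le_trans _ _ ((`|psi x| + `|psi (- x)|) * (1 + x ^+ 2))).
  by rewrite ler_wpM2r ?(ltW x2)// ler_normB.
rewrite /K; lra.
Qed.

(** The integral of sinT psi over [0, n] is that of w(x) (1 - cos(n x)), with w the
    odd difference divided by x, to which the Riemann-Lebesgue lemma applies. *)
Lemma half_line_sinT (psi dpsi : R -> R) : C1rapid psi dpsi ->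
  mu.-integrable `]0, +oo[ (EFin \o sinT psi) ->
  \int[mu]_(t in `]0, +oo[) sinT psi t =
  \int[mu]_(x in `]0, +oo[) ((psi x - psi (- x)) / x).
Proof.
move=> pC iS; have [dp cdp pr dpr] := pC.
have cp := C1rapid_continuous pC.
have H1 := half_line_trunc iS.
have iw := odd_quotient_integrable pC.
pose w x := (psi x - psi (- x)) / x.
pose dw x := (dpsi x + dpsi (- x)) / x - (psi x - psi (- x)) / x ^+ 2.
have dwP (x : R) : 0 < x -> is_derive x 1 w (dw x).
  move=> x0; have xn0 : x != 0 by rewrite gt_eqF.
  have ? := dp x.
  have ? : is_derive x 1 (fun x => psi (- x)) (dpsi (- x) * -1).
    by have ? := dp (- x); apply: is_derive1_comp.
  have ? : is_derive x 1 (fun y : R => y^-1) (- x ^- 2 *: 1).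
    exact: (@is_deriveV R id x 1 1 xn0).
  by rewrite /w; apply: is_derive_eq; rewrite /GRing.scale/= /dw; field.
have cN (h : R -> R) : continuous h -> continuous (fun x => h (- x)).
  by move=> ch x; apply: continuous_comp; [exact: opp_continuous|exact: ch].
have cdw (x : R) : 0 < x -> {for x, continuous dw}.
  move=> x0; have xn0 : x != 0 by rewrite gt_eqF.
  apply: cvgB; apply: cvgM.
  - by apply: cvgD; [exact: cdp|exact: cN].
  - by apply: cvgV => //; exact: cvg_id.
  - by apply: cvgB; [exact: cp|exact: cN].
  - by apply: cvgV; [rewrite expf_neq0|exact: exprn_continuous].
have H2 := riemann_lebesgue dwP cdw iw.
have H3 : (\int[mu]_(x in `]0, +oo[) w x -
    \int[mu]_(x in `]0, +oo[) (w x * cos (n%:R * x))) @[n --> \oo] -->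
    \int[mu]_(x in `]0, +oo[) w x - 0.
  by apply: cvgB => //; exact: cvg_cst.
have E (n : nat) : \int[mu]_(t in `[0, n%:R]) sinT psi t =
    \int[mu]_(x in `]0, +oo[) w x - \int[mu]_(x in `]0, +oo[) (w x * cos (n%:R * x)).
  have [iF ->] := transform_Fubini n%:R (@continuous_sin R) (@sin_max R) pr.
  have [_ ->] := Rintegral_fold iF.
  rewrite -RintegralB//; last first.
    apply: (@integrable_Mbounded _ _ _ _ 1) => //; last by move=> *; exact: cos_max.
    by apply: measurable_funTS; apply: continuous_measurable_fun; exact: continuous_cosM.
  apply: eq_Rintegral => x; rewrite inE/= in_itv/= andbT => x0.
  rewrite !int_sin_kernel ?oppr_eq0 ?gt_eqF// mulrN cosN invrN /w.
  ring.
rewrite -(cvg_lim _ H1)//; under eq_fun do rewrite E.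
by rewrite (cvg_lim _ H3)// subr0.
Qed.

End half_line_formulas.

(** * Schwartz functions and tempered distributions *)

Section schwartz_functions.
Context {R : realType}.
Notation mu := (@lebesgue_measure R).
Local Notation Re := (@complex.Re _).
Local Notation Im := (@complex.Im _).
Local Notation normc := ComplexField.Normc.normc.
Implicit Types (phi psi : R -> R[i]) (u v : R -> R).

Lemma schwartz_cderive phi : schwartz phi -> schwartz (cderive phi).
Proof.
move=> [d b]; split.
  by move=> k x; rewrite -iterSr; exact: d.
by move=> j k; have := b j k.+1; rewrite /weighted_derivative iterSr.
Qed.

Lemma schwartz_iter phi k : schwartz phi -> schwartz (iter k cderive phi).
Proof. by move=> sp; elim: k => // k; exact: schwartz_cderive. Qed.

Lemma derivable_is_derive (h : R -> R) (x : R) : derivable h x 1 ->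
  is_derive x 1 h (derive1 h x).
Proof. by move=> dh; rewrite derive1E; exact: derivableP. Qed.

Lemma derivable_continuous (h : R -> R) : (forall x, derivable h x 1) -> continuous h.
Proof. by move=> dh x; apply/differentiable_continuous/derivable1_diffP. Qed.

Lemma schwartz_rapid phi : schwartz phi -> rapid (Re \o phi) /\ rapid (Im \o phi).
Proof.
move=> [d b]; have c x := d 0%N x.
split; split.
- by apply: continuous_measurable_fun; apply: derivable_continuous => x; case: (c x).
- move=> j; have [M HM] := b j 0%N; exists M => t.
  apply: (@le_trans _ _ (weighted_derivative j 0 phi t)); last by apply: HM; exists t.
  by rewrite ler_wpM2l ?exprn_ge0//; exact: abs_Re_le.
- by apply: continuous_measurable_fun; apply: derivable_continuous => x; case: (c x).
- move=> j; have [M HM] := b j 0%N; exists M => t.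
  apply: (@le_trans _ _ (weighted_derivative j 0 phi t)); last by apply: HM; exists t.
  by rewrite ler_wpM2l ?exprn_ge0//; exact: abs_Im_le.
Qed.

Lemma schwartz_C1rapid phi : schwartz phi ->
  C1rapid (Re \o phi) (Re \o cderive phi) /\ C1rapid (Im \o phi) (Im \o cderive phi).
Proof.
move=> sp; have [r1 r2] := schwartz_rapid sp.
have [r3 r4] := schwartz_rapid (schwartz_cderive sp).
have [d1 _] := sp; have [d2 _] := schwartz_cderive sp.
have d1Re x : derivable (Re \o phi) x 1 := proj1 (d1 0%N x).
have d1Im x : derivable (Im \o phi) x 1 := proj2 (d1 0%N x).
have d2Re x : derivable (Re \o cderive phi) x 1 := proj1 (d2 0%N x).
have d2Im x : derivable (Im \o cderive phi) x 1 := proj2 (d2 0%N x).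
split; apply: And4.
- by move=> x; exact: derivable_is_derive (d1Re x).
- exact: derivable_continuous d2Re.
- exact: r1.
- exact: r3.
- by move=> x; exact: derivable_is_derive (d1Im x).
- exact: derivable_continuous d2Im.
- exact: r2.
- exact: r4.
Qed.

(** Multiplying by t exchanges the transforms of p k with those of p k.+1, up to sign,
    and these are bounded. *)
Lemma rapid_transforms (p : nat -> R -> R) : (forall k, C1rapid (p k) (p k.+1)) ->
  forall k, rapid (cosT (p k)) /\ rapid (sinT (p k)).
Proof.
move=> pC k; have [_ _ pr _] := pC k.
suff H j k' : (exists C, forall t, `|t| ^+ j * `|cosT (p k') t| <= C) /\
    (exists C, forall t, `|t| ^+ j * `|sinT (p k') t| <= C).
  split; split.
  - apply: continuous_measurable_fun; apply: continuous_transform => //.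
      exact: continuous_cos.
    exact: cos_max.
  - by move=> j; case: (H j k).
  - apply: continuous_measurable_fun; apply: continuous_transform => //.
      exact: continuous_sin.
    exact: sin_max.
  - by move=> j; case: (H j k).
elim: j k' => [|j IH] k'.
  have [_ _ pr' _] := pC k'.
  split; exists (\int[mu]_x `|p k' x|) => t; rewrite expr0 mul1r.
    exact: cosT_le.
  exact: sinT_le.
have [[A HA] [B HB]] := IH k'.+1.
split; [exists B|exists A] => t; rewrite exprSr -mulrA -normrM.
  by have := HB t; rewrite (sinT_derive _ (pC k')) normrN.
by have := HA t; rewrite (cosT_derive _ (pC k')).
Qed.

Lemma schwartz_transforms phi : schwartz phi ->
  [/\ rapid (cosT (Re \o phi)), rapid (sinT (Re \o phi)),
      rapid (cosT (Im \o phi)) & rapid (sinT (Im \o phi))].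
Proof.
move=> sp.
have [] := @rapid_transforms (fun k => Re \o iter k cderive phi) _ 0%N.
  by move=> k; have [] := schwartz_C1rapid (schwartz_iter k sp).
have [] := @rapid_transforms (fun k => Im \o iter k cderive phi) _ 0%N.
  by move=> k; have [] := schwartz_C1rapid (schwartz_iter k sp).
by [].
Qed.

Lemma fourierE phi t : schwartz phi ->
  fourier phi t = (cosT (Re \o phi) t + sinT (Im \o phi) t) +i*
                  (cosT (Im \o phi) t - sinT (Re \o phi) t).
Proof.
move=> /schwartz_rapid[r1 r2]; rewrite /fourier /cintegral; congr (_ +i* _).
  rewrite /cosT /sinT -RintegralD//; [|exact: integrable_cosT|exact: integrable_sinT].
  by apply: eq_Rintegral => x _; rewrite complex_ReM /= cosN sinN mulNr opprK.
rewrite /cosT /sinT -RintegralB//; [|exact: integrable_cosT|exact: integrable_sinT].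
by apply: eq_Rintegral => x _; rewrite complex_ImM /= cosN sinN mulNr.
Qed.

Lemma fourier_cderive phi t : schwartz phi ->
  fourier (cderive phi) t = 'i * t%:C * fourier phi t.
Proof.
move=> sp; have [C1 C2] := schwartz_C1rapid sp.
rewrite !fourierE//; last exact: schwartz_cderive.
rewrite (cosT_derive _ C1) (cosT_derive _ C2) (sinT_derive _ C1) (sinT_derive _ C2).
by apply: complex_eq; rewrite /=; ring.
Qed.

Lemma fourier_iter_cderive phi k t : schwartz phi ->
  fourier (iter k cderive phi) t = ('i * t%:C) ^+ k * fourier phi t.
Proof.
move=> sp; elim: k => [|k IH]; first by rewrite expr0 mul1r.
by rewrite iterS fourier_cderive ?IH ?exprS ?mulrA//; exact: schwartz_iter.
Qed.

(** Everything the pairing with a slow function needs from a test function; it holds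
    for Schwartz functions and for their transforms. *)
Definition crapid (chi : R -> R[i]) := rapid (Re \o chi) /\ rapid (Im \o chi).

Lemma crapid_fourier phi : schwartz phi -> crapid (fourier phi).
Proof.
move=> sp; have [r1 r2 r3 r4] := schwartz_transforms sp.
have -> : fourier phi = fun t => (cosT (Re \o phi) t + sinT (Im \o phi) t) +i*
                  (cosT (Im \o phi) t - sinT (Re \o phi) t).
  by apply/funext => t; exact: fourierE.
split; first exact: (rapidD r1 r4).
exact: (rapidD r3 (rapidN r2)).
Qed.

Lemma regularE u (chi : R -> R[i]) :
  regular u chi = (\int[mu]_t (u t * (Re \o chi) t)) +i* (\int[mu]_t (u t * (Im \o chi) t)).
Proof.
rewrite /regular /cintegral; congr (_ +i* _); apply: eq_Rintegral => t _.
  by rewrite complex_ReM /= mul0r subr0.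
by rewrite complex_ImM /= mul0r addr0.
Qed.

Lemma cintegrable_regular u (chi : R -> R[i]) : slow u -> crapid chi ->
  cintegrable setT (fun t => (u t)%:C * chi t).
Proof.
move=> us [r1 r2]; split.
- apply: eq_integrable (slow_rapid_integrable us r1) => // t _.
  by rewrite complex_ReM /= mul0r subr0.
- apply: eq_integrable (slow_rapid_integrable us r2) => // t _.
  by rewrite complex_ImM /= mul0r addr0.
Qed.

Lemma regularD u v (chi : R -> R[i]) : slow u -> slow v -> crapid chi ->
  regular (fun t => u t + v t) chi = regular u chi + regular v chi.
Proof.
move=> us vs [r1 r2]; rewrite !regularE; apply: complex_eq => /=.
  rewrite -RintegralD//; try exact: slow_rapid_integrable.
  by apply: eq_Rintegral => t _; rewrite mulrDl.
rewrite -RintegralD//; try exact: slow_rapid_integrable.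
by apply: eq_Rintegral => t _; rewrite mulrDl.
Qed.

Lemma regularZ (c : R) u (chi : R -> R[i]) : slow u -> crapid chi ->
  regular (fun t => c * u t) chi = c%:C * regular u chi.
Proof.
move=> us [r1 r2]; rewrite !regularE; apply: complex_eq => /=.
  rewrite mul0r subr0 -RintegralZl//; last exact: slow_rapid_integrable.
  by apply: eq_Rintegral => t _; rewrite mulrA.
rewrite mul0r addr0 -RintegralZl//; last exact: slow_rapid_integrable.
by apply: eq_Rintegral => t _; rewrite mulrA.
Qed.

Lemma regular_linear u (c : R[i]) (chi1 chi2 : R -> R[i]) :
  slow u -> crapid chi1 -> crapid chi2 ->
  regular u (fun x => c * chi1 x + chi2 x) = c * regular u chi1 + regular u chi2.
Proof.
move=> us [r1 r2] [r3 r4]; rewrite !regularE.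
have i1 := slow_rapid_integrable us r1; have i2 := slow_rapid_integrable us r2.
have i3 := slow_rapid_integrable us r3; have i4 := slow_rapid_integrable us r4.
case: c => a b; apply: complex_eq => /=.
  rewrite -!RintegralZl// -RintegralB//; [|exact: integrable_mull..].
  rewrite -RintegralD//; last by apply: integrable_subr => //; exact: integrable_mull.
  by apply: eq_Rintegral => t _; rewrite /= complex_ReD complex_ReM /=; ring.
rewrite -!RintegralZl// -RintegralD//; [|exact: integrable_mull..].
rewrite -RintegralD//; last by apply: integrable_addr => //; exact: integrable_mull.
by apply: eq_Rintegral => t _; rewrite /= complex_ImD complex_ImM /=; ring.
Qed.

Lemma slow_cst (c : R) : slow (fun=> c).
Proof. by apply: (@slow_bounded _ _ `|c|) => //; exact: measurable_cst. Qed.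

Lemma slow_sum (n : nat) (c : nat -> R) (w : nat -> R -> R) : (forall k, slow (w k)) ->
  slow (fun t => \sum_(k < n) c k * w k t).
Proof.
move=> ws; elim: n => [|n IH].
  by under eq_fun do rewrite big_ord0; exact: slow_cst.
under eq_fun do rewrite big_ord_recr.
by apply: slowD => //; apply: slowM => //; exact: slow_cst.
Qed.

Lemma regular_sum (n : nat) (c : nat -> R) (w : nat -> R -> R) (chi : R -> R[i]) :
  (forall k, slow (w k)) -> crapid chi ->
  regular (fun t => \sum_(k < n) c k * w k t) chi =
  \sum_(k < n) (c k)%:C * regular (w k) chi.
Proof.
move=> ws cr; elim: n => [|n IH].
  rewrite big_ord0 regularE.
  by apply: complex_eq; rewrite /=; under eq_Rintegral do rewrite big_ord0 mul0r;
     rewrite Rintegral_cst// mul0r.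
rewrite big_ord_recr /= -IH -regularZ// -regularD//.
- by congr (regular _ _); apply/funext => t; rewrite big_ord_recr.
- exact: slow_sum.
- by apply: slowM => //; exact: slow_cst.
Qed.

Lemma seminorm_ge (phi : R -> R[i]) j k x : schwartz phi ->
  weighted_derivative j k phi x <= schwartz_seminorm j k phi.
Proof. by move=> [_ b]; apply: ub_le_sup => //; exists x. Qed.

Lemma seminorm_ge0 (phi : R -> R[i]) j k : schwartz phi -> 0 <= schwartz_seminorm j k phi.
Proof.
move=> sp; apply: le_trans (seminorm_ge j k 0 sp).
by rewrite mulr_ge0 ?exprn_ge0//; exact: le_trans (abs_Re_le _).
Qed.

(** With growth exponent n, the seminorms with j = 0, 2, n, n + 2 and k = 0 control
    the weight (1 + t ^ 2) (1 + |t| ^ n) of the previous comparison. *)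
Lemma slow_defines_tempered u : slow u -> defines_tempered u.
Proof.
move=> us; have [mu_ [A [n [A0 uA]]]] := us; split.
  by move=> phi sp; apply: cintegrable_regular => //; exact: schwartz_rapid.
split.
  by move=> c phi psi sp ss; apply: regular_linear => //; exact: schwartz_rapid.
(* The factor 4 counts the seminorms used, and 2 the components. *)
exists (2 * (A * 4 * pi)), (2 + n)%N => phi sp.
pose s j := schwartz_seminorm j 0 phi.
set S := \sum_(j < _) _.
have S_ge j : (j <= 2 + n)%N -> s j <= S.
  move=> jn; have j1 : (j < (2 + n).+1)%N by [].
  rewrite /S (bigD1 (Ordinal j1))//= (bigD1 (ord0 : 'I_(2 + n).+1))//=.
  rewrite -addrA lerDl addr_ge0//; apply: sumr_ge0 => i _; first exact: seminorm_ge0.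
  by apply: sumr_ge0 => k _; exact: seminorm_ge0.
have bound (h : R[i] -> R) : (forall z, `|h z| <= normc z) -> forall t,
    (1 + t ^+ 2) * (1 + `|t| ^+ n) * `|h (phi t)| <= 4 * S.
  move=> hn t.
  have w j : (j <= 2 + n)%N -> `|t| ^+ j * normc (phi t) <= S.
    by move=> jn; apply: le_trans (S_ge _ jn); exact: (seminorm_ge j 0 t sp).
  apply: (@le_trans _ _ ((1 + t ^+ 2) * (1 + `|t| ^+ n) * normc (phi t))).
    by rewrite ler_wpM2l// mulr_ge0// addr_ge0 ?sqr_ge0.
  have := w 0%N (leq0n _); have := w 2 (leq_addr _ _).
  have := w n (leq_addl _ _); have := w (2 + n)%N (leqnn _).
  rewrite expr0 mul1r exprD -(real_normK (num_real t)).
  set a := `|t| ^+ 2; set b := `|t| ^+ n; set c := normc _ => *.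
  by rewrite mulrDl !mulrDr !mulr1 !mul1r !mulrDl !mul1r; lra.
have [r1 r2] := schwartz_rapid sp.
have [_ b1] := weighted_integrable mu_ (proj1 r1) A0 uA (bound _ abs_Re_le).
have [_ b2] := weighted_integrable mu_ (proj1 r2) A0 uA (bound _ abs_Im_le).
apply: (le_trans (normc_le_abs _)); rewrite regularE /=.
apply: (le_trans (lerD b1 b2)).
have -> : A * (4 * S) * pi + A * (4 * S) * pi = 2 * (A * 4 * pi) * S by ring.
exact: lexx.
Qed.

End schwartz_functions.

(** * The Fourier transform of powers on a half-line, and the theorem *)

Section heaviside_transform.
Context {R : realType}.
Notation mu := (@lebesgue_measure R).
Local Notation Re := (@complex.Re _).
Local Notation Im := (@complex.Im _).
Implicit Types (phi psi : R -> R[i]).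

Lemma heaviside_le1 (x : R) : `|heaviside x| <= 1.
Proof.
rewrite /heaviside; case: ifP => _; first by rewrite normr1.
case: ifP => _; last by rewrite normr0.
by rewrite normfV invf_le1 ger0_norm// ler1n.
Qed.

Lemma heaviside_measurable : measurable_fun setT (@heaviside R).
Proof.
apply: nondecreasing_measurable => // x y xy; rewrite /heaviside.
by case: (ltgtP 0 x) => x0; case: (ltgtP 0 y) => y0; lra.
Qed.

Lemma slow_heaviside : slow (@heaviside R).
Proof. exact: slow_bounded heaviside_measurable heaviside_le1. Qed.

Lemma slow_heavisideN : slow (fun t => @heaviside R (- t)).
Proof.
apply: (@slow_bounded _ _ 1) => [|t]; last exact: heaviside_le1.
apply: measurableT_comp; first exact: heaviside_measurable.
by apply: continuous_measurable_fun; exact: opp_continuous.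
Qed.

Lemma Rintegral_heaviside (v : R -> R) : rapid v ->
  \int[mu]_t (heaviside t * v t) = \int[mu]_(t in `]0, +oo[) v t.
Proof.
move=> vr; have [_ ->] := Rintegral_fold (slow_rapid_integrable slow_heaviside vr).
apply: eq_Rintegral => t; rewrite inE/= in_itv/= andbT => t0.
by rewrite heaviside_gt0// heaviside_lt0 ?oppr_lt0// mul1r mul0r addr0.
Qed.

Lemma Rintegral_heavisideN (v : R -> R) : rapid v ->
  \int[mu]_t (heaviside (- t) * v t) = \int[mu]_(t in `]0, +oo[) v (- t).
Proof.
move=> vr; have [_ ->] := Rintegral_fold (slow_rapid_integrable slow_heavisideN vr).
apply: eq_Rintegral => t; rewrite inE/= in_itv/= andbT => t0.
by rewrite opprK (heaviside_gt0 t0) heaviside_lt0 ?oppr_lt0// mul1r mul0r add0r.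
Qed.

Lemma cosTN (p : R -> R) t : cosT p (- t) = cosT p t.
Proof. by apply: eq_Rintegral => x _; rewrite mulNr cosN. Qed.

Lemma sinTN (p : R -> R) t : rapid p -> sinT p (- t) = - sinT p t.
Proof.
move=> pr; rewrite /sinT -[RHS]mulN1r -RintegralZl//; last exact: integrable_sinT.
by apply: eq_Rintegral => x _; rewrite mulNr sinN mulN1r mulNr.
Qed.

Lemma pv_invE phi : pv_inv phi =
  (\int[mu]_(x in `]0, +oo[) (((Re \o phi) x - (Re \o phi) (- x)) / x)) +i*
  (\int[mu]_(x in `]0, +oo[) (((Im \o phi) x - (Im \o phi) (- x)) / x)).
Proof.
rewrite /pv_inv /cintegral; congr (_ +i* _); apply: eq_Rintegral => x _ /=.
  by rewrite complex_ReM /= mul0r subr0 mulrC; case: (phi x) (phi (- x)) => a b [].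
by rewrite complex_ImM /= mul0r addr0 mulrC; case: (phi x) (phi (- x)) => a b [].
Qed.

Lemma rapid_half_line (v : R -> R) : rapid v -> mu.-integrable `]0, +oo[ (EFin \o v).
Proof. by move=> /rapid_integrable; apply: integrableS. Qed.

(** The components of the transform of psi are sums of cosT and sinT of the
    components of psi; the cosines give pi psi(0), the sines the principal value. *)
Lemma heaviside_fourier psi : schwartz psi ->
  regular heaviside (fourier psi) = pi%:C * psi 0 - 'i * pv_inv psi.
Proof.
move=> sp; have [C1 C2] := schwartz_C1rapid sp.
have [r1 r2 r3 r4] := schwartz_transforms sp.
have [f1 f2] := crapid_fourier sp.
have [i1 i2 i3 i4] := And4 (rapid_half_line r1) (rapid_half_line r2)
  (rapid_half_line r3) (rapid_half_line r4).
rewrite regularE !Rintegral_heaviside//.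
have -> : fourier psi = fun t => (cosT (Re \o psi) t + sinT (Im \o psi) t) +i*
                  (cosT (Im \o psi) t - sinT (Re \o psi) t).
  by apply/funext => t; exact: fourierE.
rewrite RintegralD//= RintegralB//.
rewrite (half_line_cosT C1)// (half_line_cosT C2)// (half_line_sinT C1)// (half_line_sinT C2)//.
rewrite pv_invE; apply: complex_eq => /=; case: (psi 0) => a b /=; ring.
Qed.

(** Reflecting the line keeps the cosines and changes the sign of the sines. *)
Lemma heavisideN_fourier psi : schwartz psi ->
  regular (fun t => heaviside (- t)) (fourier psi) = pi%:C * psi 0 + 'i * pv_inv psi.
Proof.
move=> sp; have [C1 C2] := schwartz_C1rapid sp.
have [p1 p2] := schwartz_rapid sp.
have [r1 r2 r3 r4] := schwartz_transforms sp.
have [f1 f2] := crapid_fourier sp.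
have [i1 i2 i3 i4] := And4 (rapid_half_line r1) (rapid_half_line r2)
  (rapid_half_line r3) (rapid_half_line r4).
rewrite regularE !Rintegral_heavisideN//.
have -> : fourier psi = fun t => (cosT (Re \o psi) t + sinT (Im \o psi) t) +i*
                  (cosT (Im \o psi) t - sinT (Re \o psi) t).
  by apply/funext => t; exact: fourierE.
rewrite /=; under eq_Rintegral do rewrite cosTN sinTN//.
under [X in _ +i* X = _]eq_Rintegral do rewrite cosTN sinTN// opprK.
rewrite RintegralB// RintegralD//=.
rewrite (half_line_cosT C1)// (half_line_cosT C2)// (half_line_sinT C1)// (half_line_sinT C2)//.
rewrite pv_invE; apply: complex_eq => /=; case: (psi 0) => a b /=; ring.
Qed.

(** Each distributional derivative moves to the test function with a sign. *)
Lemma iter_dist_derive k (u : functional) phi :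
  iter k dist_derive u phi = (-1) ^+ k * u (iter k cderive phi).
Proof.
elim: k phi => [|k IH] phi; first by rewrite expr0 mul1r.
by rewrite iterS /dist_derive IH -iterSr exprS mulN1r mulNr.
Qed.

Lemma inv_powE k phi : inv_pow k phi = pv_inv (iter k cderive phi) / (k`!)%:R.
Proof.
by rewrite /inv_pow iter_dist_derive mulrACA -expr2 sqrr_sign mul1r mulrC.
Qed.

Lemma invc_i : ('i : R[i])^-1 = - 'i.
Proof.
have i0 : ('i : R[i]) != 0 by rewrite eq_complex /= oner_eq0 andbF.
by apply: (mulfI i0); rewrite divff// mulrN -expr2 sqr_i opprK.
Qed.

Lemma regular_scale (u : R -> R) (c : R[i]) (chi : R -> R[i]) : slow u -> crapid chi ->
  regular u (fun t => c * chi t) = c * regular u chi.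
Proof.
(* Writing c chi as (c - 1) chi + chi avoids a zero test function. *)
move=> us cr; have := regular_linear (c - 1) us cr cr.
rewrite -[X in _ = _ + X]mul1r -mulrDl subrK => <-.
by congr (regular _ _); apply/funext => t; rewrite mulrBl mul1r subrK.
Qed.

(** Since (i t) ^ k phi-hat(t) is the transform of the k-th derivative of phi. *)
Lemma regular_power_fourier (u : R -> R) k phi : slow u -> schwartz phi ->
  regular (fun t => u t * t ^+ k) (fourier phi) =
  (- 'i) ^+ k * regular u (fourier (iter k cderive phi)).
Proof.
move=> us sp; rewrite -regular_scale//; last exact/crapid_fourier/schwartz_iter.
rewrite /regular; congr (cintegral _ _); apply/funext => t.
have E : (t ^+ k)%:C = (- 'i) ^+ k * ('i * t%:C) ^+ k :> R[i].
  by rewrite -exprMn mulrA mulNr -expr2 sqr_i opprK mul1r rmorphXn.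
by rewrite fourier_iter_cderive// rmorphM /= E !mulrA.
Qed.

(** Uses 1 / i = - i to move the powers of i to the denominator. *)
Lemma power_half_line_algebra k (a b : R[i]) :
  (- 'i) ^+ k * (pi%:C * a - 'i * b) =
  pi%:C * 'i ^+ k * ((-1) ^+ k * a) + (k`!)%:R / 'i ^+ k.+1 * (b / (k`!)%:R).
Proof.
have kn0 : (k`!)%:R != 0 :> R[i] by rewrite pnatr_eq0 -lt0n fact_gt0.
rewrite mulrBr; congr (_ + _).
  by rewrite (exprNn 'i); set c := (-1) ^+ k; set d := 'i ^+ k; ring.
rewrite [b / _]mulrC mulrACA divff// mul1r -exprVn invc_i exprS.
by set c := (- 'i) ^+ k; ring.
Qed.

Lemma power_half_lineN_algebra k (a b : R[i]) :
  (- 'i) ^+ k * (pi%:C * a + 'i * b) =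
  pi%:C * 'i ^+ k * ((-1) ^+ k * a) - (k`!)%:R / 'i ^+ k.+1 * (b / (k`!)%:R).
Proof.
have := power_half_line_algebra k a (- b).
by rewrite mulrN opprK mulNr mulrN.
Qed.

Lemma fourier_heaviside_power k phi : schwartz phi ->
  regular (fun t => heaviside t * t ^+ k) (fourier phi) =
  pi%:C * 'i ^+ k * iter k dist_derive dirac_dist phi
    + (k`!)%:R / 'i ^+ k.+1 * inv_pow k phi.
Proof.
move=> sp; rewrite regular_power_fourier//; last exact: slow_heaviside.
rewrite heaviside_fourier; last exact: schwartz_iter.
by rewrite iter_dist_derive inv_powE power_half_line_algebra.
Qed.

Lemma fourier_heavisideN_power k phi : schwartz phi ->
  regular (fun t => heaviside (- t) * t ^+ k) (fourier phi) =
  pi%:C * 'i ^+ k * iter k dist_derive dirac_dist phi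
    - (k`!)%:R / 'i ^+ k.+1 * inv_pow k phi.
Proof.
move=> sp; rewrite regular_power_fourier//; last exact: slow_heavisideN.
rewrite heavisideN_fourier; last exact: schwartz_iter.
by rewrite iter_dist_derive inv_powE power_half_lineN_algebra.
Qed.

End heaviside_transform.

Theorem theorem4p3 (R : realType) (f : R -> R)
  (f_bv : forall a b : R, a < b -> bounded_variation a b f)
  (np nm : nat) (ap am : nat -> R) (pp pm : {poly R})
  (pp_def : pp = \poly_(k < np.+1) ap k)
  (pm_def : pm = \poly_(k < nm.+1) am k)
  (f_pp : f ~_(pinfty_nbhs R) (fun x => pp.[x]))
  (f_pm : f ~_(ninfty_nbhs R) (fun x => pm.[x]))
  (g : R -> R)
  (g_def : forall x, g x = f x - heaviside x * pp.[x] - heaviside (- x) * pm.[x])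
  (g_bv : bounded_variation_line g)
  (g_pinfty : g x @[x --> +oo] --> (0 : R))
  (g_ninfty : g x @[x --> -oo] --> (0 : R)) :
  [/\ defines_tempered f, defines_tempered g &
      forall phi : R -> R[i], schwartz phi ->
        dist_fourier (regular f) phi =
          dist_fourier (regular g) phi
          + \sum_(k < np.+1) (ap k)%:C *
              (pi%:C * 'i ^+ k * iter k dist_derive dirac_dist phi
               + (k`!)%:R / 'i ^+ k.+1 * inv_pow k phi)
          + \sum_(k < nm.+1) (am k)%:C *
              (pi%:C * 'i ^+ k * iter k dist_derive dirac_dist phi
               - (k`!)%:R / 'i ^+ k.+1 * inv_pow k phi)] /\
  [/\ forall s : R, s != 0 ->
        cvg ((fourier_partial g s AB : R[i]^o)
               @[AB --> filter_prod (ninfty_nbhs R) (pinfty_nbhs R)]),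
      forall x S T : R, 0 < S ->
        cintegrable (annulus S T)
          (fun s => expi (x * s) * fourier_improper g s) &
      forall x : R,
        [/\ cvg (f t @[t --> x^'-]), cvg (f t @[t --> x^'+]) &
          exists2 L : R[i],
            (cintegral (annulus ST.1 ST.2)
                (fun s => expi (x * s) * fourier_improper g s) : R[i]^o)
              @[ST --> filter_prod (0^'+ : set_system R) (pinfty_nbhs R)] --> (L : R[i]^o) &
            ((lim (f t @[t --> x^'-]) + lim (f t @[t --> x^'+])) / 2)%:C =
              (2 * pi)^-1%:C * L
              + (heaviside x * pp.[x] + heaviside (- x) * pm.[x])%:C]].

Proof.
have gm : (g \o -%R) t @[t --> +oo] --> (0 : R) by exact/cvgNy_compNP.
have gNbv := bounded_variation_line_opp g_bv.
have [mg [M gM]] := bv_measurable_bounded g_bv g_pinfty g_ninfty.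
have gs : slow g := slow_bounded mg gM.
have decomp x : exists p1 p2 m1 m2, [/\ decays p1, decays p2, decays m1 & decays m2] /\
    (forall u, 0 < u -> g (x + u) = p1 u - p2 u) /\
    (forall u, 0 < u -> g (x - u) = m1 u - m2 u).
  have [p1 [p2 [p1d p2d pE]]] := bounded_variation_line_decomp x g_bv g_pinfty.
  have [m1 [m2 [m1d m2d mE]]] := bounded_variation_line_decomp (- x) gNbv gm.
  exists p1, p2, m1, m2; split => //; split => // u u0.
  by rewrite -mE//= opprD opprK.
pose wp (k : nat) (t : R) := heaviside t * t ^+ k.
pose wm (k : nat) (t : R) := heaviside (- t) * t ^+ k.
have fE : f = fun t => g t + \sum_(k < np.+1) ap k * wp k t +
    \sum_(k < nm.+1) am k * wm k t.
  apply/funext => t; rewrite g_def pp_def pm_def !horner_poly !mulr_sumr.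
  have -> : \sum_(k < np.+1) ap k * wp k t =
      \sum_(i < np.+1) heaviside t * (ap i * t ^+ i).
    by apply: eq_bigr => k _; exact: mulrCA.
  have -> : \sum_(k < nm.+1) am k * wm k t =
      \sum_(i < nm.+1) heaviside (- t) * (am i * t ^+ i).
    by apply: eq_bigr => k _; exact: mulrCA.
  by rewrite addrAC !subrK.
have sp k : slow (wp k).
  by apply: slowM; [exact: slow_heaviside|exact: slow_exp].
have sm k : slow (wm k).
  by apply: slowM; [exact: slow_heavisideN|exact: slow_exp].
have sgp : slow (fun t => g t + \sum_(k < np.+1) ap k * wp k t).
  by apply: slowD => //; exact: slow_sum.
have sS : slow (fun t => \sum_(k < nm.+1) am k * wm k t).
  exact: slow_sum.
split; split.
- by apply: slow_defines_tempered; rewrite fE; exact: slowD.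
- exact: slow_defines_tempered.
- move=> phi sphi; have cr := crapid_fourier sphi.
  rewrite /dist_fourier [in LHS]fE regularD// regularD//; last exact: slow_sum.
  rewrite !regular_sum//; congr (_ + _ + _); apply: eq_bigr => k _; congr (_ * _).
    exact: fourier_heaviside_power.
  exact: fourier_heavisideN_power.
- move=> s s0; have [p1 [p2 [m1 [m2 [[p1d p2d m1d m2d] [gp gm']]]]]] := decomp 0.
  apply/cvg_ex; eexists.
  exact: (cvg_fourier_partial mg gM p1d p2d m1d m2d gp gm' s0).
- move=> x S T S0; have [p1 [p2 [m1 [m2 [[p1d p2d m1d m2d] [gp gm']]]]]] := decomp x.
  exact: (cintegrable_annulus mg gM p1d p2d m1d m2d gp gm').
- move=> x; have [p1 [p2 [m1 [m2 [[p1d p2d m1d m2d] [gp gm']]]]]] := decomp x.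
  have fg t : f t = g t + heaviside t * pp.[t] + heaviside (- t) * pm.[t].
    by rewrite g_def addrAC !subrK.
  have cR : f t @[t --> x^'+] --> p1 0 - p2 0 + (if 0 <= x then 1 else 0) * pp.[x] +
      (if 0 < - x then 1 else 0) * pm.[x].
    under eq_fun do rewrite fg.
    apply: cvgD; [apply: cvgD; first exact: (cvg_at_right_decomp p1d p2d gp)|].
      apply: cvgM; first exact: cvg_heaviside_right.
      by apply: cvg_at_right_filter; exact: continuous_horner.
    apply: cvgM; first exact: cvg_heavisideN_right.
    by apply: cvg_at_right_filter; exact: continuous_horner.
  have cL : f t @[t --> x^'-] --> m1 0 - m2 0 + (if 0 < x then 1 else 0) * pp.[x] +
      (if 0 <= - x then 1 else 0) * pm.[x].
    under eq_fun do rewrite fg.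
    apply: cvgD; [apply: cvgD; first exact: (cvg_at_left_decomp m1d m2d gm')|].
      apply: cvgM; first exact: cvg_heaviside_left.
      by apply: cvg_at_left_filter; exact: continuous_horner.
    apply: cvgM; first exact: cvg_heavisideN_left.
    by apply: cvg_at_left_filter; exact: continuous_horner.
  split; [by apply/cvg_ex; eexists; exact: cL|by apply/cvg_ex; eexists; exact: cR|].
  exists (pi * (p1 0 - p2 0 + (m1 0 - m2 0)))%:C.
    exact: (cvg_cintegral_annulus mg gM p1d p2d m1d m2d gp gm').
  rewrite (cvg_lim _ cL)// (cvg_lim _ cR)// -rmorphM -rmorphD; congr (_%:C).
  rewrite (heaviside_mean x) (heaviside_mean (- x)).
  have mean (P a b p q c d e h : R) : P != 0 ->
      (b + c * p + d * q + (a + e * p + h * q)) / 2 =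
      (2 * P)^-1 * (P * (a + b)) + ((e + c) / 2 * p + (d + h) / 2 * q).
    by move=> P0; field.
  by apply: mean; rewrite gt_eqF// pi_gt0.
Qed.
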